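(* Let $(X,\mathcal B,\mu)$ be a probability measure space, let $T_1,\dots,T_k$ be commuting invertible jointly ergodic measure preserving transformations of $X$ and let $\varphi:\mathbb Z\to\mathbb Z$ be an unbounded generalized linear function. Then $$\lim_{N\to\infty}\frac1N\sum_{n=1}^N T_1^{\varphi(n)}f_1\cdots T_k^{\varphi(n)}f_k=\prod_{i=1}^k\int_X f_i\,d\mu\quad\text{in }L^2(X)\text{ for any } f_1,\dots,f_k\in L^\infty(X)$$ if and only if $\lim_{N\to\infty}\frac1N\sum_{n=1}^N\lambda^{\varphi(n)}=0$ for every $\lambda\in\mathrm{Eig}(T_1,\dots,T_k)\setminus\{1\}$. In particular, for any irrational $\alpha\in\mathbb R$, $$\lim_{N\to\infty}\frac1N\sum_{n=1}^N T_1^{[\alpha n]}f_1\cdots T_k^{[\alpha n]}f_k=\prod_{i=1}^k\int_X f_i\,d\mu\quad\text{in }L^2(X)\text{ for any } f_1,\dots,f_k\in L^\infty(X)$$ if and only if $e^{2\pi i\alpha^{-1}\mathbb Q}\cap\mathrm{Eig}(T_1,\dots,T_k)=\{1\}$, where $e^{2\pi i\alpha^{-1}\mathbb Q}=\{e^{2\pi i\alpha^{-1}q}:q\in\mathbb Q\}$.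
   Context: For $x\in\mathbb R$, $[x]$ is the integer part of $x$ and $\{x\}=x-[x]$. The set of generalized linear functions is the smallest set of functions $\mathbb R\to\mathbb R$ that contains all functions $x\mapsto ax+b$ ($a,b\in\mathbb R$) and is closed under addition, multiplication by real constants, and the operation $\varphi\mapsto[\varphi]$ (equivalently $\varphi\mapsto\{\varphi\}$). A generalized linear function $\mathbb Z\to\mathbb Z$ is the restriction to $\mathbb Z$ of a generalized linear function that takes integer values on $\mathbb Z$. Write $Tf(x)=f(Tx)$. Transformations $T_1,\dots,T_k$ are jointly ergodic if $\lim_{N\to\infty}\frac1N\sum_{n=1}^N T_1^nf_1\cdots T_k^nf_k=\prod_{i=1}^k\int_X f_i\,d\mu$ in $L^2$ norm for all $f_1,\dots,f_k\in L^\infty(X)$. For a measure preserving transformation $T$, $\mathrm{Eig}\,T=\{\lambda\in\mathbb C\setminus\{0\}: Tf=\lambda f\text{ for some nonzero } f\in L^2(X)\}$, and $\mathrm{Eig}(T_1,\dots,T_k)=\prod_{i=1}^k\mathrm{Eig}\,T_i=\{\lambda_1\cdots\lambda_k:\lambda_i\in\mathrm{Eig}\,T_i\}$. *)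

(* Defs.v *)
From mathcomp Require Export all_boot all_order all_algebra.
From mathcomp Require Export complex.
From mathcomp Require Export all_classical all_reals all_analysis.

Set Implicit Arguments.
Unset Strict Implicit.
Unset Printing Implicit Defensive.

Export Order.TTheory GRing.Theory Num.Theory.
Export numFieldNormedType.Exports.

Local Open Scope classical_set_scope.
Local Open Scope ring_scope.
Local Open Scope complex_scope.

Notation normc := ComplexField.Normc.normc.

Inductive gen_linear (R : realType) : (R -> R) -> Prop :=
| gen_linear_affine (a b : R) : gen_linear (fun x => a * x + b)
| gen_linear_add (f g : R -> R) :
    gen_linear f -> gen_linear g -> gen_linear (fun x => f x + g x)
| gen_linear_scale (c : R) (f : R -> R) :
    gen_linear f -> gen_linear (fun x => c * f x)
| gen_linear_floor (f : R -> R) :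
    gen_linear f -> gen_linear (fun x => (Num.floor (f x))%:~R).

Definition gen_linear_int (R : realType) (phi : int -> int) : Prop :=
  exists2 f : R -> R, gen_linear f & forall n : int, f n%:~R = (phi n)%:~R.

Definition unbounded (phi : int -> int) : Prop :=
  ~ exists M : int, forall n : int, `|phi n| <= M.

Section complex_valued.
Context (d : measure_display) (X : measurableType d) (R : realType).
Variable mu : {measure set X -> \bar R}.

Definition cmeasurable (f : X -> R[i]) : Prop :=
  measurable_fun setT (fun x => complex.Re (f x)) /\
  measurable_fun setT (fun x => complex.Im (f x)).

Definition Lnormc (p : \bar R) (f : X -> R[i]) : \bar R :=
  Lnorm mu p (fun x => (normc (f x))%:E).

Definition in_Lp (p : \bar R) (f : X -> R[i]) : Prop :=
  cmeasurable f /\ (Lnormc p f < +oo)%E.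

Definition cintegral (f : X -> R[i]) : R[i] :=
  (\int[mu]_x complex.Re (f x)) +i* (\int[mu]_x complex.Im (f x)).

End complex_valued.

Record mp_aut (d : measure_display) (X : measurableType d) (R : realType)
    (mu : {measure set X -> \bar R}) := MpAut {
  mp_fun :> X -> X;
  mp_inv : X -> X;
  mp_funK : cancel mp_fun mp_inv;
  mp_invK : cancel mp_inv mp_fun;
  mp_fun_measurable : measurable_fun setT mp_fun;
  mp_inv_measurable : measurable_fun setT mp_inv;
  mp_preserving : forall A : set X, measurable A ->
    pushforward mu mp_fun A = mu A }.

Section joint_ergodicity.
Context (d : measure_display) (X : measurableType d) (R : realType).
Variable mu : {measure set X -> \bar R}.

Definition iterz (T : mp_aut mu) (n : int) : X -> X :=
  match n with
  | Posz m => iter m T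
  | Negz m => iter m.+1 (mp_inv T)
  end.

Definition commuting (k : nat) (T : 'I_k -> mp_aut mu) : Prop :=
  forall i j x, T i (T j x) = T j (T i x).

(* The sum is over 1 <= n <= N, and 0^-1 = 0 makes the value at N = 0 zero. *)
Definition mult_avg (k : nat) (T : 'I_k -> mp_aut mu) (phi : int -> int)
    (f : 'I_k -> X -> R[i]) (N : nat) (x : X) : R[i] :=
  N%:R^-1 * \sum_(1 <= n < N.+1) \prod_(i < k) f i (iterz (T i) (phi n) x).

Definition jointly_ergodic_along (k : nat) (T : 'I_k -> mp_aut mu)
    (phi : int -> int) : Prop :=
  forall f : 'I_k -> X -> R[i], (forall i, in_Lp mu +oo%E (f i)) ->
  Lnormc mu 2%:E (fun x => mult_avg T phi f N x
                           - \prod_(i < k) cintegral mu (f i))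
    @[N --> \oo] --> (0 : \bar R).

Definition jointly_ergodic (k : nat) (T : 'I_k -> mp_aut mu) : Prop :=
  jointly_ergodic_along T id.

Definition Eig (T : mp_aut mu) : set R[i] :=
  [set l | l != 0 /\ exists f : X -> R[i],
     [/\ in_Lp mu 2%:E f,
         ~ (\forall x \ae mu, f x = 0) &
         \forall x \ae mu, f (T x) = l * f x]].

Definition joint_Eig (k : nat) (T : 'I_k -> mp_aut mu) : set R[i] :=
  [set \prod_(i < k) l i | l in [set l : 'I_k -> R[i] | forall i, Eig (T i) (l i)]].

End joint_ergodicity.

Definition power_avg (R : realType) (l : R[i]) (phi : int -> int) (N : nat) :
    R[i] :=
  N%:R^-1 * \sum_(1 <= n < N.+1) l ^ (phi n).

Definition expi (R : realType) (t : R) : R[i] := cos t +i* sin t.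

(* Main.v *)
From HB Require Import structures.
Require Import Defs.
From mathcomp Require Import measurable_realfun ess_sup_inf.
From mathcomp Require Import ring lra zify.

Set Implicit Arguments.
Unset Strict Implicit.
Unset Printing Implicit Defensive.

Local Open Scope classical_set_scope.
Local Open Scope ring_scope.
Local Open Scope complex_scope.

(** The average along [phi] is studied as an average of the joint orbit m -> prod T_i^m f_i,
    weighted by the number of n with phi(n) = m.

    Necessity of the eigenvalue condition: each T_i is ergodic, so eigenfunctions g_i with
    eigenvalues l_i can be taken of modulus 1, and prod T_i^phi(n) g_i = l^phi(n) prod g_i with l =
    prod l_i. If l differs from 1, some g_i has mean 0, and convergence says that the mean of
    l^phi(n) tends to 0 ([power_avg_of_joint_along]).

    Sufficiency: phi(n) stays within a bounded distance of a n. Let a > 0. Then the average along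
    phi is, up to boundary terms, an average of w(m) times the joint orbit over m <= a N, where w(m)
    counts the n with phi(n) = m ([fiber_sum_approx]). Two facts are combined. (1) The weight w is
    Besicovitch almost periodic ([fiber_count_bap]), because n -> exp(i t f(n)) is so for every
    generalized linear f ([gen_linear_bap]). The induction has to cross the jumps of the fractional
    part; this is harmless because the n at which a generalized linear function is small but nonzero
    have small density ([gen_linear_small_density]). (2) Averages of exp(i t m) prod T_i^m f_i tend
    to 0 unless exp(-i t) is a joint eigenvalue ([weighted_vanish]). The van der Corput inequality
    reduces this to means of exp(i t l) prod <T_i^l f_i, f_i>, that is, to an atom at -t of the
    convolution of the spectral measures; discretized Fejér densities replace these measures
    ([product_mean_small]), and an atom yields an eigenfunction through the mean ergodic theorem
    ([eigenfunction_of_averages]). Now let t be a frequency of w. If exp(-i t) is a joint eigenvalue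
    other than 1, the hypothesis says that w is orthogonal to this frequency, which can then be
    dropped ([good_approximation]). If exp(i t) = 1, joint ergodicity of T itself applies, and
    otherwise (2) does.

    For a < 0, T is replaced by the inverses. They are again jointly ergodic, because joint
    ergodicity amounts to ergodicity of the T_i and of the T_i T_j^-1 together with independence of
    the eigenvalues ([joint_of_conditions], [joint_inverse]).

    For phi(n) = [alpha n] and l = exp(i t), l^phi(n) is exp(i t alpha n) times a function of the
    fractional part of alpha n. Its mean vanishes unless (t + 2 pi k) alpha is in 2 pi Z for some
    integer k ([floor_power_avg_vanish]). In the remaining case, if l is not 1, the mean is a
    nonzero integral ([floor_power_avg_large]). Powers of eigenvalues reduce rational exponents to
    integer ones. *)

(** * Modulus of complex numbers and the characters [expi] *)

Section Complex_numbers.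
Context {R : realType}.
Implicit Types (x y z : R[i]) (s t : R).

Lemma normc_ge0 z : 0 <= normc z.
Proof. by case: z => a b; rewrite /= sqrtr_ge0. Qed.

Lemma sqr_normcE z : normc z ^+ 2 = complex.Re z ^+ 2 + complex.Im z ^+ 2.
Proof. by case: z => a b /=; rewrite sqr_sqrtr // addr_ge0 // sqr_ge0. Qed.

Lemma normc_conj z : normc (conjc z) = normc z.
Proof. by case: z => a b /=; rewrite sqrrN. Qed.

Lemma normc_real t : normc t%:C = `|t|.
Proof. by rewrite /= expr0n /= addr0 sqrtr_sqr. Qed.

Lemma normc_nat n : normc (n%:R : R[i]) = n%:R.
Proof. by rewrite -(rmorph_nat (real_complex R)) normc_real ger0_norm. Qed.

Lemma normc0E : normc (0 : R[i]) = 0.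
Proof. exact: ComplexField.Normc.normc0. Qed.

Lemma normc1E : normc (1 : R[i]) = 1.
Proof. exact: ComplexField.Normc.normc1. Qed.

Lemma normcB_comm x y : normc (x - y) = normc (y - x).
Proof. by rewrite -normcN opprB. Qed.

Lemma normc_eq0 z : (normc z == 0) = (z == 0).
Proof.
apply/eqP/eqP => [/ComplexField.Normc.eq0_normc //|->]; exact: normc0E.
Qed.

Lemma normc_sum (I : Type) (r : seq I) (P : pred I) (F : I -> R[i]) :
  normc (\sum_(i <- r | P i) F i) <= \sum_(i <- r | P i) normc (F i).
Proof. exact: (@ler_norm_sum _ (Rcomplex R)). Qed.

Lemma normc_prod (I : Type) (r : seq I) (P : pred I) (F : I -> R[i]) :
  normc (\prod_(i <- r | P i) F i) = \prod_(i <- r | P i) normc (F i).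
Proof.
elim/big_rec2: _ => [|i a b _ <-]; first exact: normc1E.
exact: ComplexField.Normc.normcM.
Qed.

Lemma normcX z n : normc (z ^+ n) = normc z ^+ n.
Proof.
elim: n => [|n IHn]; first by rewrite !expr0 normc1E.
by rewrite !exprS ComplexField.Normc.normcM IHn.
Qed.

Lemma ler_Re z : complex.Re z <= normc z.
Proof.
case: z => a b /=; apply: le_trans (ler_norm _) _.
by rewrite -sqrtr_sqr ler_wsqrtr // lerDl sqr_ge0.
Qed.

Lemma sqr_normcD_le x y : normc (x + y) ^+ 2 <= 2 * normc x ^+ 2 + 2 * normc y ^+ 2.
Proof.
rewrite !sqr_normcE; case: x => a b; case: y => c d /=.
have := sqr_ge0 (a - c); have := sqr_ge0 (b - d); rewrite !expr2; lra.
Qed.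

Lemma mulcJ z : z * conjc z = (normc z ^+ 2)%:C.
Proof.
by rewrite sqr_normcE; case: z => a b; apply/eqP; rewrite eq_complex /=; apply/andP; split; apply/eqP; ring.
Qed.

Lemma conjcD x y : conjc (x + y) = conjc x + conjc y.
Proof. exact: rmorphD. Qed.

Lemma conjcM x y : conjc (x * y) = conjc x * conjc y.
Proof. exact: rmorphM. Qed.

Lemma conjc_sum (I : Type) (r : seq I) (P : pred I) (F : I -> R[i]) :
  conjc (\sum_(i <- r | P i) F i) = \sum_(i <- r | P i) conjc (F i).
Proof. exact: rmorph_sum. Qed.

Lemma conjc_prod (I : Type) (r : seq I) (P : pred I) (F : I -> R[i]) :
  conjc (\prod_(i <- r | P i) F i) = \prod_(i <- r | P i) conjc (F i).
Proof. exact: rmorph_prod. Qed.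

Lemma ReM_real t z : complex.Re (t%:C * z) = t * complex.Re z.
Proof. by case: z => a b /=; ring. Qed.

Lemma Re_sum (I : Type) (r : seq I) (P : pred I) (F : I -> R[i]) :
  complex.Re (\sum_(i <- r | P i) F i) = \sum_(i <- r | P i) complex.Re (F i).
Proof. exact: (raddf_sum (@complex.Re R : Rcomplex R -> R)). Qed.

Lemma expi0 : expi (0 : R) = 1.
Proof. by rewrite /expi cos0 sin0. Qed.

Lemma expiD s t : expi (s + t) = expi s * expi t.
Proof.
by apply/eqP; rewrite eq_complex /= cosD sinD eqxx addrC (mulrC (sin s)) eqxx.
Qed.

Lemma expiN t : expi (- t) = conjc (expi t).
Proof. by rewrite /expi cosN sinN. Qed.

Lemma normc_expi t : normc (expi t) = 1.
Proof. by rewrite /= cos2Dsin2 sqrtr1. Qed.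

Lemma expi_neq0 t : expi t != 0.
Proof. by rewrite -normc_eq0 normc_expi oner_eq0. Qed.

Lemma expiV t : (expi t)^-1 = expi (- t).
Proof.
by apply: (mulfI (expi_neq0 t)); rewrite mulfV ?expi_neq0 // -expiD subrr expi0.
Qed.

Lemma expiB s t : expi (s - t) = expi s / expi t.
Proof. by rewrite expiD expiV. Qed.

Lemma expiX t n : expi t ^+ n = expi (t * n%:R).
Proof.
elim: n => [|n IHn]; first by rewrite mulr0 expi0 expr0.
by rewrite exprS IHn -expiD -natr1 mulrDr mulr1 addrC.
Qed.

Lemma expiXz t (m : int) : expi t ^ m = expi (t * m%:~R).
Proof.
case: m => n; first by rewrite -exprnP expiX.
by rewrite NegzE -exprnN expiX expiV mulrNz mulrN.
Qed.

Lemma expi_sum (I : Type) (r : seq I) (P : pred I) (F : I -> R) :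
  expi (\sum_(i <- r | P i) F i) = \prod_(i <- r | P i) expi (F i).
Proof.
by elim/big_rec2: _ => [|i a b _ <-]; rewrite ?expi0 // expiD.
Qed.

Lemma expi_2pi_int (m : int) : expi (2 * pi * m%:~R : R) = 1.
Proof.
rewrite -expiXz (_ : expi (2 * pi) = 1) ?exp1rz //.
by rewrite /expi mulrC mulr_natr cos2pi sin2pi.
Qed.

Lemma sqr_normc_expiB1 t : normc (expi t - 1) ^+ 2 = 2 - 2 * cos t.
Proof.
rewrite sqr_normcE /= oppr0 addr0; have := cos2Dsin2 t => e.
have -> : sin t ^+ 2 = 1 - cos t ^+ 2 by lra.
ring.
Qed.

Lemma normc_expiB1 t : normc (expi t - 1) <= `|t|.
Proof.
rewrite -ler_sqr ?nnegrE ?normc_ge0 ?normr_ge0 // sqr_normc_expiB1 real_normK ?num_real //.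
have -> : cos t = 1 - 2 * sin (t / 2) ^+ 2.
  have -> : t = (t / 2) *+ 2 by lra.
  rewrite cos_mulr2n sin2cos2 -(_ : t / 2 = t / 2 *+ 2 / 2); last by lra.
  by rewrite mulr2n; ring.
suff : sin (t / 2) ^+ 2 <= (t / 2) ^+ 2 by nra.
have sinle (x : R) : 0 <= x -> `|sin x| <= x.
  rewrite le_eqVlt => /predU1P[<-|x0]; first by rewrite sin0 normr0.
  have [c _] := @MVT R (@sin R) (@cos R) 0 x x0 (fun u _ => is_derive_sin u)
    (@continuous_subspaceT _ _ _ _ (@continuous_sin R)).
  rewrite sin0 !subr0 => ->; rewrite normrM (gtr0_norm x0).
  by rewrite ler_piMl ?(ltW x0) // cos_max.
rewrite -(real_normK (num_real (sin _))) -(real_normK (num_real (t / 2))).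
rewrite lerXn2r ?nnegrE ?normr_ge0 //.
have [t0|t0] := leP 0 (t / 2); first by rewrite (ger0_norm t0) sinle.
by rewrite -normrN -sinN (ltr0_norm t0) sinle // oppr_ge0 ltW.
Qed.

Lemma normc_expiB s t : normc (expi s - expi t) <= `|s - t|.
Proof.
have -> : expi s - expi t = expi t * (expi (s - t) - 1).
  by rewrite mulrBr mulr1 -expiD (addrC t) subrK.
by rewrite ComplexField.Normc.normcM normc_expi mul1r normc_expiB1.
Qed.

Lemma unit_expi z : normc z = 1 -> exists t, z = expi t.
Proof.
move=> nz; have : normc z ^+ 2 = 1 by rewrite nz expr1n.
rewrite sqr_normcE; case: z {nz} => a b /= ab.
have a1 : -1 <= a <= 1 by have := sqr_ge0 b => b2; apply/andP; split; nra.
have sa : sin (acos a) = `|b|.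
  by rewrite sin_acos // (_ : 1 - a ^+ 2 = b ^+ 2) ?sqrtr_sqr //; lra.
have ca : cos (acos a) = a by rewrite acosK // in_itv.
have [b0|b0] := leP 0 b.
  by exists (acos a); rewrite /expi ca sa ger0_norm.
by exists (- acos a); rewrite /expi cosN sinN ca sa ltr0_norm // opprK.
Qed.

(** The geometric sum telescopes against [z - 1]. The bound is uniform in [n]: it gives the decay of
    the Fejér kernels and of the averages of a nontrivial character. *)
Lemma normc_geom z n : normc z <= 1 ->
  normc (z - 1) * normc (\sum_(k < n) z ^+ k) <= 2.
Proof.
move=> z1; rewrite -ComplexField.Normc.normcM -subrX1.
apply: le_trans (le_normcD _ _) _; rewrite normcN normc1E normcX.
have : normc z ^+ n <= 1 by rewrite exprn_ile1 // normc_ge0.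
lra.
Qed.

End Complex_numbers.

Arguments ComplexField.Normc.normc : simpl never.
Arguments expi : simpl never.

(** * Cesàro averages and Besicovitch almost periodic sequences *)

Section Averages.
Context {R : realType}.

(** One-sided: the upper limit is at most 0. It passes to smaller sequences without any sign
    condition, and for nonnegative sequences it is convergence to 0 ([vanish_cvg]). *)
Definition vanish (a : nat -> R) : Prop :=
  forall e, 0 < e -> \forall N \near \oo, a N <= e.

Lemma vanish_near (a b : nat -> R) :
  vanish b -> (\forall N \near \oo, a N <= b N) -> vanish a.
Proof. by move=> vb ab e e0; near=> N; apply: (@le_trans _ _ (b N)); near: N => //; exact: vb. Unshelve. all: by end_near. Qed.

Lemma vanish_le (a b : nat -> R) : vanish b -> (forall N, a N <= b N) -> vanish a.
Proof. by move=> vb ab; apply: (vanish_near vb); near=> N; exact: ab. Unshelve. all: by end_near. Qed.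

Lemma vanish0 : vanish (fun=> 0).
Proof. by move=> e e0; near=> N; exact: ltW. Unshelve. all: by end_near. Qed.

Lemma vanishD (a b : nat -> R) : vanish a -> vanish b -> vanish (fun N => a N + b N).
Proof.
move=> va vb e e0; have e2 : 0 < e / 2 by rewrite divr_gt0.
near=> N; rewrite (splitr e) lerD //; near: N; [exact: va|exact: vb].
Unshelve. all: by end_near. Qed.

Lemma vanishZ (c : R) (a : nat -> R) : 0 <= c -> vanish a -> vanish (fun N => c * a N).
Proof.
move=> c0 va e e0; have d0 : 0 < e / (c + 1) by rewrite divr_gt0 // ltr_wpDl.
have va' := va _ d0; near=> N.
have h : a N <= e / (c + 1) by near: N.
have [a0|a0] := leP (a N) 0.
  by apply: le_trans (ltW e0); rewrite mulr_ge0_le0.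
apply: (@le_trans _ _ ((c + 1) * a N)); first by rewrite ler_pM2r // lerDl.
by rewrite mulrC -ler_pdivlMr // ltr_wpDl.
Unshelve. all: by end_near. Qed.

Lemma vanish_sum (I : Type) (r : seq I) (P : pred I) (a : I -> nat -> R) :
  (forall i, P i -> vanish (a i)) -> vanish (fun N => \sum_(i <- r | P i) a i N).
Proof.
move=> va; elim: r => [|i r IHr].
  by apply: (vanish_le vanish0) => N; rewrite big_nil.
case Pi: (P i); last by apply: (vanish_le IHr) => N; rewrite big_cons Pi.
by apply: (vanish_le (vanishD (va _ Pi) IHr)) => N; rewrite big_cons Pi.
Qed.

Lemma vanish_approx (a : nat -> R) :
  (forall e, 0 < e -> exists2 b, vanish b & \forall N \near \oo, a N <= b N + e) -> vanish a.
Proof.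
move=> h e e0; have e2 : 0 < e / 2 by rewrite divr_gt0.
have [b vb ab] := h _ e2; have {}vb := vb _ e2.
near=> N; apply: (@le_trans _ _ (b N + e / 2)); first by near: N.
by rewrite [leRHS](splitr e) lerD2r; near: N.
Unshelve. all: by end_near. Qed.

Lemma near_gt0 : \forall N \near \oo, (0 < N)%N.
Proof. by exists 1%N. Qed.

Lemma vanish_invn (c : R) : vanish (fun N => c * N%:R^-1).
Proof.
move=> e e0; near=> N.
have N0 : 0 < N%:R :> R by rewrite ltr0n; near: N; exact: near_gt0.
rewrite ler_pdivrMr // mulrC -ler_pdivrMr //; near: N; exact: nbhs_infty_ger.
Unshelve. all: by end_near. Qed.

Lemma vanish_sqr (a : nat -> R) : (forall N, 0 <= a N) -> vanish a -> vanish (fun N => a N ^+ 2).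
Proof.
move=> a0 va e e0; have m0 : 0 < Num.min 1 e by rewrite lt_min ltr01.
have {}va := va _ m0; near=> N.
have : a N <= Num.min 1 e by near: N.
by rewrite le_min expr2 => /andP[a1 ae]; rewrite -[e]mul1r ler_pM.
Unshelve. all: by end_near. Qed.

Lemma vanish_sqr_inv (a : nat -> R) : (forall N, 0 <= a N) ->
  vanish (fun N => a N ^+ 2) -> vanish a.
Proof.
move=> a0 va e e0; have {}va := va _ (exprn_gt0 2 e0); near=> N.
by rewrite -ler_sqr ?nnegrE ?(ltW e0) //; near: N.
Unshelve. all: by end_near. Qed.

Definition favg (F : fieldType) (u : nat -> F) N : F :=
  N%:R^-1 * \sum_(1 <= n < N.+1) u n.

Lemma favgD (F : fieldType) (u v : nat -> F) N :
  favg (fun n => u n + v n) N = favg u N + favg v N.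
Proof. by rewrite /favg big_split mulrDr. Qed.

Lemma favgZ (F : fieldType) (c : F) (u : nat -> F) N :
  favg (fun n => c * u n) N = c * favg u N.
Proof. by rewrite /favg -mulr_sumr mulrCA. Qed.

Lemma favg_sum (F : fieldType) (I : Type) (r : seq I) (P : pred I) (u : I -> nat -> F) N :
  favg (fun n => \sum_(i <- r | P i) u i n) N = \sum_(i <- r | P i) favg (u i) N.
Proof. by rewrite /favg exchange_big mulr_sumr. Qed.

Lemma eq_favg (F : fieldType) (u v : nat -> F) N :
  (forall n, (0 < n)%N -> u n = v n) -> favg u N = favg v N.
Proof.
move=> uv; rewrite /favg; congr (_ * _).
by apply: eq_big_nat => n /andP[n0 _]; rewrite uv.
Qed.

Lemma ler_favg (u v : nat -> R) N :
  (forall n, (0 < n)%N -> u n <= v n) -> favg u N <= favg v N.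
Proof.
move=> uv; rewrite /favg ler_wpM2l ?invr_ge0 //.
by rewrite !big_nat; apply: ler_sum => n /andP[n0 _]; rewrite uv.
Qed.

Lemma favg_ge0 (u : nat -> R) N : (forall n, (0 < n)%N -> 0 <= u n) -> 0 <= favg u N.
Proof.
move=> u0; rewrite /favg mulr_ge0 ?invr_ge0 // big_nat.
by apply: sumr_ge0 => n /andP[n0 _]; exact: u0.
Qed.

Lemma favg_cst (c : R) N : 0 <= c -> favg (fun=> c) N <= c.
Proof.
move=> c0; rewrite /favg big_const_nat subn1 /= iter_addr_0 -[c *+ N]mulr_natr mulrCA.
by case: N => [|N]; rewrite ?mulr0 // mulVf ?mulr1 // pnatr_eq0.
Qed.

Lemma favg_cst1 N : (0 < N)%N -> favg (fun=> 1 : R[i]) N = 1.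
Proof.
move=> N0; rewrite /favg big_const_nat subn1 /= iter_addr_0 mulVf //.
by rewrite pnatr_eq0 -lt0n.
Qed.

Lemma normc_natV n : normc (n%:R^-1 : R[i]) = n%:R^-1.
Proof.
have -> : n%:R^-1 = (n%:R^-1)%:C :> R[i] by rewrite fmorphV rmorph_nat.
by rewrite normc_real ger0_norm // invr_ge0.
Qed.

Lemma normc_favg (u : nat -> R[i]) N : normc (favg u N) <= favg (fun n => normc (u n)) N.
Proof.
rewrite /favg ComplexField.Normc.normcM normc_natV ler_wpM2l ?invr_ge0 //.
exact: normc_sum.
Qed.

Lemma sqr_favg (u : nat -> R) N : (favg u N) ^+ 2 <= favg (fun n => u n ^+ 2) N.
Proof.
have [->|N0] := posnP N; first by rewrite /favg !invr0 !mul0r expr0n.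
set m := favg u N; rewrite -subr_ge0.
suff -> : favg (fun n => u n ^+ 2) N - m ^+ 2 = favg (fun n => (u n - m) ^+ 2) N.
  by apply: favg_ge0 => n _; exact: sqr_ge0.
transitivity (favg (fun n => u n ^+ 2 + (- (2 * m) * u n + m ^+ 2)) N); last first.
  by apply: eq_favg => n _; ring.
rewrite !favgD favgZ -/m (_ : favg (fun=> m ^+ 2) N = m ^+ 2); last first.
  rewrite /favg big_const_nat subn1 /= iter_addr_0 -[_ ^+ 2 *+ N]mulr_natr mulrCA mulVf ?mulr1 //.
  by rewrite pnatr_eq0 -lt0n.
ring.
Qed.

Lemma vanish_expi (s : R) : expi s != 1 ->
  vanish (fun N => normc (favg (fun n => expi (s * n%:R)) N)).
Proof.
move=> s1; have d0 : 0 < normc (expi s - 1).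
  by rewrite lt_neqAle normc_ge0 andbT eq_sym normc_eq0 subr_eq0.
apply: (vanish_le (vanish_invn (2 / normc (expi s - 1)))) => N.
rewrite /favg ComplexField.Normc.normcM normc_natV mulrC ler_wpM2r ?invr_ge0 //.
rewrite big_add1 /= big_mkord (eq_bigr (fun i : 'I_N => expi s * expi s ^+ i)); last first.
  by move=> i _; rewrite -exprS expiX.
rewrite -mulr_sumr ComplexField.Normc.normcM normc_expi mul1r.
by rewrite ler_pdivlMr // mulrC; apply: normc_geom; rewrite normc_expi.
Qed.

Definition trigpoly (p : nat -> R[i]) : Prop :=
  exists K (c : nat -> R[i]) (t : nat -> R),
    forall n, p n = \sum_(i < K) c i * expi (t i * n%:R).

(* Besicovitch almost periodicity: closure of the trigonometric polynomials
   for the quadratic mean. *)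
Definition bap (u : nat -> R[i]) : Prop :=
  forall e : R, 0 < e -> exists2 p, trigpoly p &
    \forall N \near \oo, favg (fun n => normc (u n - p n) ^+ 2) N <= e.

Lemma trigpoly_bounded p : trigpoly p -> exists2 C : R, 0 <= C & forall n, normc (p n) <= C.
Proof.
move=> [K [c [t pE]]]; exists (\sum_(i < K) normc (c i)).
  by apply: sumr_ge0 => i _; exact: normc_ge0.
move=> n; rewrite pE; apply: le_trans (normc_sum _ _ _) _.
by apply: ler_sum => i _; rewrite ComplexField.Normc.normcM normc_expi mulr1.
Qed.

Lemma trigpolyD p q : trigpoly p -> trigpoly q -> trigpoly (fun n => p n + q n).
Proof.
move=> [K [c [t pE]]] [L [c' [t' qE]]].
exists (K + L)%N, (fun i => if (i < K)%N then c i else c' (i - K)%N),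
  (fun i => if (i < K)%N then t i else t' (i - K)%N) => n.
rewrite pE qE big_split_ord /=; congr (_ + _); apply: eq_bigr => i _ /=.
  by rewrite ltn_ord.
by rewrite ltnNge leq_addr /= addKn.
Qed.

Lemma trigpoly1 (c : R[i]) (t : R) : trigpoly (fun n => c * expi (t * n%:R)).
Proof. by exists 1%N, (fun=> c), (fun=> t) => n; rewrite big_ord1. Qed.

Lemma trigpoly_sum (I : Type) (r : seq I) (p : I -> nat -> R[i]) :
  (forall i, trigpoly (p i)) -> trigpoly (fun n => \sum_(i <- r) p i n).
Proof.
move=> tp; elim: r => [|i r [K [c [t IHr]]]].
  by exists 0%N, (fun=> 0), (fun=> 0) => n; rewrite big_nil big_ord0.
have [L [c' [t' h]]] := trigpolyD (tp i) (ex_intro _ K (ex_intro _ c (ex_intro _ t IHr))).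
by exists L, c', t' => n; rewrite big_cons h.
Qed.

Lemma trigpolyM p q : trigpoly p -> trigpoly q -> trigpoly (fun n => p n * q n).
Proof.
move=> [K [c [t pE]]] [L [c' [t' qE]]].
have [M [d [s h]]] := @trigpoly_sum ('I_K * 'I_L)%type (index_enum _)
  (fun ij n => (c ij.1 * c' ij.2) * expi ((t ij.1 + t' ij.2) * n%:R))
  (fun ij => trigpoly1 _ _).
exists M, d, s => n; rewrite -h pE qE mulr_suml.
rewrite (eq_bigr _ (fun i _ => mulr_sumr _ _ _ _)) pair_bigA /=.
by apply: eq_bigr => ij _; rewrite mulrDl expiD; ring.
Qed.

Lemma bap_trigpoly p : trigpoly p -> bap p.
Proof.
move=> tp e e0; exists p => //; near=> N.
apply: le_trans (ltW e0); rewrite /favg big1 ?mulr0 // => n _.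
by rewrite subrr normc0E expr0n.
Unshelve. all: by end_near. Qed.

Lemma bap_approx u :
  (forall e, 0 < e -> exists2 v, bap v &
     \forall N \near \oo, favg (fun n => normc (u n - v n) ^+ 2) N <= e) -> bap u.
Proof.
move=> h e e0; have e4 : 0 < e / 4 by rewrite divr_gt0.
have [v bv uv] := h _ e4; have [p tp vp] := bv _ e4.
exists p => //; near=> N.
have h1 : favg (fun n => normc (u n - v n) ^+ 2) N <= e / 4 by near: N.
have h2 : favg (fun n => normc (v n - p n) ^+ 2) N <= e / 4 by near: N.
apply: (@le_trans _ _ (favg (fun n => 2 * normc (u n - v n) ^+ 2 + 2 * normc (v n - p n) ^+ 2) N)).
  apply: ler_favg => n _; rewrite (_ : u n - p n = (u n - v n) + (v n - p n)); last by ring.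
  exact: sqr_normcD_le.
rewrite favgD !favgZ; lra.
Unshelve. all: by end_near. Qed.

Lemma eq_bap u v : (forall n, (0 < n)%N -> u n = v n) -> bap v -> bap u.
Proof.
move=> uv bv; apply: bap_approx => e e0; exists v => //; near=> N.
apply: le_trans (ltW e0); rewrite /favg big_nat big1 ?mulr0 // => n /andP[n0 _].
by rewrite uv // subrr normc0E expr0n.
Unshelve. all: by end_near. Qed.

Lemma bapD u v : bap u -> bap v -> bap (fun n => u n + v n).
Proof.
move=> bu bv e e0; have e4 : 0 < e / 4 by rewrite divr_gt0.
have [p tp up] := bu _ e4; have [q tq vq] := bv _ e4.
exists (fun n => p n + q n); first exact: trigpolyD.
near=> N.
have h1 : favg (fun n => normc (u n - p n) ^+ 2) N <= e / 4 by near: N.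
have h2 : favg (fun n => normc (v n - q n) ^+ 2) N <= e / 4 by near: N.
apply: (@le_trans _ _ (favg (fun n => 2 * normc (u n - p n) ^+ 2 + 2 * normc (v n - q n) ^+ 2) N)).
  apply: ler_favg => n _; rewrite (_ : _ - _ = (u n - p n) + (v n - q n)); last by ring.
  exact: sqr_normcD_le.
rewrite favgD !favgZ; lra.
Unshelve. all: by end_near. Qed.

(** Write [u v - p q = (u - p) v + p (v - q)]. The approximation [p] of [u] comes first, with a
    tolerance set by the bound of [v]; then [q], with a tolerance set by the bound of [p]. *)
Lemma bapM u v B : (forall n, normc (v n) <= B) -> bap u -> bap v ->
  bap (fun n => u n * v n).
Proof.
move=> vB bu bv; have B0 : 0 <= B by apply: le_trans (vB 0%N); exact: normc_ge0.
move=> e e0; have d0 : 0 < e / (4 * (B ^+ 2 + 1)).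
  by rewrite divr_gt0 // mulr_gt0 // ltr_wpDl // sqr_ge0.
have [p tp up] := bu _ d0; have [C C0 pC] := trigpoly_bounded tp.
have d'0 : 0 < e / (4 * (C ^+ 2 + 1)).
  by rewrite divr_gt0 // mulr_gt0 // ltr_wpDl // sqr_ge0.
have [q tq vq] := bv _ d'0.
exists (fun n => p n * q n); first exact: trigpolyM.
near=> N.
have h1 : favg (fun n => normc (u n - p n) ^+ 2) N <= e / (4 * (B ^+ 2 + 1)) by near: N.
have h2 : favg (fun n => normc (v n - q n) ^+ 2) N <= e / (4 * (C ^+ 2 + 1)) by near: N.
apply: (@le_trans _ _ (favg (fun n => 2 * (B ^+ 2 + 1) * normc (u n - p n) ^+ 2
    + 2 * (C ^+ 2 + 1) * normc (v n - q n) ^+ 2) N)).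
  apply: ler_favg => n _.
  rewrite (_ : _ - _ = (u n - p n) * v n + p n * (v n - q n)); last by ring.
  apply: le_trans (sqr_normcD_le _ _) _.
  rewrite !ComplexField.Normc.normcM !exprMn.
  have hv : normc (v n) ^+ 2 <= B ^+ 2 + 1.
    by rewrite -[leLHS]addr0 lerD // lerXn2r ?nnegrE ?normc_ge0.
  have hp : normc (p n) ^+ 2 <= C ^+ 2 + 1.
    by rewrite -[leLHS]addr0 lerD // lerXn2r ?nnegrE ?normc_ge0.
  have := ler_wpM2l (sqr_ge0 (normc (u n - p n))) hv.
  have := ler_wpM2l (sqr_ge0 (normc (v n - q n))) hp.
  set a := normc (u n - p n) ^+ 2; set b := normc (v n - q n) ^+ 2.
  set c := normc (v n) ^+ 2; set d := normc (p n) ^+ 2; lra.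
rewrite favgD !favgZ (splitr e) lerD //.
  rewrite mulrC -ler_pdivlMr ?mulr_gt0 ?ltr_wpDl ?sqr_ge0 //.
  by apply: le_trans h1 _; rewrite -!mulrA -!invfM ler_pM2l // lef_pV2 ?posrE ?mulr_gt0 ?ltr_wpDl ?sqr_ge0 //; lra.
rewrite mulrC -ler_pdivlMr ?mulr_gt0 ?ltr_wpDl ?sqr_ge0 //.
by apply: le_trans h2 _; rewrite -!mulrA -!invfM ler_pM2l // lef_pV2 ?posrE ?mulr_gt0 ?ltr_wpDl ?sqr_ge0 //; lra.
Unshelve. all: by end_near. Qed.

Lemma bapZ c u : bap u -> bap (fun n => c * u n).
Proof.
move=> bu; apply: (@eq_bap _ (fun n => u n * (c * expi (0 * n%:R)))).
  by move=> n _; rewrite mul0r expi0 mulr1 mulrC.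
apply: (@bapM _ _ (normc c)) => // [n|].
  by rewrite mul0r expi0 mulr1.
by apply: bap_trigpoly; exact: trigpoly1.
Qed.

Lemma bap_sum (I : Type) (r : seq I) (u : I -> nat -> R[i]) :
  (forall i, bap (u i)) -> bap (fun n => \sum_(i <- r) u i n).
Proof.
move=> bu; elim: r => [|i r IHr].
  apply: (@eq_bap _ (fun n => 0 * expi (0 * n%:R))) => [n _|]; first by rewrite big_nil mul0r.
  by apply: bap_trigpoly; exact: trigpoly1.
by apply: (eq_bap _ (bapD (bu i) IHr)) => n _; rewrite big_cons.
Qed.

End Averages.

(** * Structure of generalized linear functions on the integers *)

Section Generalized_linear.
Context {R : realType}.
Implicit Types f g : R -> R.

Lemma gen_linear_slope f : gen_linear f -> exists A C : R, forall x, `|f x - A * x| <= C.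
Proof.
elim=> [a b|{}f g _ [A [C fA]] _ [B [D gB]]|c {}f _ [A [C fA]]|{}f _ [A [C fA]]].
- by exists a, `|b| => x; rewrite addrAC subrr add0r.
- exists (A + B), (C + D) => x.
  rewrite (_ : _ - _ = (f x - A * x) + (g x - B * x)); last by ring.
  by apply: le_trans (ler_normD _ _) _; rewrite lerD.
- exists (c * A), (`|c| * C) => x.
  by rewrite -mulrA -mulrBr normrM ler_wpM2l.
- exists A, (C + 1) => x.
  have /andP[h1 h2] := floor_itv (f x).
  have -> : (Num.floor (f x))%:~R - A * x = (f x - A * x) + ((Num.floor (f x))%:~R - f x).
    by ring.
  apply: le_trans (ler_normD _ _) _; rewrite lerD //.
  by rewrite ler_norml; rewrite intrD in h2; lra.
Qed.

Lemma gen_linear_comp f g : gen_linear f -> gen_linear g -> gen_linear (fun x => f (g x)).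
Proof.
move=> + gg; elim=> [a b|f1 f2 _ h1 _ h2|c f1 _ h1|f1 _ h1].
- by apply: gen_linear_add; [apply: gen_linear_scale|have := gen_linear_affine 0 b; under eq_fun do rewrite mul0r add0r].
- exact: gen_linear_add.
- exact: gen_linear_scale.
- exact: gen_linear_floor.
Qed.

Lemma gen_linear_cst (b : R) : gen_linear (fun=> b).
Proof. by have := gen_linear_affine 0 b; under eq_fun do rewrite mul0r add0r. Qed.

Lemma gen_linear_id : gen_linear (fun x : R => x).
Proof. by have := gen_linear_affine (1 : R) 0; under eq_fun do rewrite mul1r addr0. Qed.

Lemma gen_linear_opp f : gen_linear f -> gen_linear (fun x => - f x).
Proof. by move=> /(gen_linear_scale (-1)); under eq_fun do rewrite mulN1r. Qed.

Lemma gen_linear_sub f g : gen_linear f -> gen_linear g -> gen_linear (fun x => f x - g x).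
Proof. by move=> gf gg; apply: gen_linear_add => //; exact: gen_linear_opp. Qed.

Definition finite_valued (u : int -> R) : Prop :=
  exists s : seq R, forall n, u n \in s.

Lemma finite_valuedD u v : finite_valued u -> finite_valued v ->
  finite_valued (fun n => u n + v n).
Proof.
move=> [s us] [t vt]; exists [seq x + y | x <- s, y <- t] => n.
exact: allpairs_f (us n) (vt n).
Qed.

Lemma finite_valuedZ c u : finite_valued u -> finite_valued (fun n => c * u n).
Proof. by move=> [s us]; exists [seq c * x | x <- s] => n; apply: map_f. Qed.

Lemma finite_valued_sum (I : Type) (r : seq I) (P : pred I) (u : I -> int -> R) :
  (forall i, P i -> finite_valued (u i)) ->
  finite_valued (fun n => \sum_(i <- r | P i) u i n).
Proof.
move=> fu; elim: r => [|i r IHr].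
  by exists [:: 0] => n; rewrite big_nil mem_seq1.
case Pi: (P i).
  have [s us] := finite_valuedD (fu _ Pi) IHr.
  by exists s => n; rewrite big_cons Pi.
by have [s us] := IHr; exists s => n; rewrite big_cons Pi.
Qed.

Lemma finite_valued_int (phi : int -> int) (C : R) :
  (forall n, `|(phi n)%:~R| <= C) -> finite_valued (fun n => (phi n)%:~R).
Proof.
move=> phiC; pose M := (Num.truncn C).+1.
exists [seq (i%:Z - M%:Z)%:~R | i <- iota 0 (2 * M).+1] => n.
have lt : `|phi n| < M%:Z.
  rewrite -(ltr_int R) intr_norm; apply: le_lt_trans (phiC n) _.
  exact: Num.Theory.truncnS_gt.
apply/mapP; exists (absz (phi n + M%:Z)%R); last by congr (_%:~R); lia.
by rewrite mem_iota; lia.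
Qed.

Lemma finite_valued_gap u : finite_valued u ->
  exists2 e : R, 0 < e & forall n, u n = 0 \/ e <= `|u n|.
Proof.
move=> [s us].
suff [e e0 he] : exists2 e : R, 0 < e & forall x, x \in s -> x = 0 \/ e <= `|x|.
  by exists e => // n; exact: he.
elim: s {us} => [|x s [e e0 he]]; first by exists 1.
have [->|x0] := eqVneq x 0.
  by exists e => // y; rewrite inE => /predU1P[->|/he//]; left.
exists (Num.min e `|x|); first by rewrite lt_min e0 normr_gt0.
move=> y; rewrite inE => /predU1P[->|/he[->|ey]]; [right|by left|right].
  by rewrite ge_min lexx orbT.
by rewrite ge_min ey.
Qed.

(** For a floor, [floor (x + d) - floor x - floor d] is 0 or 1, so finitely many increments [d] of
    the argument produce finitely many increments of the floor. *)
Lemma gen_linear_diff_finite f (h : int) : gen_linear f ->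
  finite_valued (fun n => f (n + h)%:~R - f n%:~R).
Proof.
elim=> [a b|{}f g _ ff _ gg|c {}f _ ff|{}f _ [s fs]].
- exists [:: a * h%:~R] => n; rewrite mem_seq1 intrD; apply/eqP; ring.
- by under eq_fun do rewrite opprD addrACA; exact: finite_valuedD.
- by under eq_fun do rewrite -mulrBr; exact: finite_valuedZ.
- exists [seq (Num.floor x + b%:Z)%:~R | x <- s, b <- [:: 0; 1]%N] => n.
  apply/allpairsP; set x := f n%:~R; set d := f (n + h)%:~R - x.
  have -> : f (n + h)%:~R = x + d by rewrite /d (addrC x) subrK.
  exists (d, absz (Num.floor (x + d) - Num.floor x - Num.floor d)%R) => /=.
  have /andP[x1 x2] := floor_itv x; have /andP[d1 d2] := floor_itv d.
  have l1 : (Num.floor x + Num.floor d <= Num.floor (x + d)).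
    by rewrite floor_ge_int intrD lerD.
  have l2 : (Num.floor (x + d) < Num.floor x + Num.floor d + 2).
    by rewrite floor_lt_int; move: x2 d2; rewrite !intrD; lra.
  split; [exact: fs|rewrite !inE; lia|rewrite -intrB; congr (_%:~R); lia].
Qed.

Definition quasilinear (phi : int -> int) : Prop :=
  exists A C : R, forall n, `|(phi n)%:~R - A * n%:~R| <= C.

Lemma quasilinear_comb (a b : int) phi psi : quasilinear phi -> quasilinear psi ->
  quasilinear (fun n => a * phi n - b * psi n).
Proof.
move=> [A [C hA]] [B [D hB]].
exists (a%:~R * A - b%:~R * B), (`|a%:~R| * C + `|b%:~R| * D) => n.
rewrite intrB !intrM (_ : _ - _ = a%:~R * ((phi n)%:~R - A * n%:~R)
   - b%:~R * ((psi n)%:~R - B * n%:~R)); last by ring.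
by apply: le_trans (ler_normB _ _) _; rewrite !normrM lerD // ler_wpM2l.
Qed.

(** Only the outermost floors are unfolded: a floor is integer-valued and, by [gen_linear_slope],
    near a linear function, so it is a single term of the combination. *)
Lemma gen_linear_comb f : gen_linear f ->
  exists K (c : nat -> R) (phi : nat -> int -> int),
    (forall i, quasilinear (phi i)) /\
    (forall n : int, f n%:~R = \sum_(i < K) c i * (phi i n)%:~R).
Proof.
elim=> [a b|{}f g _ [K [c [phi [qphi fE]]]] _ [L [d [psi [qpsi gE]]]]
        |a {}f _ [K [c [phi [qphi fE]]]]|{}f gf _].
- exists 2, (fun i => if i is 0 then a else b), (fun i n => if i is 0 then n else 1).
  split; last by move=> n; rewrite big_ord_recl big_ord1 /= mulr1.
  case=> [|_]; first by exists 1, 0 => n; rewrite mul1r subrr normr0.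
  by exists 0, 1 => n; rewrite mul0r subr0 normr1.
- exists (K + L)%N, (fun i => if (i < K)%N then c i else d (i - K)%N),
    (fun i => if (i < K)%N then phi i else psi (i - K)%N); split.
    by move=> i; case: ifP.
  move=> n; rewrite fE gE big_split_ord /=; congr (_ + _); apply: eq_bigr => i _ /=.
    by rewrite ltn_ord.
  by rewrite ltnNge leq_addr /= addKn.
- exists K, (fun i => a * c i), phi; split => // n.
  by rewrite fE mulr_sumr; apply: eq_bigr => i _; rewrite mulrA.
- exists 1%N, (fun=> 1), (fun _ n => Num.floor (f n%:~R)); split; last first.
    by move=> n; rewrite big_ord1 mul1r.
  move=> _; have [A [C fA]] := gen_linear_slope (gen_linear_floor gf).
  by exists A, C => n; exact: fA.
Qed.

Definition recurrence_free (v : int -> R) : Prop :=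
  exists h0 : nat, forall h : nat, (h0 < h)%N -> forall n, v (n + h%:Z) != v n.

(* After discarding the phi_i until the c_i are linearly independent over the
   rationals, [v (n + h) = v n] forces [phi_i (n + h) = phi_i n] for all i. *)
Lemma comb_dichotomy K (P : {set 'I_K}) (c : 'I_K -> R) (phi : 'I_K -> int -> int) v :
  (forall i, quasilinear (phi i)) ->
  (forall n : int, v n = \sum_(i in P) c i * (phi i n)%:~R) ->
  finite_valued v \/ recurrence_free v.
Proof.
have [m] := ubnP #|P|; elim: m P c phi => // m IHm P c phi /ltnSE Pm qphi vE.
have [indep|] := pselect (forall z : 'I_K -> int,
    \sum_(i in P) (z i)%:~R * c i = 0 -> forall i, i \in P -> z i = 0).
  have [bnd|] := pselect (forall i, i \in P -> exists C : R, forall n, `|(phi i n)%:~R| <= C).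
    left; rewrite (_ : v = fun n => \sum_(i in P) c i * (phi i n)%:~R); last exact/funext.
    apply: finite_valued_sum => i iP; apply: finite_valuedZ.
    by have [C hC] := bnd i iP; exact: finite_valued_int hC.
  move=> /existsNP[i /not_implyP[iP unb]]; right.
  have [A [C hA]] := qphi i.
  have A0 : A != 0.
    by apply: contra_notN unb => /eqP A0; exists C => n; have := hA n; rewrite A0 mul0r subr0.
  (* Equal values of [phi i] at distance [h] give [|A| h <= 2 C], which this threshold rules out. *)
  exists (Num.truncn (2 * C / `|A|)) => h hh n; apply/eqP => vv.
  have := vv; rewrite !vE => /eqP; rewrite -subr_eq0 -sumrB => /eqP e.
  have : phi i (n + h%:Z) - phi i n = 0.
    apply: (indep (fun i => phi i (n + h%:Z) - phi i n)) => //.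
    by rewrite -[RHS]e; apply: eq_bigr => j _; rewrite intrB; ring.
  move=> /eqP; rewrite subr_eq0 => /eqP pp.
  have : `|A * h%:R| <= 2 * C.
    have -> : A * h%:R = ((phi i n)%:~R - A * n%:~R) - ((phi i (n + h%:Z))%:~R - A * (n + h%:Z)%:~R).
      by rewrite pp intrD; ring.
    by apply: le_trans (ler_normB _ _) _; rewrite mulr_natl mulr2n lerD.
  rewrite normrM normr_nat mulrC -ler_pdivlMr ?normr_gt0 //; apply/negP; rewrite -ltNge.
  by apply: lt_le_trans (Num.Theory.truncnS_gt _) _; rewrite ler_nat.
move=> /existsNP[z /not_implyP[zc /existsNP[j /not_implyP[jP /eqP zj]]]].
(* A rational relation with [z j] nonzero eliminates [c j]. The denominators go into the
   coefficients, so the new functions stay integer-valued and quasilinear. *)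
apply: (IHm (P :\ j) (fun i => c i / (z j)%:~R) (fun i n => z j * phi i n - z i * phi j n)).
- by apply: leq_trans Pm; rewrite [in leqRHS](cardsD1 j) jP.
- by move=> i; exact: quasilinear_comb.
move=> n; have zj' : (z j)%:~R != 0 :> R by rewrite intr_eq0.
have cj : c j = - (\sum_(i in P :\ j) (z i)%:~R * c i) / (z j)%:~R.
  move: zc; rewrite (big_setD1 j) //= => /eqP; rewrite addr_eq0 => /eqP <-.
  by rewrite mulrC mulKf.
rewrite vE (big_setD1 j) //= cj !mulNr !mulr_suml -sumrN -big_split /=.
apply: eq_bigr => i _; rewrite intrB !intrM; field.
exact: zj'.
Qed.

Lemma gen_linear_dichotomy f : gen_linear f ->
  finite_valued (fun n => f n%:~R) \/ recurrence_free (fun n => f n%:~R).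
Proof.
move=> /gen_linear_comb[K [c [phi [qphi fE]]]].
apply: (@comb_dichotomy K [set: 'I_K] (fun i => c i) (fun i => phi i)) => // n.
by rewrite fE; apply: eq_bigl => i; rewrite inE.
Qed.

End Generalized_linear.

(** * Density of the small nonzero values of a generalized linear function *)

Section Density.
Context {R : realType}.

Lemma uniform_gap K (u : nat -> int -> R) :
  (forall j, (j < K)%N -> finite_valued (u j)) ->
  exists2 e : R, 0 < e & forall j, (j < K)%N -> forall n, u j n = 0 \/ e <= `|u j n|.
Proof.
elim: K => [|K IHK] fu; first by exists 1.
have [e e0 he] := IHK (fun j jK => fu j (leqW jK)).
have [d d0 hd] := finite_valued_gap (fu K (leqnn _)).
exists (Num.min e d); first by rewrite lt_min e0.
move=> j; rewrite ltnS leq_eqVlt => /predU1P[->|jK] n.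
  by have [->|h] := hd n; [left|right; rewrite ge_min h orbT].
by have [->|h] := he j jK n; [left|right; rewrite ge_min h].
Qed.

Lemma shift_count (E : nat -> bool) h N :
  (\sum_(1 <= n < N.+1) E n <= \sum_(1 <= n < N.+1) E (n + h) + h)%N.
Proof.
have -> : (\sum_(1 <= n < N.+1) E (n + h) = \sum_(1 + h <= n < N.+1 + h) E n)%N.
  by rewrite big_addn addnK.
apply: (@leq_trans (\sum_(1 <= n < N.+1 + h) E n)).
  by rewrite (@big_cat_nat _ _ _ N.+1 1 (N.+1 + h)) //= ?leq_addr.
rewrite (@big_cat_nat _ _ _ (1 + h) 1 (N.+1 + h)) //= ?leq_addr ?leq_add2r //.
rewrite addnC leq_add2l (@leq_trans (\sum_(1 <= n < 1 + h) 1)) //.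
  by apply: leq_sum => i _; case: (E i).
by rewrite sum_nat_const_nat muln1 addKn.
Qed.

(** Double counting: the [K] shifts of [E] by multiples of [H] are disjoint, and each has as many
    points in the window as [E] has, up to a boundary term. *)
Lemma separated_density (E : nat -> bool) H K N :
  (forall n i j, (i < j < K)%N -> ~~ (E (n + i * H)%N && E (n + j * H)%N)) ->
  (K * \sum_(1 <= n < N.+1) E n <= N + K * (K * H))%N.
Proof.
move=> sep.
have le1 n : (\sum_(i < K) E (n + i * H)%N <= 1)%N.
  have [/existsP[i Ei]|] := boolP [exists i : 'I_K, E (n + i * H)%N]; last first.
    rewrite negb_exists => /forallP h.
    by rewrite big1 // => i _; rewrite (negbTE (h i)).
  rewrite (bigD1 i) //= Ei big1 // => j; rewrite neq_ltn => /orP[ij|ij].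
    by have := sep n j i; rewrite ij ltn_ord Ei /= andbT => /(_ isT)/negbTE ->.
  by have := sep n i j; rewrite ij ltn_ord Ei /= => /(_ isT)/negbTE ->.
apply: (@leq_trans (\sum_(i < K) (\sum_(1 <= n < N.+1) E (n + i * H)%N + i * H))%N).
  by rewrite -{1}(card_ord K) -sum_nat_const; apply: leq_sum => i _; exact: shift_count.
rewrite big_split /= leq_add //.
  rewrite exchange_big /= (@leq_trans (\sum_(1 <= n < N.+1) 1)%N) //.
    by apply: leq_sum => n _; exact: le1.
  by rewrite sum_nat_const_nat muln1 subn1.
have -> : (K * (K * H) = \sum_(i < K) K * H)%N by rewrite sum_nat_const card_ord.
apply: leq_sum => i _.
by rewrite leq_mul2r ltnW ?orbT.
Qed.

(** A finite-valued [v] has a gap above 0. Otherwise the differences of [v] at distances [H], [2 H],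
    ..., [(K - 1) H] are nonzero and take finitely many values, so they are bounded below by some
    [d]. Two points at such a distance cannot both satisfy [|v| < d / 2], and the density is at most
    [1 / K]. *)
Lemma gen_linear_small_density (v : R -> R) e : gen_linear v -> 0 < e ->
  exists2 d : R, 0 < d &
    \forall N \near \oo, favg (fun n => (0 < `|v n%:R| < d)%R%:R : R) N <= e.
Proof.
move=> gv e0.
have [fv|[h0 rf]] := gen_linear_dichotomy gv.
  have [d d0 hd] := finite_valued_gap fv; exists d => //; near=> N.
  rewrite /favg big1 ?mulr0 ?(ltW e0) // => n _.
  by have [/= h|/= h] := hd n; rewrite pmulrn ?h ?normr0 ?ltxx // [X in _ && X]ltNge h andbF.
(* Since [H > h0], [v] takes no value twice at a distance that is a positive multiple of [H]; since
   [K >= 2 / e], half of [e] is left for the boundary term. *)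
pose K := (Num.truncn (2 / e)).+1; pose H := h0.+1.
have [d d0 hd] := @uniform_gap K (fun j n => v (n + (j * H)%N%:Z)%:~R - v n%:~R)
  (fun j _ => gen_linear_diff_finite _ gv).
exists (d / 2); first by rewrite divr_gt0.
pose E n := 0 < `|v n%:R| < d / 2.
have sep n i j : (i < j < K)%N -> ~~ (E (n + i * H)%N && E (n + j * H)%N).
  move=> /andP[ij jK]; apply/negP => /andP[/andP[_ h1] /andP[_ h2]].
  have jiK : (j - i < K)%N by rewrite (leq_ltn_trans (leq_subr _ _)).
  have := hd (j - i)%N jiK (n + i * H)%N%:Z.
  rewrite -PoszD -addnA -mulnDl subnKC ?(ltnW ij) // -!pmulrn.
  case=> [/eqP|].
    rewrite subr_eq0 => /eqP vv.
    have := rf ((j - i) * H)%N _ (n + i * H)%N%:Z.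
    rewrite -PoszD -addnA -mulnDl subnKC ?(ltnW ij) // -!pmulrn vv eqxx.
    suff hh : (h0 < (j - i) * H)%N by move=> /(_ hh).
    by rewrite -/H -[X in (X <= _)%N]mul1n leq_mul2r subn_gt0 ij.
  apply/negP; rewrite -ltNge; apply: le_lt_trans (ler_normB _ _) _.
  by rewrite (splitr d) ltrD.
have := @separated_density E H K _ sep => cnt.
near=> N.
have N0 : (0 < N)%N by near: N; exact: near_gt0.
have N0' : 0 < N%:R :> R by rewrite ltr0n.
have NK : (K * H)%:R * (2 / e) <= N%:R :> R by near: N; exact: nbhs_infty_ger.
have K2 : 2 / e <= K%:R by apply/ltW; exact: Num.Theory.truncnS_gt.
have := cnt N; rewrite -(ler_nat R) natrM natrD natrM natr_sum => hS.
rewrite /favg [leLHS]mulrC ler_pdivrMr //.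
rewrite -/(\sum_(1 <= n < N.+1) (E n)%:R).
set S := \sum_(_ <= _ < _) _ in hS *.
have K0 : 0 < K%:R :> R by rewrite ltr0n.
rewrite -(ler_pM2l K0) (le_trans hS) //.
have h1 : N%:R <= K%:R * (e / 2) * N%:R.
  apply: ler_peMl; first exact: ltW.
  by rewrite -ler_pdivrMr ?divr_gt0 // mul1r invf_div.
have h2 : K%:R * (K * H)%:R <= K%:R * (e / 2) * N%:R.
  by rewrite -mulrA ler_pM2l // mulrC -ler_pdivrMr ?divr_gt0 // invf_div.
lra.
Unshelve. all: by end_near. Qed.

End Density.

(** * Fejér interpolation on the circle *)

Section Fejer.
Context {R : realType}.
Implicit Types (s t x y : R).

Lemma cos_2pi_le (a s : R) : 0 <= a -> a <= s <= 1 - a -> cos (2 * pi * s) <= cos (2 * pi * a).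
Proof.
move=> a0 /andP[as_ sa]; have pi0 := @pi_gt0 R.
wlog s2 : s as_ sa / s <= 1 / 2.
  move=> h; have [s2|s2] := leP s (1 / 2); first exact: h.
  have -> : cos (2 * pi * s) = cos (2 * pi * (1 - s)).
    by rewrite -[RHS]cosN -[RHS]cosD2pi; congr cos; rewrite mulr2n; ring.
  by apply: h; lra.
move: as_; rewrite le_eqVlt => /predU1P[->//|as_]; apply: ltW.
rewrite ltr_cos ?in_itv /= ?ltr_pM2l ?mulr_gt0 //; apply/andP; split; nra.
Qed.

Lemma cos_2pi_lt1 (a : R) : 0 < a <= 1 / 2 -> cos (2 * pi * a) < 1.
Proof.
move=> /andP[a0 a2]; have pi0 := @pi_gt0 R.
have [h1 h2] : 0 < 2 * pi * a /\ 2 * pi * a <= pi by split; nra.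
rewrite -[X in _ < X](@cos0 R) ltr_cos ?in_itv //=; apply/andP; split => //.
- exact: ltW.
- exact: ltW.
Qed.

Definition frac x := x - (Num.floor x)%:~R.

Lemma frac_itv x : 0 <= frac x < 1.
Proof. by have := floor_itv x; rewrite /frac intrD; lra. Qed.

Lemma expi_frac (m : int) x : expi (2 * pi * m%:~R * x) = expi (2 * pi * m%:~R * frac x).
Proof.
rewrite {1}(_ : x = frac x + (Num.floor x)%:~R); last by rewrite /frac subrK.
by rewrite mulrDr expiD -[_ * (Num.floor x)%:~R]mulrA -intrM expi_2pi_int mulr1.
Qed.

Lemma expi_eq1 x : expi (2 * pi * x) = 1 -> x = (Num.floor x)%:~R.
Proof.
have := expi_frac 1 x; rewrite mulr1 => -> e.
have /andP[f0 f1] := frac_itv x.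
have [f00|fN0] := eqVneq (frac x) 0; first by apply/eqP; rewrite -subr_eq0 -/(frac x) f00.
have {f0 fN0} f0 : 0 < frac x by rewrite lt_neqAle eq_sym fN0.
have c1 : cos (2 * pi * frac x) = 1 by case: e.
have [f2|f2] := leP (frac x) (1 / 2).
  by have := @cos_2pi_lt1 (frac x); rewrite c1 ltxx f0 f2 => /(_ isT).
have := @cos_2pi_lt1 (1 - frac x).
rewrite (_ : cos _ = cos (2 * pi * frac x)); last first.
  by rewrite -[RHS]cosN -[RHS]cosD2pi; congr cos; rewrite mulr2n; ring.
by rewrite c1 ltxx => h; suff: false by []; apply: h; lra.
Qed.

Lemma roots_sum M (m : int) : (`|m| < M%:Z)%R ->
  M%:R^-1 * \sum_(j < M) expi (2 * pi * (j%:R / M%:R) * m%:~R : R) = (m == 0)%:R.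
Proof.
move=> mM; have M0 : (0 < M)%N by lia.
have M0' : M%:R != 0 :> R by rewrite pnatr_eq0 -lt0n.
have M0c : M%:R != 0 :> R[i] by rewrite pnatr_eq0 -lt0n.
have [->|m0] := eqVneq m 0.
  rewrite (eq_bigr (fun=> 1)) => [|j _]; last by rewrite mulr0 expi0.
  by rewrite sumr_const card_ord mulVf.
set z := expi (2 * pi * (m%:~R / M%:R) : R).
rewrite (eq_bigr (fun j : 'I_M => z ^+ j)); last first.
  by move=> j _; rewrite /z expiX; congr expi; ring.
have zM : z ^+ M = 1.
  by rewrite /z expiX -mulrA mulfVK // expi_2pi_int.
have z1 : z != 1.
  apply/eqP => /expi_eq1 /(congr1 ( *%R^~ M%:R)) /eqP; rewrite divfK //.
  rewrite (_ : M%:R = (M%:Z)%:~R) // -intrM eqr_int => /eqP e.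
  move: mM m0; rewrite e; case: (Num.floor _) => [[|a]|a]; rewrite ?mul0r ?eqxx //; nia.
have : (z - 1) * \sum_(j < M) z ^+ j = 0 by rewrite -subrX1 zM subrr.
by move=> /eqP; rewrite mulf_eq0 subr_eq0 (negbTE z1) /= => /eqP ->; rewrite mulr0.
Qed.

Definition fejer_kernel N y : R :=
  N%:R^-1 * normc (\sum_(k < N) expi (2 * pi * k%:R * y)) ^+ 2.

Lemma fejer_kernel_ge0 N y : 0 <= fejer_kernel N y.
Proof. by rewrite mulr_ge0 ?invr_ge0 ?sqr_ge0. Qed.

Lemma fejer_kernelE N y : (fejer_kernel N y)%:C =
  N%:R^-1 * \sum_(k < N) \sum_(l < N) expi (2 * pi * (k%:Z - l%:Z)%:~R * y).
Proof.
rewrite /fejer_kernel rmorphM fmorphV rmorph_nat /= -mulcJ; congr (_ * _).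
rewrite conjc_sum mulr_suml; apply: eq_bigr => k _; rewrite mulr_sumr.
apply: eq_bigr => l _; rewrite -expiN -expiD; congr expi.
by rewrite intrB; ring.
Qed.

(** Averaging over the nodes keeps only the diagonal terms [k = l], since [|k - l| < N]. The sampled
    kernels are thus an exact partition of unity, and [fejer] is a convex combination of values of
    the interpolated function. *)
Lemma fejer_kernel_sum N x : (0 < N)%N ->
  N%:R^-1 * \sum_(j < N) fejer_kernel N (x - j%:R / N%:R) = 1.
Proof.
move=> N0; apply: (@complexI R); rewrite rmorphM fmorphV rmorph_nat rmorph_sum /=.
rewrite (eq_bigr _ (fun j _ => fejer_kernelE N _)) -mulr_sumr mulrCA exchange_big /=.
transitivity (N%:R^-1 * \sum_(k < N) \sum_(l < N) (k == l)%:R : R[i]); last first.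
  rewrite (eq_bigr (fun=> 1)); last first.
    move=> k _; rewrite (bigD1 k) //= eqxx big1 ?addr0 // => l.
    by rewrite eq_sym => /negbTE ->.
  by rewrite sumr_const card_ord mulVf // pnatr_eq0 -lt0n.
congr (_ * _); rewrite mulr_sumr; apply: eq_bigr => k _.
rewrite exchange_big mulr_sumr; apply: eq_bigr => l _ /=.
have := @roots_sum N (l%:Z - k%:Z); rewrite (_ : (_ < _) = true); last first.
  by have := ltn_ord k; have := ltn_ord l; lia.
move=> /(_ isT); rewrite (_ : (_ == 0) = (k == l)); last first.
  by rewrite subr_eq0 eq_sym eqz_nat.
move=> h; rewrite (eq_bigr (fun j : 'I_N => expi (2 * pi * (k%:Z - l%:Z)%:~R * x) *
    expi (2 * pi * (j%:R / N%:R) * (l%:Z - k%:Z)%:~R))); last first.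
  by move=> j _; rewrite -expiD; congr expi; rewrite !intrB; ring.
rewrite -mulr_sumr mulrCA h; case: eqP => [->|_]; last by rewrite mulr0.
by rewrite subrr mulr0 mul0r expi0 mulr1.
Qed.

Lemma fejer_kernel_far N (a y : R) : (0 < N)%N -> 0 < a -> a <= `|y| <= 1 - a ->
  fejer_kernel N y <= 4 / (2 - 2 * cos (2 * pi * a)) / N%:R.
Proof.
move=> N0 a0 ay; have a2 : a <= 1 / 2 by lra.
have c1 : cos (2 * pi * a) < 1 by apply: cos_2pi_lt1; rewrite a0.
have cy : cos (2 * pi * y) <= cos (2 * pi * a).
  have -> : cos (2 * pi * y) = cos (2 * pi * `|y|).
    have [y0|y0] := leP 0 y; first by rewrite ger0_norm.
    by rewrite ltr0_norm // mulrN cosN.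
  by apply: cos_2pi_le => //; exact: ltW.
rewrite /fejer_kernel mulrC ler_wpM2r ?invr_ge0 // ler_pdivlMr; last by lra.
apply: (@le_trans _ _ (normc (\sum_(k < N) expi (2 * pi * k%:R * y)) ^+ 2 *
    normc (expi (2 * pi * y) - 1) ^+ 2)).
  by rewrite ler_wpM2l ?sqr_ge0 // sqr_normc_expiB1; lra.
rewrite -exprMn mulrC (eq_bigr (fun k : 'I_N => expi (2 * pi * y) ^+ k)); last first.
  by move=> k _; rewrite expiX; congr expi; ring.
have -> : 4 = 2 ^+ 2 :> R by rewrite expr2; lra.
rewrite lerXn2r ?nnegrE ?mulr_ge0 ?normc_ge0 //.
by apply: normc_geom; rewrite normc_expi.
Qed.

(* Fejer interpolation of the 1-periodic function [x |-> expi (- t * frac x)]. *)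
Definition fejer t N x : R[i] :=
  N%:R^-1 * \sum_(j < N) expi (- t * (j%:R / N%:R)) *
    (fejer_kernel N (x - j%:R / N%:R))%:C.

Lemma normc_fejer t N x : normc (fejer t N x) <= 1.
Proof.
have [->|N0] := posnP N; first by rewrite /fejer big_ord0 mulr0 normc0E.
rewrite /fejer ComplexField.Normc.normcM normc_natV -[X in _ <= X](fejer_kernel_sum x N0).
rewrite ler_wpM2l ?invr_ge0 //; apply: le_trans (normc_sum _ _ _) _.
apply: ler_sum => j _; rewrite ComplexField.Normc.normcM normc_expi mul1r normc_real.
by rewrite ger0_norm // fejer_kernel_ge0.
Qed.

(** Nodes within [a] of [frac x] carry values within [|t| a], and at the other nodes the kernel is
    of order [1 / N]. The margin [a] on both sides keeps a node of the unit interval that is far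
    from [frac x] also far from it modulo 1. *)
Lemma fejer_approx t (a : R) N x : (0 < N)%N -> 0 < a -> a <= frac x <= 1 - a ->
  normc (fejer t N x - expi (- t * frac x)) <=
    `|t| * a + 8 / (2 - 2 * cos (2 * pi * a)) / N%:R.
Proof.
move=> N0 a0 /andP[ax xa]; set y := frac x.
have N0' : 0 < N%:R :> R by rewrite ltr0n.
have ker z : fejer_kernel N (x - z) = fejer_kernel N (y - z).
  rewrite /fejer_kernel; congr (_ * normc _ ^+ 2); apply: eq_bigr => k _.
  have := expi_frac k x; rewrite -pmulrn -/y => e.
  by rewrite mulrBr expiB e -expiB -mulrBr.
rewrite -/y in ax xa *; clearbody y.
have c1 : cos (2 * pi * a) < 1 by apply: cos_2pi_lt1; rewrite a0; lra.
set B := 8 / _ / _; have B0 : 0 <= B.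
  by rewrite /B !divr_ge0 //; lra.
have -> : fejer t N x - expi (- t * y) = N%:R^-1 * \sum_(j < N)
    (expi (- t * (j%:R / N%:R)) - expi (- t * y)) * (fejer_kernel N (x - j%:R / N%:R))%:C.
  under [in RHS]eq_bigr => j _ do rewrite mulrBl.
  rewrite [in RHS]sumrB mulrBr; congr (_ - _).
  rewrite -mulr_sumr mulrCA -(rmorph_sum (real_complex R)).
  have := congr1 (real_complex R) (fejer_kernel_sum x N0).
  by rewrite rmorphM fmorphV rmorph_nat /= => ->; rewrite mulr1.
rewrite ComplexField.Normc.normcM normc_natV.
have -> : `|t| * a + B = N%:R^-1 * \sum_(j < N) (`|t| * a * fejer_kernel N (x - j%:R / N%:R) + B).
  rewrite big_split /= mulrDr -mulr_sumr mulrCA fejer_kernel_sum // mulr1.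
  by rewrite sumr_const card_ord -[B *+ N]mulr_natl mulKf // gt_eqF.
rewrite ler_wpM2l ?invr_ge0 //; apply: le_trans (normc_sum _ _ _) _.
apply: ler_sum => j _; rewrite ComplexField.Normc.normcM normc_real.
set z := j%:R / N%:R; rewrite (ger0_norm (fejer_kernel_ge0 _ _)).
have /andP[z0 z1] : 0 <= z < 1.
  apply/andP; split; first by rewrite divr_ge0.
  by rewrite ltr_pdivrMr // mul1r ltr_nat ltn_ord.
have [near_|far] := leP `|z - y| a.
  rewrite -[leLHS]addr0 lerD // ler_wpM2r ?fejer_kernel_ge0 //.
  apply: le_trans (normc_expiB _ _) _.
  by rewrite -mulrBr normrM normrN ler_wpM2l.
rewrite -[leLHS]add0r lerD //; first by apply: mulr_ge0; [apply: mulr_ge0; last exact: ltW|exact: fejer_kernel_ge0].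
have -> : B = 2 * (4 / (2 - 2 * cos (2 * pi * a)) / N%:R) by rewrite /B; field; lra.
apply: ler_pM; rewrite ?normc_ge0 ?fejer_kernel_ge0 //.
  apply: le_trans (le_normcD _ _) _.
  by rewrite normcN !normc_expi; lra.
rewrite ker; apply: fejer_kernel_far => //.
rewrite distrC (ltW far) /=.
by rewrite ler_norml; lra.
Qed.

End Fejer.

(** * Almost periodicity of exponentials and of fiber counts *)

Section Generalized_linear_almost_periodic.
Context {R : realType}.

Lemma bap_fejer t N (b : R) (f : R -> R) :
  (forall s, bap (fun n => expi (s * f n%:R))) -> bap (fun n => fejer t N (f n%:R + b)).
Proof.
move=> fb; rewrite /fejer; apply: bapZ; apply: bap_sum => j.
apply: bapZ.
apply: (@eq_bap _ _ (fun n => N%:R^-1 * \sum_(k < N) \sum_(l < N)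
  expi (2 * pi * (k%:Z - l%:Z)%:~R * (b - j%:R / N%:R)) *
  expi (2 * pi * (k%:Z - l%:Z)%:~R * f n%:R))).
  move=> n _; rewrite fejer_kernelE; congr (_ * _).
  by apply: eq_bigr => k _; apply: eq_bigr => l _; rewrite -expiD; congr expi; ring.
by apply: bapZ; apply: bap_sum => k; apply: bap_sum => l; apply: bapZ; exact: fb.
Qed.

(* The discontinuity of the fractional part is reached only from below, that is,
   where the signed distance of [f n] to the nearest integer is in ]-3a, 0[. *)
Lemma gen_linear_bap (f : R -> R) t : gen_linear f -> bap (fun n => expi (t * f n%:R)).
Proof.
move=> gf; elim: gf t => [a b|{}f g _ hf _ hg|c {}f _ hf|{}f gf hf] t.
- apply: bap_trigpoly; apply: (eq_ind (fun n => expi (t * b) * expi (t * a * n%:R)) trigpoly).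
    exact: trigpoly1.
  by apply/funext => n; rewrite -expiD; congr expi; ring.
- under eq_fun do rewrite mulrDr expiD.
  by apply: (@bapM _ _ _ 1) => // n; rewrite normc_expi.
- by under eq_fun do rewrite mulrA; exact: hf.
have -> : (fun n => expi (t * (Num.floor (f n%:R))%:~R)) =
    (fun n => expi (t * f n%:R) * expi (- t * frac (f n%:R))).
  by apply/funext => n; rewrite -expiD /frac; congr expi; ring.
apply: (@bapM _ _ _ 1) => // [n|]; first by rewrite normc_expi.
apply: bap_approx => e e0.
pose s x := f x - (Num.floor (f x + 1 / 2))%:~R.
have gs : gen_linear s.
  apply: gen_linear_sub => //; apply: gen_linear_floor.
  by apply: gen_linear_add => //; exact: gen_linear_cst.
have e8 : 0 < e / 8 by rewrite divr_gt0.
have [d d0 hd] := gen_linear_small_density gs e8.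
pose r := Num.min 1 (e / 2).
have r0 : 0 < r by rewrite lt_min ltr01 divr_gt0.
have r2 : r ^+ 2 <= e / 2.
  by rewrite expr2 -[leRHS]mul1r; apply: ler_pM; rewrite ?(ltW r0) // /r ge_min lexx ?orbT.
pose a := Num.min (d / 3) (Num.min (1 / 6) (r / 2 / (3 * (`|t| + 1)))).
have t1 : 0 < `|t| + 1 by rewrite ltr_wpDl.
have a0 : 0 < a by rewrite !lt_min !divr_gt0 // mulr_gt0.
have ad : 3 * a <= d by rewrite mulrC -ler_pdivlMr // /a ge_min lexx.
have a6 : a <= 1 / 6 by rewrite /a !ge_min lexx !orbT.
have at_ : 3 * `|t| * a <= r / 2.
  have : a <= r / 2 / (3 * (`|t| + 1)) by rewrite /a !ge_min lexx !orbT.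
  rewrite ler_pdivlMr ?mulr_gt0 // => h; apply: le_trans h.
  by rewrite [leRHS]mulrC ler_pM2r // ler_pM2l // lerDl.
have c1 : cos (2 * pi * a) < 1 by apply: cos_2pi_lt1; rewrite a0; lra.
pose B := 8 / (2 - 2 * cos (2 * pi * a)).
have B0 : 0 < B by rewrite divr_gt0 //; lra.
pose M := (Num.truncn (B / (r / 2))).+1.
have MB : B / M%:R <= r / 2.
  rewrite ler_pdivrMr ?ltr0n // mulrC -ler_pdivrMr ?divr_gt0 //.
  by apply/ltW; exact: Num.Theory.truncnS_gt.
(* The shift moves fractional parts from between 0 and [1 - 3 a] to between [2 a] and [1 - a], where
   [fejer_approx] holds. Integer values of [f n], which may have positive density, thus fall on the
   good side. *)
exists (fun n => fejer t M (f n%:R + 2 * a)); first exact: bap_fejer.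
near=> N.
(* The error is at most [r] at good points and at most 2 at the others, whose proportion is
   eventually at most [e / 8]. *)
apply: (@le_trans _ _ (favg (fun n => r ^+ 2 + 4 * (0 < `|s n%:R| < d)%R%:R : R) N)); last first.
  rewrite favgD (favgZ 4) (splitr e) lerD //.
    by apply: (le_trans _ r2); apply: favg_cst; exact: sqr_ge0.
  rewrite mulrC -ler_pdivlMr // -mulrA -invfM.
  rewrite (_ : e / (2 * 4) = e / 8); last by congr (_ / _); lra.
  by near: N.
apply: ler_favg => n _; set x := f n%:R.
have /andP[x0 x1] := frac_itv x.
have [fx|fx] := leP (frac x) (1 - 3 * a).
  rewrite -[leLHS]addr0 lerD ?mulr_ge0 // lerXn2r ?nnegrE ?normc_ge0 ?(ltW r0) //.
  have fl : Num.floor (x + 2 * a) = Num.floor x.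
    by apply: floor_def; rewrite intrD; rewrite /frac in x0 x1 fx; lra.
  have fxa : frac (x + 2 * a) = frac x + 2 * a by rewrite /frac fl; ring.
  have := @fejer_approx _ t a M (x + 2 * a) isT a0; rewrite fxa => /(_ _).
  have -> : a <= frac x + 2 * a <= 1 - a by lra.
  move=> /(_ isT) h.
  have -> : expi (- t * frac x) - fejer t M (x + 2 * a) =
     (expi (- t * frac x) - expi (- t * (frac x + 2 * a))) -
     (fejer t M (x + 2 * a) - expi (- t * (frac x + 2 * a))) by ring.
  apply: le_trans (le_normcD _ _) _; rewrite normcN.
  have h2 : normc (expi (- t * frac x) - expi (- t * (frac x + 2 * a))) <= `|t| * (2 * a).
    apply: le_trans (normc_expiB _ _) _.
    by rewrite -mulrBr normrM normrN opprD addrA subrr add0r normrN (gtr0_norm (_ : 0 < 2 * a)) // mulr_gt0.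
  rewrite -/B in h; move: h h2 MB at_; set u := normc _; set v := normc _; lra.
have sx : s n%:R = frac x - 1.
  rewrite /s -/x (_ : Num.floor _ = Num.floor x + 1) ?intrD /frac; first by ring.
  by apply: floor_def; rewrite !intrD; rewrite /frac in x0 x1 fx; lra.
rewrite (_ : 0 < `|s n%:R| < d); last first.
  by rewrite sx ltr0_norm; last lra; lra.
rewrite mulr1 -[leLHS]add0r lerD ?sqr_ge0 //.
have -> : 4 = 2 ^+ 2 :> R by rewrite expr2; lra.
rewrite lerXn2r ?nnegrE ?normc_ge0 //.
apply: le_trans (le_normcD _ _) _; rewrite normcN normc_expi.
by have := normc_fejer t M (x + 2 * a); lra.
Unshelve. all: by end_near. Qed.

(** For integers smaller than [M] in absolute value, the mean of the [M]-th roots of unity raised to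
    the power [psi n] detects [psi n = 0]; each of these exponentials is almost periodic. *)
Lemma zero_set_bap (psi : int -> int) (f : R -> R) (C : R) : gen_linear f ->
  (forall n : int, f n%:~R = (psi n)%:~R) -> (forall n, `|(psi n)%:~R| <= C) ->
  bap (fun n => (psi n%:Z == 0)%:R : R[i]).
Proof.
move=> gf fpsi psiC; pose M := (Num.truncn C).+1.
apply: (@eq_bap _ _ (fun n => M%:R^-1 * \sum_(j < M) expi (2 * pi * (j%:R / M%:R) * f n%:R))).
  move=> n _; have lt : `|psi n%:Z| < M%:Z.
    rewrite -(ltr_int R) intr_norm; apply: le_lt_trans (psiC _) _.
    exact: Num.Theory.truncnS_gt.
  rewrite -(@roots_sum R M (psi n%:Z)) //; congr (_ * _).
  by apply: eq_bigr => j _; rewrite -fpsi.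
by apply: bapZ; apply: bap_sum => j; exact: gen_linear_bap.
Qed.

(** When [phi] has slope [a] and [J] is large, this is the number of all [n] with [phi n = m]: they
    lie in a bounded window around [m / a]. Searching only the window keeps the number of summands
    independent of [m]. *)
Definition fiber_count (phi : int -> int) (a : R) (J m : nat) : nat :=
  \sum_(j < (2 * J).+1) (phi (Num.floor (a^-1 * m%:R) + j%:Z - J%:Z)%R == m%:Z).

(** For each offset [j], [phi (g m) - m] is a bounded integer-valued generalized linear function of
    [m], because [g m] is within a bounded distance of [m / a]. *)
Lemma fiber_count_bap phi (f : R -> R) (a : R) J : gen_linear f ->
  (forall n : int, f n%:~R = (phi n)%:~R) ->
  0 < a -> (exists C, forall x, `|f x - a * x| <= C) ->
  bap (fun m => (fiber_count phi a J m)%:R : R[i]).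
Proof.
move=> gf fphi a0 [C fC]; rewrite /fiber_count; under eq_fun do rewrite natr_sum.
apply: bap_sum => j.
pose g (m : int) := Num.floor (a^-1 * m%:~R) + j%:Z - J%:Z.
apply: (@eq_bap _ _ (fun m => (phi (g m) - m%:Z == 0)%:R)); first by move=> m _; rewrite subr_eq0.
pose h (x : R) := (Num.floor (a^-1 * x))%:~R + (j%:Z - J%:Z)%:~R : R.
have hg m : h m%:~R = (g m)%:~R by rewrite /h /g -addrA [in RHS]intrD.
have gh : gen_linear h.
  apply: gen_linear_add; last exact: gen_linear_cst.
  by apply: gen_linear_floor; apply: gen_linear_scale; exact: gen_linear_id.
apply: (@zero_set_bap (fun m => phi (g m) - m) (fun x => f (h x) - x)
   (C + a * (1 + `|(j%:Z - J%:Z)%:~R|))).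
- by apply: gen_linear_sub; [exact: gen_linear_comp|exact: gen_linear_id].
- by move=> m; rewrite intrB -fphi hg.
move=> m; rewrite intrB -fphi -hg.
have -> : f (h m%:~R) - m%:~R = (f (h m%:~R) - a * h m%:~R) + a * (h m%:~R - a^-1 * m%:~R).
  by field; lra.
apply: le_trans (ler_normD _ _) _; rewrite lerD // normrM (gtr0_norm a0) ler_pM2l //.
rewrite /h addrAC; apply: le_trans (ler_normD _ _) _; rewrite lerD //.
have := floor_itv (a^-1 * m%:~R); rewrite intrD => ?.
by rewrite ler_norml; lra.
Qed.

End Generalized_linear_almost_periodic.

(** * Sums along [phi] as sums weighted by fiber counts *)

Section Fiber_sum.
Context {R : realType}.

(** Both sums become sums over [-J <= n <= N + J]: one keeps [1 <= n <= N], the other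
    [1 <= phi n <= a N]. The two conditions differ only near the ends, on a number of terms that
    depends neither on [F] nor on [N]. *)
Lemma fiber_sum_approx (phi : int -> int) (a C : R) : 0 < a ->
  (forall n, `|(phi n)%:~R - a * n%:~R| <= C) ->
  exists J K : nat, forall (F : int -> R[i]) (B : R) (N : nat),
    (forall m, normc (F m) <= B) ->
    normc (\sum_(1 <= n < N.+1) F (phi n) -
      \sum_(1 <= m < (Num.truncn (a * N%:R)).+1) (fiber_count phi a J m)%:R * F m)
    <= K%:R * B.
Proof.
move=> a0 phiC; pose J := (Num.truncn ((C + 1) / a) + 3)%N.
have C0 : 0 <= C by apply: le_trans (phiC 0).
have hJ : (C + 1) / a + 2 <= J%:R.
  rewrite /J natrD; have := Num.Theory.truncnS_gt ((C + 1) / a); rewrite -natr1; lra.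
have hJa : C + 1 + 2 * a <= a * J%:R.
  by move: hJ; rewrite -(ler_pM2l a0) mulrDr mulrC divfK ?gt_eqF // mulrC; lra.
exists J, ((2 * J).+1 + (2 * J).+1)%N => F B N FB.
have B0 : 0 <= B by apply: le_trans (FB 0); exact: normc_ge0.
set M := Num.truncn (a * N%:R); set L := (N + 2 * J).+1.
have /andP[M1 M2] : M%:R <= a * N%:R < M.+1%:R.
  by apply: Num.Theory.truncn_itv; rewrite mulr_ge0 // ltW.
pose nu (i : nat) : int := i%:Z - J%:Z.
have fiberE m : (1 <= m < M.+1)%N ->
    fiber_count phi a J m = (\sum_(i < L) (phi (nu i) == m%:Z))%N.
  move=> /andP[m1 mM].
  set q := Num.floor (a^-1 * m%:R).
  have /andP[q1 q2] := floor_itv (a^-1 * m%:R); rewrite -/q in q1 q2.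
  have am0 : 0 <= a^-1 * m%:R by rewrite mulr_ge0 ?invr_ge0 ?(ltW a0).
  have q0 : 0 <= q by rewrite floor_ge0.
  have qN : q <= N%:Z.
    rewrite -(ler_int R); apply: le_trans q1 _; rewrite mulrC ler_pdivrMr // mulrC.
    by apply: le_trans M1; rewrite ler_nat.
  have near_ n : phi n = m%:Z -> q - J%:Z <= n <= q + J%:Z.
    move=> e; have := phiC n; rewrite e ler_norml => /andP[h1 h2].
    have h3 : n%:~R <= a^-1 * m%:R + C / a.
      by rewrite mulrC -mulrDl ler_pdivlMr // mulrC; rewrite -pmulrn in h1; lra.
    have h4 : a^-1 * m%:R - C / a <= n%:~R.
      by rewrite mulrC -mulrBl ler_pdivrMr // mulrC; rewrite -pmulrn in h2; lra.
    have h5 : C / a + 2 <= J%:R.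
      by apply: le_trans hJ; rewrite lerD2r ler_pM2r ?invr_gt0 // lerDl.
    rewrite -!(ler_int R) intrB intrD -!pmulrn; rewrite intrD in q2; lra.
  pose Q := absz q; have qE : q = Q%:Z by rewrite /Q gez0_abs.
  have QN : (Q <= N)%N by move: qN; rewrite qE.
  rewrite -(big_mkord xpredT (fun i => nat_of_bool (phi (nu i) == m%:Z))).
  have out i : (i < Q)%N || (Q + (2 * J).+1 <= i)%N -> (phi (nu i) == m%:Z) = false.
    by move=> hi; apply/eqP => /near_; rewrite /nu; lia.
  rewrite (@big_cat_nat _ _ _ Q) /=; [|lia|lia].
  rewrite big_nat big1 ?add0n => [|i /andP[_ iQ]]; last by rewrite out ?iQ.
  rewrite (@big_cat_nat _ _ _ (Q + (2 * J).+1)) /=; [|lia|lia].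
  have -> : (\sum_(Q + (2 * J).+1 <= i < L) (phi (nu i) == m%:Z) = 0)%N.
    by rewrite big_nat big1 // => i /andP[Qi _]; rewrite out ?Qi ?orbT.
  have shift (G : nat -> nat) P : (\sum_(Q <= i < Q + P) G i = \sum_(0 <= i < P) G (i + Q))%N.
    by rewrite -{1}[Q]add0n big_addn addKn.
  rewrite addn0 shift big_mkord.
  rewrite /fiber_count; apply: eq_bigr => j _; rewrite -/q qE /nu.
  by congr (nat_of_bool (phi _ == _)); lia.
have -> : \sum_(1 <= m < M.+1) (fiber_count phi a J m)%:R * F m =
    \sum_(i < L) (if 1 <= phi (nu i) <= M%:Z then F (phi (nu i)) else 0).
  rewrite (eq_big_nat _ _ (F2 := fun m => \sum_(i < L) (phi (nu i) == m%:Z)%:R * F m)); last first.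
    by move=> m hm; rewrite fiberE // natr_sum mulr_suml.
  rewrite exchange_big /=; apply: eq_bigr => i _.
  case: ifPn => [/andP[z1 zM]|hz].
    pose p := absz (phi (nu i)); have pE : phi (nu i) = p%:Z by rewrite /p gez0_abs; lia.
    rewrite (bigD1_seq p) ?iota_uniq //=; last by rewrite mem_index_iota; lia.
    rewrite -pE eqxx mul1r big1 ?addr0 // => m mp.
    by rewrite pE eqz_nat eq_sym (negbTE mp) mul0r.
  rewrite big_nat big1 // => m /andP[m1 mM].
  case: eqP => [e|_]; last by rewrite mul0r.
  by move: hz; rewrite e; lia.
have -> : \sum_(1 <= n < N.+1) F (phi n) =
    \sum_(i < L) (if (J < i)%N && (i <= N + J)%N then F (phi (nu i)) else 0).
  rewrite -(big_mkord xpredT (fun i => if (J < i)%N && (i <= N + J)%N then F (phi (nu i)) else 0)).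
  rewrite [RHS](@big_cat_nat _ _ _ J.+1) /=; [|lia|lia].
  rewrite [X in _ = X + _]big_nat [X in _ = X + _]big1 ?add0r => [|i]; last by case: ifP => //; lia.
  rewrite [RHS](@big_cat_nat _ _ _ (N + J).+1) /=; [|lia|lia].
  rewrite [X in _ = _ + X]big_nat [X in _ = _ + X]big1 ?addr0 => [|i]; last by case: ifP => //; lia.
  have -> : (N + J).+1 = (N.+1 + J)%N by [].
  rewrite -[in RHS](add1n J) big_addn addnK.
  apply: eq_big_nat => n hn; rewrite ifT; last by lia.
  by congr (F (phi _)); rewrite /nu; lia.
rewrite -sumrB; apply: le_trans (normc_sum _ _ _) _.
apply: (@le_trans _ _ (\sum_(i < L) ((i < (2 * J).+1)%N + (N <= i)%N)%:R * B)); last first.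
  rewrite -mulr_suml ler_wpM2r // -natr_sum ler_nat big_split /= leq_add //.
    rewrite -(big_mkord xpredT (fun i => nat_of_bool (i < (2 * J).+1)%N)).
    rewrite (@big_cat_nat _ _ _ (2 * J).+1) /=; [|lia|lia].
    rewrite [X in (_ + X <= _)%N]big_nat [X in (_ + X <= _)%N]big1 ?addn0 => [|i]; last by lia.
    rewrite (@leq_trans (\sum_(0 <= i < (2 * J).+1) 1)%N) //.
      by apply: leq_sum => i _; exact: leq_b1.
    by rewrite sum_nat_const_nat muln1 subn0.
  rewrite -(big_mkord xpredT (fun i => nat_of_bool (N <= i)%N)).
  rewrite (@big_cat_nat _ _ _ N) /=; [|lia|lia].
  rewrite big_nat big1 ?add0n => [|i]; last by lia.
  rewrite (@leq_trans (\sum_(N <= i < L) 1)%N) //.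
    by apply: leq_sum => i _; exact: leq_b1.
  by rewrite sum_nat_const_nat muln1 /L; lia.
apply: ler_sum => i _; have iL := ltn_ord i.
(* In the middle range the size of [J] forces both conditions to hold; elsewhere the two terms
   differ by at most [B]. *)
have [mid|far] := boolP ((2 * J < i)%N && (i < N)%N); last first.
  apply: (@le_trans _ _ (1 * B)); last by rewrite ler_wpM2r // (ler_nat _ 1); lia.
  rewrite mul1r; case: ifP => _; case: ifP => _; rewrite ?subrr ?subr0 ?sub0r ?normcN ?normc0E //.
rewrite ifT; last by lia.
rewrite ifT ?subrr ?normc0E ?mulr_ge0 //.
have := phiC (nu i); rewrite ler_norml => /andP[h1 h2].
have J2 : J%:R + 1 <= (nu i)%:~R :> R.
  by rewrite -[1]/(1%:~R) pmulrn -intrD ler_int /nu; lia.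
have N2 : (nu i)%:~R + J%:R <= N%:R :> R.
  by rewrite !pmulrn -intrD ler_int /nu; lia.
have J2' := J2; have N2' := N2; rewrite -(ler_pM2l a0) mulrDr in J2'.
rewrite -(ler_pM2l a0) mulrDr in N2'.
apply/andP; split.
  by rewrite -(ler_int R); lra.
rewrite -ltzD1 -(ltr_int R) intrD -pmulrn; rewrite -natr1 in M2; lra.
Qed.

End Fiber_sum.

(** * Semi-inner products and the van der Corput inequality *)

(** Only semidefinite: the form will live on functions not identified modulo null sets, where a
    vector of norm 0 need not be 0. *)
Record sesquilinear_psd (R : realType) (V : lmodType R[i]) := SesquilinearPsd {
  form :> V -> V -> R[i];
  formDl : forall x y z, form (x + y) z = form x z + form y z;
  formZl : forall a x y, form (a *: x) y = a * form x y;
  formJ : forall x y, form y x = conjc (form x y);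
  form_ge0 : forall x, 0 <= complex.Re (form x x) }.

Lemma Re_natVM (R : realType) n (z : R[i]) : complex.Re (n%:R^-1 * z) = n%:R^-1 * complex.Re z.
Proof. by rewrite -ReM_real fmorphV rmorph_nat. Qed.

Lemma Re_favg (R : realType) (u : nat -> R[i]) N :
  complex.Re (favg u N) = favg (fun n => complex.Re (u n)) N.
Proof. by rewrite /favg Re_natVM Re_sum. Qed.

Lemma conjc_natV (R : realType) n : conjc (n%:R^-1 : R[i]) = n%:R^-1.
Proof. by rewrite conjc_inv conjc_nat. Qed.

Section Semi_inner_product.
Context {R : realType} {V : lmodType R[i]} (ip : sesquilinear_psd V).
Implicit Types (x y z : V) (a b : R[i]).

Definition nrm2 x : R := complex.Re (ip x x).

Lemma formDr x y z : ip x (y + z) = ip x y + ip x z.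
Proof. by rewrite formJ formDl conjcD -!formJ. Qed.

Lemma formZr a x y : ip x (a *: y) = conjc a * ip x y.
Proof. by rewrite formJ formZl conjcM -formJ. Qed.

Lemma form_nrm2 x : ip x x = (nrm2 x)%:C.
Proof.
rewrite /nrm2; have := formJ ip x x; case: (ip x x) => a b [] h.
by congr (_ +i* _) => /=; lra.
Qed.

Lemma nrm2_ge0 x : 0 <= nrm2 x.
Proof. exact: form_ge0. Qed.

Lemma nrm2Z a x : nrm2 (a *: x) = normc a ^+ 2 * nrm2 x.
Proof.
by rewrite /nrm2 formZl formZr mulrA mulcJ ReM_real.
Qed.

Lemma form0l y : ip 0 y = 0.
Proof. by have := formZl ip 0 0 y; rewrite scale0r mul0r. Qed.

Lemma form0r x : ip x 0 = 0.
Proof. by rewrite formJ form0l conjc0. Qed.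

Lemma nrm2_0 : nrm2 0 = 0.
Proof. by rewrite /nrm2 form0l. Qed.

Lemma form_suml (I : Type) (r : seq I) (P : pred I) (F : I -> V) y :
  ip (\sum_(i <- r | P i) F i) y = \sum_(i <- r | P i) ip (F i) y.
Proof.
elim/big_rec2: _ => [|i u v _ <-]; [exact: form0l|exact: formDl].
Qed.

Lemma form_sumr (I : Type) (r : seq I) (P : pred I) (F : I -> V) x :
  ip x (\sum_(i <- r | P i) F i) = \sum_(i <- r | P i) ip x (F i).
Proof.
elim/big_rec2: _ => [|i u v _ <-]; [exact: form0r|exact: formDr].
Qed.

Lemma nrm2D x y : nrm2 (x + y) = nrm2 x + nrm2 y + 2 * complex.Re (ip x y).
Proof.
rewrite /nrm2 formDl !formDr (formJ ip x y).
case: (ip x x) (ip x y) (ip y y) => [? ?] [? ?] [? ?] /=; ring.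
Qed.

Lemma nrm2N x : nrm2 (- x) = nrm2 x.
Proof. by rewrite -scaleN1r nrm2Z normcN normc1E expr1n mul1r. Qed.

Lemma nrm2B_comm x y : nrm2 (x - y) = nrm2 (y - x).
Proof. by rewrite -nrm2N opprB. Qed.

Lemma nrm2B x y : nrm2 (x - y) = nrm2 x + nrm2 y - 2 * complex.Re (ip x y).
Proof.
rewrite nrm2D nrm2N -scaleN1r formZr (_ : conjc (-1) = -1); last first.
  by apply/eqP; rewrite eq_complex /= !oppr0 !eqxx.
by rewrite mulN1r; case: (ip x y) => ? ? /=; ring.
Qed.

Lemma parallelogram x y : nrm2 (x + y) + nrm2 (x - y) = 2 * nrm2 x + 2 * nrm2 y.
Proof. by rewrite nrm2D nrm2B; ring. Qed.

Lemma nrm2D_le x y : nrm2 (x + y) <= 2 * nrm2 x + 2 * nrm2 y.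
Proof. by rewrite -parallelogram lerDl nrm2_ge0. Qed.

Lemma bessel1 x y : nrm2 y = 1 -> normc (ip x y) ^+ 2 <= nrm2 x.
Proof.
move=> y1; rewrite -subr_ge0; have := nrm2_ge0 (x - ip x y *: y).
rewrite nrm2B nrm2Z y1 mulr1 formZr [conjc _ * _]mulrC mulcJ /=; lra.
Qed.

Definition vavg (u : nat -> V) N : V := N%:R^-1 *: \sum_(1 <= n < N.+1) u n.

Lemma vavgB u v N : vavg u N - vavg v N = vavg (fun n => u n - v n) N.
Proof. by rewrite /vavg -scalerBr sumrB. Qed.

Lemma nrm2_mean (I : eqType) (r : seq I) (F : I -> V) :
  nrm2 ((size r)%:R^-1 *: \sum_(i <- r) F i) <= (size r)%:R^-1 * \sum_(i <- r) nrm2 (F i).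
Proof.
set n := size r; have [n0|n0] := posnP n.
  by rewrite n0 !invr0 scale0r nrm2_0 mul0r.
have n0' : 0 < n%:R :> R by rewrite ltr0n.
set m := _ *: _; rewrite mulrC ler_pdivlMr // -subr_ge0.
suff -> : \sum_(i <- r) nrm2 (F i) - nrm2 m * n%:R = \sum_(i <- r) nrm2 (F i - m).
  by apply: sumr_ge0 => i _; exact: nrm2_ge0.
have mE : \sum_(i <- r) F i = n%:R *: m.
  by rewrite /m scalerA mulfV ?scale1r // pnatr_eq0 -lt0n.
have e : \sum_(i <- r) complex.Re (ip (F i) m) = n%:R * nrm2 m.
  rewrite -Re_sum -form_suml mE formZl form_nrm2.
  by rewrite -(rmorph_nat (real_complex R)) ReM_real.
rewrite (eq_bigr _ (fun i _ => nrm2B (F i) m)) big_split /= big_split /= sumrN -mulr_sumr e.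
rewrite big_const_seq count_predT iter_addr_0 -/n -[_ *+ n]mulr_natr; ring.
Qed.

Lemma nrm2_sum_le (I : eqType) (r : seq I) (F : I -> V) :
  nrm2 (\sum_(i <- r) F i) <= (size r)%:R * \sum_(i <- r) nrm2 (F i).
Proof.
have [n0|n0] := posnP (size r).
  by rewrite (size0nil n0) !big_nil nrm2_0 mulr0.
have n0' : 0 < (size r)%:R :> R by rewrite ltr0n.
have := nrm2_mean r F; rewrite nrm2Z normc_natV.
rewrite -(ler_pM2l n0') -(ler_pM2l n0'); congr (_ <= _); last by field; lra.
by field; lra.
Qed.

Lemma nrm2_vavg u N : nrm2 (vavg u N) <= favg (fun n => nrm2 (u n)) N.
Proof.
have := nrm2_mean (index_iota 1 N.+1) u.
by rewrite size_iota subn1.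
Qed.

Lemma nrm2_vavg_shift u (B : R) h N : (forall n, nrm2 (u n) <= B) ->
  nrm2 (vavg u N - vavg (fun n => u (n + h)%N) N) <= 4 * h%:R ^+ 2 * B / N%:R ^+ 2.
Proof.
move=> uB.
have [->|N0] := posnP N; first by rewrite /vavg !invr0 !scale0r subr0 nrm2_0 expr0n invr0 mulr0.
rewrite /vavg -scalerBr nrm2Z normc_natV mulrC exprVn ler_wpM2r ?invr_ge0 ?sqr_ge0 //.
have -> : \sum_(1 <= n < N.+1) u n - \sum_(1 <= n < N.+1) u (n + h)%N =
    \sum_(1 <= n < 1 + h) u n - \sum_(N.+1 <= n < N.+1 + h) u n.
  have -> : \sum_(1 <= n < N.+1) u (n + h)%N = \sum_(1 + h <= n < N.+1 + h) u n.
    by rewrite big_addn addnK.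
  have : \sum_(1 <= n < N.+1) u n + \sum_(N.+1 <= n < N.+1 + h) u n =
      \sum_(1 <= n < 1 + h) u n + \sum_(1 + h <= n < N.+1 + h) u n.
    by rewrite -!big_cat_nat //= ?leq_addr // leq_add2r.
  by move=> e; apply/eqP; rewrite subr_eq addrAC eq_sym subr_eq e.
apply: le_trans (nrm2D_le _ _) _; rewrite nrm2N.
have bnd (a : nat) : nrm2 (\sum_(a <= n < a + h) u n) <= h%:R ^+ 2 * B.
  apply: le_trans (nrm2_sum_le _ _) _.
  rewrite size_iota addKn expr2 -mulrA ler_wpM2l //.
  apply: (@le_trans _ _ (\sum_(a <= n < a + h) B)); first by apply: ler_sum.
  by rewrite sumr_const_nat addKn mulr_natl.
by have := bnd 1%N; have := bnd N.+1; lra.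
Qed.

(** Long averages hardly change when [u] is replaced by its short averages [w] over [H] consecutive
    terms. The mean of the squared norms of [w] is a double mean over [h, h' < H] of correlations,
    whose limits are the [g h h']. *)
Lemma van_der_corput u (B : R) (g : nat -> nat -> R[i]) :
  (forall n, nrm2 (u n) <= B) ->
  (forall h h', vanish (fun N =>
     normc (favg (fun m => ip (u (m + h)%N) (u (m + h')%N)) N - g h h'))) ->
  (forall e, 0 < e -> exists2 H, (0 < H)%N &
     complex.Re (H%:R^-1 ^+ 2 * \sum_(h < H) \sum_(h' < H) g h h') <= e) ->
  vanish (fun N => nrm2 (vavg u N)).
Proof.
move=> uB ug gH; apply: vanish_approx => e e0.
have e2 : 0 < e / 2 by rewrite divr_gt0.
have [H H0 hH] := gH _ e2.
have B0 : 0 <= B by apply: le_trans (uB 0%N); exact: nrm2_ge0.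
pose w m := H%:R^-1 *: \sum_(h < H) u (m + h)%N.
pose b1 N := 2 * (4 * H%:R ^+ 2 * B * (N%:R^-1) ^+ 2).
pose b2 N := 2 * (H%:R^-1 ^+ 2 * \sum_(h < H) \sum_(h' < H)
  normc (favg (fun m => ip (u (m + h)%N) (u (m + h')%N)) N - g h h')).
exists (fun N => b1 N + b2 N).
  apply: vanishD.
    apply: vanishZ => //; apply: vanishZ; first by rewrite !mulr_ge0 ?sqr_ge0.
    apply: vanish_sqr => [N|]; first by rewrite invr_ge0.
    by apply: (vanish_le (vanish_invn 1)) => N; rewrite mul1r.
  apply: vanishZ => //; apply: vanishZ; first exact: sqr_ge0.
  by apply: vanish_sum => h _; apply: vanish_sum => h' _.
near=> N.
have N0 : (0 < N)%N by near: N; exact: near_gt0.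
have -> : vavg u N = (vavg u N - vavg w N) + vavg w N by rewrite subrK.
apply: le_trans (nrm2D_le _ _) _.
rewrite -addrA [leRHS](_ : _ = 2 * (b1 N / 2) + 2 * (b2 N / 2 + e / 2)); last by field.
rewrite lerD // ler_pM2l //.
  have -> : vavg u N - vavg w N = H%:R^-1 *: \sum_(h < H) (vavg u N - vavg (fun n => u (n + h)%N) N).
    rewrite sumrB sumr_const card_ord scalerBr -[vavg u N *+ H]scaler_nat scalerA mulVf ?pnatr_eq0 -?lt0n // scale1r.
    congr (_ - _); rewrite /vavg /w -scaler_sumr scalerA mulrC -scalerA; congr (_ *: _).
    by rewrite exchange_big /= scaler_sumr.
  have := nrm2_mean (index_enum 'I_H) (fun h : 'I_H => vavg u N - vavg (fun n => u (n + h)%N) N).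
  rewrite (_ : size _ = H); last by rewrite -[RHS](card_ord H) cardT enumT.
  move=> /le_trans; apply; rewrite ler_pdivrMl ?ltr0n //.
  apply: (@le_trans _ _ (\sum_(h < H) b1 N / 2)); last by rewrite sumr_const card_ord mulr_natl.
  apply: ler_sum => h _; apply: le_trans (nrm2_vavg_shift _ _ uB) _.
  rewrite -exprVn /b1; set v := N%:R^-1 ^+ 2; have v0 : 0 <= v by exact: sqr_ge0.
  rewrite [leRHS](_ : _ = 4 * H%:R ^+ 2 * B * v); last by field.
  rewrite ler_wpM2r // ler_wpM2r // ler_pM2l //.
  by rewrite lerXn2r ?nnegrE // ler_nat ltnW.
apply: le_trans (nrm2_vavg _ _) _.
have -> : favg (fun n => nrm2 (w n)) N = complex.Re (H%:R^-1 ^+ 2 * \sum_(h < H) \sum_(h' < H)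
    favg (fun m => ip (u (m + h)%N) (u (m + h')%N)) N).
  transitivity (complex.Re (favg (fun m => H%:R^-1 ^+ 2 * \sum_(h < H) \sum_(h' < H)
      ip (u (m + h)%N) (u (m + h')%N)) N)); last first.
    congr complex.Re; rewrite favgZ favg_sum; congr (_ * _).
    by apply: eq_bigr => h _; rewrite favg_sum.
  rewrite Re_favg; apply: eq_favg => m _.
  rewrite /nrm2 /w formZl formZr form_suml conjc_natV mulrA -expr2; congr (complex.Re (_ * _)).
  by apply: eq_bigr => h _; rewrite form_sumr.
rewrite /b2 [2 * _]mulrC mulfK //.
have -> : \sum_(h < H) \sum_(h' < H) favg (fun m => ip (u (m + h)%N) (u (m + h')%N)) N =
   \sum_(h < H) \sum_(h' < H) (favg (fun m => ip (u (m + h)%N) (u (m + h')%N)) N - g h h') +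
   \sum_(h < H) \sum_(h' < H) g h h'.
  by rewrite -big_split; apply: eq_bigr => h _; rewrite -big_split; apply: eq_bigr => h' _; rewrite /= subrK.
rewrite mulrDr raddfD /=.
set S := \sum_(h < H) \sum_(h' < H) (_ - _).
have -> : complex.Re (H%:R^-1 ^+ 2 * S) = H%:R^-1 ^+ 2 * complex.Re S.
  by rewrite expr2 -mulrA !Re_natVM mulrA -expr2.
have : complex.Re S <= \sum_(h < H) \sum_(h' < H)
    normc (favg (fun m => ip (u (m + h)%N) (u (m + h')%N)) N - g h h').
  apply: le_trans (ler_Re _) _; apply: le_trans (normc_sum _ _ _) _.
  by apply: ler_sum => h _; apply: normc_sum.
move=> /(ler_wpM2l (sqr_ge0 (H%:R^-1 : R))); move: hH; lra.
Unshelve. all: by end_near. Qed.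

End Semi_inner_product.

(** * A Wiener criterion for products of positive definite sequences *)

Section Positive_definite_product.
Context {R : realType} {k : nat}.
(** Think of [c i] as the Fourier coefficients of a positive measure on the circle: [N * sig i N] is
    its Fejér density, and [sig i N s] tends to the mass of the atom at [s]. The last hypothesis
    then says that the convolution of the measures has no atom at [-t]. *)
Variables (c : 'I_k -> int -> R[i]) (B : R) (sig : 'I_k -> nat -> R -> R) (t : R).
Hypothesis B1 : 1 <= B.
Hypothesis cB : forall i l, normc (c i l) <= B.
Hypothesis sigE : forall i N s, (sig i N s)%:C = N%:R^-1 ^+ 2 *
  \sum_(n < N) \sum_(m < N) expi (- s * (n%:Z - m%:Z)%:~R) * c i (n%:Z - m%:Z).
Hypothesis sig_ge0 : forall i N s, 0 <= sig i N s.
Hypothesis sig_double : forall i N s, sig i (2 * N)%N s <= sig i N s.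
Hypothesis sig_small : forall s : 'I_k -> R, expi (t + \sum_i s i) = 1 ->
  exists i, forall e, 0 < e -> exists J, sig i (2 ^ J)%N (s i) <= e.

Let B0 : 0 <= B. Proof. exact: le_trans ler01 B1. Qed.

Lemma sig_pow2_mono i J J' s : (J <= J')%N -> sig i (2 ^ J')%N s <= sig i (2 ^ J)%N s.
Proof.
move=> /subnKC <-; elim: (J' - J)%N => [|n IHn]; first by rewrite addn0.
by rewrite addnS expnS; apply: le_trans (sig_double _ _ _) IHn.
Qed.

Lemma sig_lipschitz i N : exists2 K : R, 0 < K & forall s s',
  sig i N s' <= sig i N s + K * `|s' - s|.
Proof.
pose K := \sum_(n < N) \sum_(m < N) `|(n%:Z - m%:Z)%:~R : R| * B.
exists (N%:R^-1 ^+ 2 * K + 1).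
  by rewrite ltr_wpDl // mulr_ge0 ?sqr_ge0 //; do 2![apply: sumr_ge0 => ? _]; rewrite mulr_ge0.
move=> s s'; rewrite addrC -lerBlDr.
apply: (@le_trans _ _ (normc (sig i N s' - sig i N s)%:C)); first by rewrite normc_real ler_norm.
rewrite rmorphB /= !sigE -mulrBr -sumrB ComplexField.Normc.normcM normcX normc_natV.
rewrite [leRHS]mulrDl mul1r -[leLHS]addr0 lerD // -[leRHS]mulrA ler_wpM2l ?sqr_ge0 //.
apply: le_trans (normc_sum _ _ _) _; rewrite /K mulr_suml; apply: ler_sum => n _.
rewrite -sumrB; apply: le_trans (normc_sum _ _ _) _; rewrite mulr_suml; apply: ler_sum => m _.
rewrite -mulrBl ComplexField.Normc.normcM mulrAC; apply: ler_pM; rewrite ?normc_ge0 //.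
apply: le_trans (normc_expiB _ _) _.
have -> : - s' * (n%:Z - m%:Z)%:~R - - s * (n%:Z - m%:Z)%:~R = - ((n%:Z - m%:Z)%:~R * (s' - s)) by ring.
by rewrite normrN normrM.
Qed.

(* Dini's argument: compactness of the torus makes the pointwise smallness uniform. *)
Lemma sig_small_uniform e : 0 < e -> exists2 eta : R, 0 < eta & exists J0, forall s : 'I_k -> R,
  (forall i, 0 <= s i <= 2 * pi) -> normc (expi (t + \sum_i s i) - 1) < eta ->
  exists i, forall J, (J0 <= J)%N -> sig i (2 ^ J)%N (s i) <= e.
Proof.
move=> e0; apply: contrapT => /forall2NP H.
have bad n : exists s : 'rV[R]_k, [/\ forall i, 0 <= s ord0 i <= 2 * pi,
    normc (expi (t + \sum_i s ord0 i) - 1) < n.+1%:R^-1 &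
    forall i, e < sig i (2 ^ n)%N (s ord0 i)].
  have [|/forallNP/(_ n)/existsNP[s /not_implyP[sp /not_implyP[st /forallNP h]]]] := H n.+1%:R^-1.
    by rewrite invr_gt0 ltr0n.
  exists (\row_i s i); split.
  - by move=> i; rewrite mxE.
  - by under eq_bigr do rewrite mxE.
  move=> i; rewrite mxE ltNge; apply/negP => se; apply: (h i) => J nJ.
  by apply: le_trans se; exact: sig_pow2_mono.
have [s hs] := choice bad.
have cpt : compact [set v : 'rV[R]_k | forall i, [set x : R | 0 <= x <= 2 * pi] (v ord0 i)].
  apply: (@rV_compact R k (fun=> [set x : R | 0 <= x <= 2 * pi])) => _; rewrite (_ : [set x : R | _] = `[0, 2 * pi]%classic).
    exact: segment_compact.
  by apply/seteqP; split => x /=; rewrite in_itv.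
have [z [_ zcl]] : [set v : 'rV[R]_k | forall i, [set x : R | 0 <= x <= 2 * pi] (v ord0 i)]
    `&` cluster (s @ \oo) !=set0.
  by apply: cpt; exists 0%N => // n _ i /=; have [] := hs n.
have freq (d : R) n0 : 0 < d -> exists2 n, (n0 <= n)%N & forall i, `|z ord0 i - s n ord0 i| < d.
  move=> d0.
  have [v [[n /= n0n <-] vz]] : [set s n | n in [set n | (n0 <= n)%N]] `&` ball z d !=set0.
    apply: zcl; last exact: nbhsx_ballx.
    by exists n0 => // n /= n0n; exists n.
  by exists n => // i; have [_ /(_ ord0 i)] := vz.
have zt : expi (t + \sum_i z ord0 i) = 1.
  apply/eqP; rewrite -subr_eq0 -normc_eq0 eq_le normc_ge0 andbT.
  apply/ler_addgt0Pr => d d0; rewrite add0r.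
  pose d' := d / 2 / (k%:R + 1).
  have k1 : 0 < k%:R + 1 :> R by rewrite ltr_wpDl.
  have d'0 : 0 < d' by rewrite !divr_gt0.
  have [n nn hn] := freq d' (Num.truncn (2 / d)) d'0.
  have [_ st _] := hs n.
  have -> : expi (t + \sum_i z ord0 i) - 1 =
    (expi (t + \sum_i z ord0 i) - expi (t + \sum_i s n ord0 i)) +
    (expi (t + \sum_i s n ord0 i) - 1) by ring.
  apply: le_trans (le_normcD _ _) _; rewrite (splitr d) lerD //.
    apply: le_trans (normc_expiB _ _) _; rewrite opprD addrACA subrr add0r -sumrB.
    apply: le_trans (ler_norm_sum _ _ _) _.
    apply: (@le_trans _ _ (\sum_(i < k) d')); first by apply: ler_sum => i _; exact: ltW.
    rewrite sumr_const card_ord -[d' *+ k]mulr_natl /d' mulrCA ler_piMr ?divr_ge0 ?(ltW d0) //.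
    by rewrite ler_pdivrMr // mul1r lerDl.
  apply: le_trans (ltW st) _; rewrite -[leRHS]invrK lef_pV2 ?posrE ?invr_gt0 ?divr_gt0 ?ltr0n //.
  rewrite invf_div; apply: ltW; apply: lt_le_trans (Num.Theory.truncnS_gt _) _.
  by rewrite ler_nat.
(* Some coordinate of the limit point [z] has small [sig]. By Lipschitz continuity and monotonicity
   in the dyadic scale so does that coordinate of a late [s n], against the choice of [s n]. *)
have [i hi] := sig_small zt.
have [J hJ] := hi (e / 2) (divr_gt0 e0 (ltr0n _ 2)).
have [K K0 lip] := sig_lipschitz i (2 ^ J)%N.
have d0 : 0 < e / 2 / K by rewrite !divr_gt0.
have [n Jn hn] := freq (e / 2 / K) J d0.
have [_ _ /(_ i)] := hs n; apply/negP; rewrite -leNgt.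
apply: le_trans (sig_pow2_mono _ _ Jn) _; apply: le_trans (lip (z ord0 i) _) _.
rewrite (splitr e) lerD // mulrC -ler_pdivlMr // distrC.
exact: ltW.
Unshelve. all: by end_near. Qed.

Section Roots_of_unity.
Variables (N H : nat).
Hypotheses (H0 : (0 < H)%N) (HN : (H <= N)%N).
Let M := (2 * N)%N.
Let node (j : nat) : R := 2 * pi * (j%:R / M%:R).

(** For [|l| < N] this is the Fejér weight [1 - |l| / N], in the form of a count. *)
Definition overlap (l : int) : R :=
  N%:R^-1 * (\sum_(m < N) \sum_(n < N) (n%:Z - m%:Z == l)%R)%:R.

Let N0 : (0 < N)%N. Proof. exact: leq_trans H0 HN. Qed.

Lemma overlap_le1 l : overlap l <= 1.
Proof.
rewrite /overlap mulrC ler_pdivrMr ?ltr0n // mul1r ler_nat.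
apply: (@leq_trans (\sum_(m < N) 1)%N); last by rewrite sum_nat_const card_ord muln1.
apply: leq_sum => m _.
have [/existsP[n nl]|] := boolP [exists n : 'I_N, (n%:Z - m%:Z == l)%R]; last first.
  by rewrite negb_exists => /forallP h; rewrite big1 // => n _; rewrite (negbTE (h n)).
rewrite (bigD1 n) //= nl big1 // => n' n'n; apply/eqP; rewrite eqb0; apply: contra n'n => e.
apply/eqP/val_inj => /=; lia.
Qed.

Lemma overlap_ge l : (`|l| < H%:Z)%R -> 1 - 2 * H%:R / N%:R <= overlap l.
Proof.
move=> lH; rewrite /overlap [leRHS]mulrC ler_pdivlMr ?ltr0n // mulrBl mul1r divfK ?pnatr_eq0 -?lt0n //.
rewrite lerBlDr -natrM -natrD ler_nat.
have {1}-> : N = (\sum_(m < N) 1)%N by rewrite sum_nat_const card_ord muln1.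
apply: (@leq_trans (\sum_(m < N) (\sum_(n < N) (n%:Z - m%:Z == l)%R + ((m < H)%N + (N - H <= m)%N)))%N).
  apply: leq_sum => m _; have mN := ltn_ord m.
  case: (ltnP m H) => mH; first by rewrite addnC -addnA.
  case: (leqP (N - H) m) => mNH; first by rewrite addnC.
  have nN : (absz (m%:Z + l)%R < N)%N by lia.
  rewrite (bigD1 (Ordinal nN)) //= (_ : _ == l); last by lia.
  by rewrite -addnA.
rewrite big_split /= leq_add2l big_split /= mul2n -addnn leq_add //.
  apply: (@leq_trans (\sum_(m < N | (m < H)%N) 1)%N).
    by rewrite [leqRHS]big_mkcond; apply: leq_sum => m _; case: ifP.
  by rewrite -(big_ord_widen N (fun=> 1%N) HN) sum_nat_const card_ord muln1.
rewrite -(big_mkord xpredT (fun i => nat_of_bool (N - H <= i)%N)).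
rewrite (@big_cat_nat _ _ _ (N - H)) ?leq_subr //= big_nat big1 ?add0n; last by move=> i; lia.
apply: (@leq_trans (\sum_(N - H <= i < N) 1)%N); first by apply: leq_sum => i _; exact: leq_b1.
by rewrite sum_nat_const_nat muln1; lia.
Qed.

(** The frequencies [n - m] of [sig i N] are below [N] in absolute value and [|l| < H <= N], so
    [2 N] nodes recover the coefficient without aliasing. *)
Lemma fourier_sig i l : (`|l| < H%:Z)%R ->
  \sum_(j < M) (M%:R^-1 * (N%:R * sig i N (node j)))%:C * expi (node j * l%:~R)
  = (overlap l)%:C * c i l.
Proof.
move=> lH.
transitivity (N%:R^-1 * \sum_(n < N) \sum_(m < N) c i (n%:Z - m%:Z) *
    (M%:R^-1 * \sum_(j < M) expi (node j * (l - (n%:Z - m%:Z))%:~R))).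
  rewrite (eq_bigr (fun j : 'I_M => \sum_(n < N) \sum_(m < N)
      N%:R^-1 * (c i (n%:Z - m%:Z) * (M%:R^-1 * expi (node j * (l - (n%:Z - m%:Z))%:~R))))); last first.
    move=> j _; rewrite !rmorphM /= sigE fmorphV !rmorph_nat.
    have -> : N%:R * (N%:R^-1 ^+ 2 * \sum_(n < N) \sum_(m < N)
        expi (- node j * (n%:Z - m%:Z)%:~R) * c i (n%:Z - m%:Z)) = N%:R^-1 * \sum_(n < N) \sum_(m < N)
        expi (- node j * (n%:Z - m%:Z)%:~R) * c i (n%:Z - m%:Z).
      by rewrite mulrA expr2 mulrA mulfV ?mul1r // pnatr_eq0 -lt0n.
    set S := \sum_(n < N) _; transitivity (N%:R^-1 * (S * (M%:R^-1 * expi (node j * l%:~R)))); first by ring.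
    rewrite /S mulr_suml mulr_sumr; apply: eq_bigr => n _.
    rewrite mulr_suml mulr_sumr; apply: eq_bigr => m _.
    have -> : expi (node j * (l - (n%:Z - m%:Z))%:~R) =
        expi (- node j * (n%:Z - m%:Z)%:~R) * expi (node j * l%:~R).
      by rewrite -expiD; congr expi; rewrite !intrB; ring.
    ring.
  rewrite exchange_big mulr_sumr; apply: eq_bigr => n _; rewrite exchange_big mulr_sumr.
  by apply: eq_bigr => m _; rewrite -mulr_sumr -mulr_sumr -mulr_sumr.
rewrite /overlap rmorphM fmorphV !rmorph_nat -mulrA; congr (_ * _).
rewrite natr_sum mulr_suml exchange_big; apply: eq_bigr => n _ /=.
rewrite natr_sum mulr_suml; apply: eq_bigr => m _.
rewrite roots_sum; last by have := ltn_ord n; have := ltn_ord m; rewrite /M; lia.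
rewrite subr_eq0; case: eqP => [->|]; first by rewrite eqxx mulr1 mul1r.
by move=> h; rewrite mulr0 (_ : (_ == _) = false) ?mul0r //; apply/eqP => h'; exact: h.
Qed.

Let kern (s : R) : R := H%:R^-1 ^+ 2 * normc (\sum_(h < H) expi (s * h%:R)) ^+ 2.

Let kern_ge0 s : 0 <= kern s. Proof. by rewrite mulr_ge0 ?sqr_ge0. Qed.

Lemma kernE s : (kern s)%:C = H%:R^-1 ^+ 2 *
  \sum_(h < H) \sum_(h' < H) expi (s * (h%:Z - h'%:Z)%:~R).
Proof.
rewrite /kern rmorphM rmorphXn fmorphV rmorph_nat /= -mulcJ conjc_sum mulr_suml.
congr (_ * _); apply: eq_bigr => h _; rewrite mulr_sumr; apply: eq_bigr => h' _.
by rewrite -expiN -expiD; congr expi; rewrite intrB; ring.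
Qed.

Lemma kern_le1 s : kern s <= 1.
Proof.
rewrite /kern -exprMn exprn_ile1 ?mulr_ge0 ?normc_ge0 // mulrC ler_pdivrMr ?ltr0n // mul1r.
apply: le_trans (normc_sum _ _ _) _.
by under eq_bigr do rewrite normc_expi; rewrite sumr_const card_ord.
Qed.

Lemma kern_far s (eta : R) : 0 < eta -> eta <= normc (expi s - 1) ->
  kern s <= 4 / eta ^+ 2 / H%:R ^+ 2.
Proof.
move=> eta0 es; rewrite /kern mulrC exprVn ler_wpM2r ?invr_ge0 ?sqr_ge0 //.
rewrite ler_pdivlMr ?exprn_gt0 // -exprMn (_ : 4 = 2 ^+ 2); last by rewrite expr2; lra.
rewrite lerXn2r ?nnegrE ?mulr_ge0 ?normc_ge0 ?(ltW eta0) //.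
apply: (@le_trans _ _ (normc (expi s - 1) * normc (\sum_(h < H) expi s ^+ h))).
  rewrite mulrC ler_pM ?normc_ge0 ?(ltW eta0) // le_eqVlt; apply/orP; left; apply/eqP.
  by congr (normc _); apply: eq_bigr => h _; rewrite expiX.
by apply: normc_geom; rewrite normc_expi.
Qed.

(** As for the Fourier transform of a convolution, a character of the sum of the nodes factors over
    the coordinates. *)
Lemma kern_expansion (g : 'I_k -> 'I_M -> R) :
  (\sum_(f : {ffun 'I_k -> 'I_M}) (\prod_i g i (f i)) * kern (t + \sum_i node (f i)))%:C =
  H%:R^-1 ^+ 2 * \sum_(h < H) \sum_(h' < H) expi (t * (h%:Z - h'%:Z)%:~R) *
    \prod_i \sum_(j < M) (g i j)%:C * expi (node j * (h%:Z - h'%:Z)%:~R).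
Proof.
rewrite rmorph_sum /=.
transitivity (\sum_(f : {ffun 'I_k -> 'I_M}) H%:R^-1 ^+ 2 * \sum_(h < H) \sum_(h' < H)
   (expi (t * (h%:Z - h'%:Z)%:~R) * \prod_i ((g i (f i))%:C * expi (node (f i) * (h%:Z - h'%:Z)%:~R)))).
  apply: eq_bigr => f _; rewrite rmorphM /= kernE mulrCA; congr (_ * _).
  rewrite rmorph_prod /= mulr_sumr; apply: eq_bigr => h _.
  rewrite mulr_sumr; apply: eq_bigr => h' _.
  by rewrite big_split /= mulrCA -expi_sum -expiD -mulr_suml -mulrDl.
rewrite -mulr_sumr; congr (_ * _); rewrite exchange_big; apply: eq_bigr => h _ /=.
rewrite exchange_big; apply: eq_bigr => h' _ /=.
by rewrite bigA_distr_bigA /= mulr_sumr.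
Qed.

Let w i (j : 'I_M) : R := M%:R^-1 * (N%:R * sig i N (node j)).

Let w_ge0 i j : 0 <= w i j.
Proof. by rewrite !mulr_ge0 ?invr_ge0. Qed.

(** The total mass is the Fourier coefficient at 0. *)
Lemma sum_w_le i : \sum_(j < M) w i j <= B.
Proof.
have := fourier_sig i (l := 0); rewrite normr0 ltz_nat H0 => /(_ isT) e.
apply: (@le_trans _ _ (normc ((overlap 0)%:C * c i 0))).
  rewrite -e; under [X in normc X]eq_bigr do rewrite mulr0z mulr0 expi0 mulr1.
  by rewrite -(rmorph_sum (real_complex R)) normc_real ler_norm.
rewrite ComplexField.Normc.normcM -[leRHS]mul1r ler_pM ?normc_ge0 //.
by rewrite normc_real ger0_norm ?overlap_le1 // mulr_ge0 ?invr_ge0.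
Qed.

Let prod_le (P : pred 'I_k) (g : 'I_k -> R) : (forall i, 0 <= g i <= B) ->
  \prod_(i | P i) g i <= B ^+ k.
Proof.
move=> gB; rewrite big_mkcond -[X in B ^+ X](card_ord k) -prodr_const.
apply: ler_prod => i _; case: ifP => _; first exact: gB.
by rewrite ler01 B1.
Qed.

(** With uniform weights in coordinate [i], summing over its nodes annihilates the pairs with [h]
    different from [h'] and leaves [H] of the [H ^ 2] terms. The other coordinates have mass at most
    [B]. *)
Lemma near_diagonal_bound i :
  \sum_(f : {ffun 'I_k -> 'I_M}) (\prod_i' (if i' == i then M%:R^-1 else w i' (f i'))) *
    kern (t + \sum_i' node (f i')) <= H%:R^-1 * B ^+ k.
Proof.
have M0 : M%:R != 0 :> R by rewrite pnatr_eq0 /M; lia.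
have := @kern_expansion (fun i' j => if i' == i then M%:R^-1 else w i' j).
set S := \sum_(f : _) _ => /(congr1 (@complex.Re R)) /= ->.
have -> : \sum_(h < H) \sum_(h' < H) expi (t * (h%:Z - h'%:Z)%:~R) *
    \prod_i0 \sum_(j < M) (if i0 == i then M%:R^-1 else w i0 j)%:C * expi (node j * (h%:Z - h'%:Z)%:~R)
  = (\sum_(h < H) \prod_(i' | i' != i) \sum_(j < M) w i' j)%:C.
  rewrite rmorph_sum; apply: eq_bigr => h _.
  rewrite (bigD1 h) //= [X in _ + X]big1 ?addr0; last first.
    move=> h' h'h; rewrite (bigD1 i) //= eqxx -mulr_sumr fmorphV rmorph_nat.
    rewrite roots_sum; last by have := ltn_ord h; have := ltn_ord h'; rewrite /M; lia.
    rewrite subr_eq0 eqz_nat (_ : (_ == _) = false); last by rewrite eq_sym; apply: negbTE.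
    by rewrite mul0r mulr0.
  rewrite subrr mulr0z mulr0 expi0 mul1r [LHS](bigD1 i) //= eqxx.
  under eq_bigr do rewrite mulr0 expi0 mulr1.
  rewrite sumr_const card_ord -[_ *+ M]mulr_natr fmorphV rmorph_nat mulVf ?mul1r; last first.
    by rewrite pnatr_eq0 /M; lia.
  rewrite rmorph_prod; apply: eq_bigr => i' /negbTE -> /=.
  under eq_bigr do rewrite mulr0 expi0 mulr1.
  by rewrite (rmorph_sum (real_complex R)).
rewrite expr2 -mulrA !Re_natVM /= ler_wpM2l ?invr_ge0 // ler_pdivrMl ?ltr0n //.
apply: (@le_trans _ _ (\sum_(h < H) B ^+ k)); last by rewrite sumr_const card_ord [leRHS]mulr_natl.
apply: ler_sum => h _; apply: prod_le => i'.
by rewrite sum_w_le andbT; apply: sumr_ge0.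
Qed.

(** Tuples of nodes whose total phase is [eta]-far from 0 are handled by the decay of [kern]. For
    the others some coordinate has [sig <= e], so its weight is at most [N e] times the uniform one
    and [near_diagonal_bound] applies; summing over [i] covers every choice of that coordinate. *)
Lemma kern_product_bound (eta e : R) : 0 < eta -> 0 <= e ->
  (forall s : 'I_k -> R, (forall i, 0 <= s i <= 2 * pi) ->
     normc (expi (t + \sum_i s i) - 1) < eta -> exists i, sig i N (s i) <= e) ->
  \sum_(f : {ffun 'I_k -> 'I_M}) (\prod_i w i (f i)) * kern (t + \sum_i node (f i)) <=
  B ^+ k * (4 / eta ^+ 2 / H%:R ^+ 2) + k%:R * (N%:R * e * (H%:R^-1 * B ^+ k)).
Proof.
move=> eta0 e0 he.
have M0 : 0 < M%:R :> R by rewrite ltr0n /M; lia.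
have node_itv (j : 'I_M) : 0 <= node j <= 2 * pi.
  have pi0 : 0 <= 2 * pi :> R by apply: mulr_ge0 => //; exact: pi_ge0.
  apply/andP; split; first by apply: mulr_ge0; rewrite // divr_ge0.
  by rewrite -[leRHS]mulr1 ler_wpM2l // ler_pdivrMr // mul1r ler_nat ltnW.
apply: (@le_trans _ _ (\sum_(f : {ffun 'I_k -> 'I_M}) ((\prod_i w i (f i)) * (4 / eta ^+ 2 / H%:R ^+ 2) +
  \sum_i N%:R * e * ((\prod_i' (if i' == i then M%:R^-1 else w i' (f i'))) *
     kern (t + \sum_i' node (f i')))))).
  apply: ler_sum => f _; set s := t + _.
  have W0 : 0 <= \prod_i w i (f i) by apply: prodr_ge0.
  have P0 i : 0 <= \prod_i' (if i' == i then M%:R^-1 else w i' (f i')).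
    by apply: prodr_ge0 => i' _; case: ifP => // _; rewrite invr_ge0 ltW.
  have T0 i : 0 <= N%:R * e * ((\prod_i' (if i' == i then M%:R^-1 else w i' (f i'))) * kern s).
    by apply: mulr_ge0; [exact: mulr_ge0|exact: mulr_ge0 (P0 i) (kern_ge0 s)].
  have [far|near_] := leP eta (normc (expi s - 1)).
    rewrite -[leLHS]addr0 lerD ?sumr_ge0 // ler_wpM2l //; exact: kern_far.
  have [i hi] := he (fun i => node (f i)) (fun i => node_itv (f i)) near_.
  rewrite -[leLHS]add0r lerD //; first by rewrite mulr_ge0 // !divr_ge0 ?sqr_ge0.
  rewrite [leRHS](bigD1 i) //= -[leLHS]addr0 lerD ?sumr_ge0 // [leRHS]mulrA ler_wpM2r //.
  rewrite (bigD1 i) //= [X in _ <= _ * X](bigD1 i) //= eqxx mulrA.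
  have -> : \prod_(i' | i' != i) (if i' == i then M%:R^-1 else w i' (f i')) =
            \prod_(i' | i' != i) w i' (f i').
    by apply: eq_bigr => i' /negbTE ->.
  rewrite ler_wpM2r //; first by apply: prodr_ge0.
  by rewrite /w mulrC ler_wpM2r ?invr_ge0 ?(ltW M0) // ler_wpM2l.
rewrite big_split /= -mulr_suml lerD //.
  rewrite ler_wpM2r ?divr_ge0 ?sqr_ge0 // -bigA_distr_bigA.
  by apply: prod_le => i; rewrite sum_w_le andbT sumr_ge0.
rewrite exchange_big /=.
apply: (@le_trans _ _ (\sum_(i < k) N%:R * e * (H%:R^-1 * B ^+ k))); last first.
  by rewrite sumr_const card_ord [leRHS]mulr_natl.
apply: ler_sum => i _; rewrite -mulr_sumr ler_wpM2l ?mulr_ge0 //.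
exact: near_diagonal_bound.
Qed.

Lemma bernoulli_ge (r : R) m : 0 <= r <= 1 -> 1 - r ^+ m <= m%:R * (1 - r).
Proof.
move=> /andP[r0 r1]; elim: m => [|m IHm]; first by rewrite expr0 subrr mul0r.
have : r ^+ m <= 1 by exact: exprn_ile1.
have : 0 <= r ^+ m by exact: exprn_ge0.
by rewrite exprS -natr1 mulrDl mul1r; nra.
Qed.

(** The discrete measures have coefficients [overlap l * c i l] instead of [c i l]. For [|l| < H]
    this loses at most [2 H / N] per factor, which accounts for the last summand. *)
Lemma product_mean_bound (eta e : R) : 0 < eta -> 0 <= e ->
  (forall s : 'I_k -> R, (forall i, 0 <= s i <= 2 * pi) ->
     normc (expi (t + \sum_i s i) - 1) < eta -> exists i, sig i N (s i) <= e) ->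
  complex.Re (H%:R^-1 ^+ 2 * \sum_(h < H) \sum_(h' < H)
     expi (t * (h%:Z - h'%:Z)%:~R) * \prod_i c i (h%:Z - h'%:Z)) <=
  B ^+ k * (4 / eta ^+ 2 / H%:R ^+ 2) + k%:R * (N%:R * e * (H%:R^-1 * B ^+ k))
  + k%:R * (2 * H%:R / N%:R) * B ^+ k.
Proof.
move=> eta0 e0 he; have := kern_product_bound eta0 e0 he.
have := kern_expansion w; set S := \sum_(f : _) _ => SE hS.
have lH (h h' : 'I_H) : (`|h%:Z - h'%:Z| < H%:Z)%R by have := ltn_ord h; have := ltn_ord h'; lia.
have ov l : 0 <= overlap l by rewrite mulr_ge0 ?invr_ge0.
have {}SE : S%:C = H%:R^-1 ^+ 2 * \sum_(h < H) \sum_(h' < H) expi (t * (h%:Z - h'%:Z)%:~R) *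
    ((overlap (h%:Z - h'%:Z) ^+ k)%:C * \prod_i c i (h%:Z - h'%:Z)).
  rewrite SE; congr (_ * _); apply: eq_bigr => h _; apply: eq_bigr => h' _; congr (_ * _).
  rewrite (eq_bigr _ (fun i _ => fourier_sig i (lH h h'))) big_split /=; congr (_ * _).
  by rewrite prodr_const card_ord rmorphXn.
set Q := H%:R^-1 ^+ 2 * _.
have -> : complex.Re Q = S + complex.Re (Q - S%:C) by case: Q => ? ? /=; ring.
rewrite lerD //; apply: le_trans (ler_Re _) _.
rewrite SE -mulrBr -sumrB ComplexField.Normc.normcM normcX normc_natV.
have H0' : 0 < H%:R :> R by rewrite ltr0n.
rewrite expr2 -mulrA ler_pdivrMl // ler_pdivrMl //.
apply: le_trans (normc_sum _ _ _) _.
apply: (@le_trans _ _ (\sum_(h < H) H%:R * (k%:R * (2 * H%:R / N%:R) * B ^+ k))); last first.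
  by rewrite sumr_const card_ord [leRHS]mulr_natl.
apply: ler_sum => h _; rewrite -sumrB; apply: le_trans (normc_sum _ _ _) _.
apply: (@le_trans _ _ (\sum_(h' < H) (k%:R * (2 * H%:R / N%:R) * B ^+ k))); last first.
  by rewrite sumr_const card_ord [leRHS]mulr_natl.
apply: ler_sum => h' _; rewrite -mulrBr ComplexField.Normc.normcM normc_expi mul1r.
rewrite -{1}[\prod_i _]mul1r -mulrBl ComplexField.Normc.normcM.
apply: ler_pM; rewrite ?normc_ge0 //; last first.
  by rewrite normc_prod; apply: prod_le => i; rewrite normc_ge0 cB.
rewrite -(rmorph1 (real_complex R)) -rmorphB normc_real ger0_norm; last first.
  by rewrite subr_ge0 exprn_ile1 // overlap_le1.
apply: le_trans (bernoulli_ge _ _) _; first by rewrite ov overlap_le1.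
by rewrite ler_wpM2l // lerBlDr -lerBlDl overlap_ge.
Qed.

End Roots_of_unity.

(** Take [N = 2 ^ p * H]. First [p] makes [H / N] small, then [d] absorbs the factor [N / H], now
    fixed, and finally [H = 2 ^ q] is taken large in terms of the [eta] and [J0] that
    [sig_small_uniform] returns for [d]. *)
Lemma product_mean_small e : 0 < e -> exists2 H, (0 < H)%N &
  complex.Re (H%:R^-1 ^+ 2 * \sum_(h < H) \sum_(h' < H)
     expi (t * (h%:Z - h'%:Z)%:~R) * \prod_i c i (h%:Z - h'%:Z)) <= e.
Proof.
move=> e0; have Bk0 : 0 < B ^+ k by rewrite exprn_gt0 // (lt_le_trans ltr01).
have e3 : 0 < e / 3 by rewrite divr_gt0.
have k1 : 0 < k%:R + 1 :> R by rewrite ltr_wpDl.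
have pow_ge n : n%:R <= (2 ^ n)%:R :> R by rewrite ler_nat ltnW // ltn_expl.
pose p := (Num.truncn (2 * (k%:R + 1) * B ^+ k / (e / 3))).+1.
have hp : 2 * (k%:R + 1) * B ^+ k <= e / 3 * (2 ^ p)%:R.
  rewrite [leRHS]mulrC -ler_pdivrMr // (le_trans _ (pow_ge _)) //.
  exact/ltW/Num.Theory.truncnS_gt.
pose d := e / 3 / ((k%:R + 1) * (2 ^ p)%:R * B ^+ k).
have d0 : 0 < d by rewrite divr_gt0 // !mulr_gt0 // ltr0n expn_gt0.
have [eta eta0 [J0 hJ]] := sig_small_uniform d0.
pose q := (J0 + (Num.truncn (B ^+ k * (4 / eta ^+ 2) / (e / 3))).+1)%N.
have hq : B ^+ k * (4 / eta ^+ 2) <= e / 3 * (2 ^ q)%:R.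
  rewrite [leRHS]mulrC -ler_pdivrMr // (le_trans _ (pow_ge _)) //.
  rewrite (@le_trans _ _ (Num.truncn (B ^+ k * (4 / eta ^+ 2) / (e / 3))).+1%:R) //.
    exact/ltW/Num.Theory.truncnS_gt.
  by rewrite ler_nat leq_addl.
exists (2 ^ q)%N; first by rewrite expn_gt0.
have HN : (2 ^ q <= 2 ^ (p + q))%N by rewrite leq_exp2l // leq_addl.
have q0 : (0 < 2 ^ q)%N by rewrite expn_gt0.
apply: le_trans (product_mean_bound q0 HN eta0 (ltW d0) _) _.
  move=> s sp st; have [i hi] := hJ s sp st; exists i; apply: hi.
  by rewrite /q; lia.
have Q0 : 0 < (2 ^ q)%:R :> R by rewrite ltr0n.
have Q1 : 1 <= (2 ^ q)%:R :> R by rewrite (ler_nat _ 1).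
have P0 : 0 < (2 ^ p)%:R :> R by rewrite ltr0n expn_gt0.
rewrite expnD natrM; move: hp hq d0; rewrite /d.
set P := (2 ^ p)%:R; set Q := (2 ^ q)%:R; set b := B ^+ k => hp hq d0.
rewrite [leRHS](_ : e = e / 3 + e / 3 + e / 3); last by field.
rewrite !lerD //.
- rewrite mulrA ler_pdivrMr ?exprn_gt0 //; apply: le_trans hq _.
  by rewrite ler_wpM2l ?(ltW e3) // expr2 ler_peMl // ltW.
- rewrite [leLHS](_ : _ = k%:R / (k%:R + 1) * (e / 3)); last first.
    by field; rewrite !gt_eqF.
  by rewrite ler_piMl ?(ltW e3) // ler_pdivrMr // mul1r lerDl.
- rewrite [leLHS](_ : _ = 2 * k%:R * b / P); last by field; rewrite !gt_eqF.
  rewrite ler_pdivrMr //; apply: le_trans hp.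
  by rewrite ler_wpM2r ?(ltW Bk0) // ler_pM2l // lerDl.
Qed.

End Positive_definite_product.

(** * Mean ergodic theorem for stationary sequences *)

Section Stationary.
Context {R : realType} {V : lmodType R[i]} (ip : sesquilinear_psd V).
Implicit Types (x y : nat -> V).

Definition stationary y : Prop := forall n m, ip (y n.+1) (y m.+1) = ip (y n) (y m).

Lemma stationary_shift y b n m : stationary y -> ip (y (n + b)%N) (y (m + b)%N) = ip (y n) (y m).
Proof. by move=> sy; elim: b => [|b IHb]; rewrite ?addn0 // !addnS sy. Qed.

Lemma stationary_nrm2 y n : stationary y -> nrm2 ip (y n) = nrm2 ip (y 0%N).
Proof. by move=> sy; rewrite /nrm2 -[in LHS](add0n n) stationary_shift. Qed.

Lemma form_comb_shift y b (I : Type) (r : seq I) (d : I -> R[i]) (h : I -> nat) : stationary y ->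
  nrm2 ip (\sum_(i <- r) d i *: y (h i + b)%N) = nrm2 ip (\sum_(i <- r) d i *: y (h i)).
Proof.
move=> sy; rewrite /nrm2 !form_suml; congr complex.Re; apply: eq_bigr => i _.
rewrite !form_sumr; apply: eq_bigr => j _.
by rewrite !formZl !formZr stationary_shift.
Qed.

Lemma nrm2_vavg_stationary y b N : stationary y ->
  nrm2 ip (vavg (fun n => y (n + b)%N) N) = nrm2 ip (vavg y N).
Proof.
move=> sy; rewrite /vavg !nrm2Z; congr (_ * _).
have := @form_comb_shift y b nat (index_iota 1 N.+1) (fun=> 1) id sy.
by under eq_bigr do rewrite scale1r; under [in RHS]eq_bigr do rewrite scale1r.
Qed.

Lemma vavg_double y N : vavg y (2 * N) =
  2^-1 *: (vavg y N + vavg (fun n => y (n + N)%N) N).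
Proof.
rewrite /vavg -scalerDr scalerA natrM invfM; congr (_ *: _).
rewrite (@big_cat_nat _ _ _ N.+1) //=; last by lia.
congr (_ + _); rewrite -(add1n N) big_addn; congr bigop; congr index_iota; lia.
Qed.

Lemma nrm2_vavg_double y N : stationary y -> nrm2 ip (vavg y (2 * N)) <= nrm2 ip (vavg y N).
Proof.
move=> sy; rewrite vavg_double nrm2Z.
have -> : normc (2^-1 : R[i]) = 2^-1 by exact: normc_natV.
have := nrm2D_le ip (vavg y N) (vavg (fun n => y (n + N)%N) N).
rewrite nrm2_vavg_stationary // => h.
by rewrite expr2; lra.
Qed.

(** The factor of the first term can be brought close to 1, which a sharp lower bound requires and
    [nrm2D_le] does not give. *)
Lemma nrm2D_weighted (u v : V) (e : R) : 0 < e ->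
  nrm2 ip (u + v) <= (1 + e) * nrm2 ip u + (1 + e^-1) * nrm2 ip v.
Proof.
move=> e0; have e1 : e * e^-1 = 1 by rewrite mulfV // gt_eqF.
have := nrm2_ge0 ip (e%:C *: u - v); rewrite nrm2D nrm2B nrm2Z normc_real formZl ReM_real.
rewrite (gtr0_norm e0) => h.
have := mulr_ge0 (ltW (_ : 0 < e^-1)) h; rewrite invr_gt0 => /(_ e0).
rewrite mulrBr mulrDr expr2 !mulrA (mulrC e^-1) mulfV ?gt_eqF // mul1r.
rewrite -[_ * 2 * e * _]mulrA (mulrC e^-1 2) -!mulrA (mulrA e^-1) mulVf ?gt_eqF // mul1r; lra.
Qed.

(* Averaging the shifts of an affine combination of the [y n] does not increase its
   norm and brings it close to a long average of [y]. *)
Lemma stationary_lower_bound y (m : R) (I : eqType) (r : seq I) (d : I -> R[i]) (h : I -> nat) :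
  stationary y -> (forall L, (0 < L)%N -> exists2 L', (L <= L')%N & m <= nrm2 ip (vavg y L')) ->
  \sum_(i <- r) d i = 1 -> m <= nrm2 ip (\sum_(i <- r) d i *: y (h i)).
Proof.
move=> sy hm d1; set v := \sum_(i <- r) _; pose B := nrm2 ip (y 0%N).
have yB n : nrm2 ip (y n) <= B by rewrite stationary_nrm2.
pose w b := \sum_(i <- r) d i *: y (h i + b)%N.
pose D : R := (size r)%:R * \sum_(i <- r) normc (d i) ^+ 2 * (4 * (h i)%:R ^+ 2 * B).
have close L : nrm2 ip (vavg y L - vavg w L) <= D / L%:R ^+ 2.
  have -> : vavg y L - vavg w L = \sum_(i <- r) d i *: (vavg y L - vavg (fun n => y (n + h i)%N) L).
    under eq_bigr do rewrite scalerBr.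
    rewrite sumrB -scaler_suml d1 scale1r; congr (_ - _).
    rewrite /vavg /w exchange_big scaler_sumr; apply: eq_bigr => i _.
    rewrite scalerA mulrC -scalerA -scaler_sumr; congr (_ *: (_ *: _)).
    by apply: eq_bigr => n _; rewrite addnC.
  apply: le_trans (nrm2_sum_le _ _ _) _; rewrite /D -[leRHS]mulrA ler_wpM2l // mulr_suml.
  apply: ler_sum => i _; rewrite nrm2Z -[leRHS]mulrA ler_wpM2l ?sqr_ge0 //.
  exact: nrm2_vavg_shift.
have wle L : nrm2 ip (vavg w L) <= nrm2 ip v.
  apply: le_trans (nrm2_vavg _ _ _) _; apply: (@le_trans _ _ (favg (fun=> nrm2 ip v) L)).
    by apply: ler_favg => n _; rewrite /w form_comb_shift.
  by apply: favg_cst; exact: nrm2_ge0.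
apply/ler_addgt0Pr => e e0; set nu := nrm2 ip v.
have nu1 : 0 < nu + 1 by rewrite ltr_wpDl // nrm2_ge0.
pose e2 := e / 2 / (nu + 1); have e20 : 0 < e2 by rewrite !divr_gt0.
have vD : vanish (fun L => (1 + e2^-1) * (D * (L%:R^-1) ^+ 2)).
  apply: vanishZ; first by rewrite addr_ge0 // invr_ge0 ltW.
  apply: vanishZ.
    rewrite mulr_ge0 //; apply: sumr_ge0 => i _.
    by rewrite /B !mulr_ge0 ?normc_ge0 ?nrm2_ge0.
  apply: vanish_sqr => [N|]; first by rewrite invr_ge0.
  by apply: (vanish_le (vanish_invn 1)) => N; rewrite mul1r.
have [L0 _ hL0] := vD (e / 2) (divr_gt0 e0 (ltr0n _ 2)).
have [L /ltnW LL mL] := hm L0.+1 isT.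
apply: le_trans mL _.
rewrite (_ : vavg y L = vavg w L + (vavg y L - vavg w L)); last by rewrite addrC subrK.
apply: le_trans (nrm2D_weighted _ _ e20) _.
have hD := hL0 L LL; rewrite exprVn in hD.
have h1 : (1 + e2) * nrm2 ip (vavg w L) <= nu + e / 2.
  apply: (@le_trans _ _ ((1 + e2) * nu)); first by rewrite ler_wpM2l ?wle // addr_ge0 // ltW.
  rewrite mulrDl mul1r lerD2l /e2 mulrAC ler_pdivrMr //.
  by rewrite ler_pM2l ?divr_gt0 // lerDl.
have h2 : (1 + e2^-1) * nrm2 ip (vavg y L - vavg w L) <= e / 2.
  apply: le_trans hD; rewrite ler_wpM2l ?close //.
  by rewrite addr_ge0 // invr_ge0 ltW.
by rewrite [X in _ <= nu + X](splitr e) addrA lerD.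
Qed.

(** The squared norms of the dyadic averages decrease to their infimum [m]. By
    [stationary_lower_bound] the midpoint of two averages still has squared norm at least [m], and
    the parallelogram law makes them close. *)
Lemma stationary_cauchy y : stationary y -> forall e, 0 < e -> exists J0, forall J K,
  (J0 <= J)%N -> (J0 <= K)%N ->
  nrm2 ip (vavg y (2 ^ J) - vavg y (2 ^ K)) <= e.
Proof.
move=> sy e e0; pose a J := nrm2 ip (vavg y (2 ^ J)).
have a_mono J K : (J <= K)%N -> a K <= a J.
  move=> /subnKC <-; elim: (K - J)%N => [|n IHn]; first by rewrite addn0.
  by apply: le_trans IHn; rewrite /a addnS expnS; exact: nrm2_vavg_double.
pose m := inf (range a).
have lba : has_inf (range a).
  by split; [exists (a 0%N); exists 0%N|exists 0 => _ [n _ <-]; exact: nrm2_ge0].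
have ma J : m <= a J by apply: ge_inf; [case: lba|exists J].
have lower J K : m <= nrm2 ip (2^-1 *: (vavg y (2 ^ J) + vavg y (2 ^ K))).
  (* The midpoint as one affine combination of the [y n]; the Boolean tells which average a term
     comes from. *)
  pose d (q : bool * nat) : R[i] := 2^-1 * (2 ^ (if q.1 then J else K))%:R^-1.
  pose r := [seq (true, n) | n <- index_iota 1 (2 ^ J).+1] ++
            [seq (false, n) | n <- index_iota 1 (2 ^ K).+1].
  have := @stationary_lower_bound y m _ r d snd sy.
  rewrite /r !big_cat !big_map /=.
  rewrite /d /= -!mulr_suml -!scaler_sumr -!scalerA -scalerDr; apply.
    move=> L L0; exists (2 ^ L)%N; last exact: ma.
    by rewrite ltnW // ltn_expl.
  rewrite !big_const_nat !subn1 /= !iter_addr_0.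
  have h P : (2^-1 *+ (2 ^ P)) * (2 ^ P)%:R^-1 = 2^-1 :> R[i].
    by rewrite -[2^-1 *+ _]mulr_natr mulfK // pnatr_eq0 -lt0n expn_gt0.
  by rewrite !h [RHS]splitr mul1r.
have [_ [J0 _ <-] hJ0] := inf_adherent (divr_gt0 e0 (ltr0n _ 4)) lba.
exists J0 => J K JJ KK.
have := parallelogram ip (vavg y (2 ^ J)) (vavg y (2 ^ K)).
have := lower J K; rewrite nrm2Z (_ : normc (2^-1 : R[i]) = 2^-1); last exact: normc_natV.
have := a_mono _ _ JJ; have := a_mono _ _ KK; rewrite -/(a J) -/(a K) exprVn -/m in hJ0 *.
move=> h1 h2 h3; rewrite /a in h1 h2 hJ0 *; lra.
Qed.

End Stationary.

(** * The module of bounded measurable functions *)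

Section Bounded_measurable.
Context {d : measure_display} {X : measurableType d} {R : realType}.
Implicit Types f g : X -> R[i].

Definition bmeas f : Prop := cmeasurable f /\ exists B : R, forall x, normc (f x) <= B.

Lemma cmeasurable_add f g : cmeasurable f -> cmeasurable g -> cmeasurable (fun x => f x + g x).
Proof.
move=> [rf jf] [rg jg]; split.
  apply: (eq_measurable_fun (fun x => complex.Re (f x) + complex.Re (g x))).
    by move=> x _; case: (f x); case: (g x).
  exact: measurable_funD.
apply: (eq_measurable_fun (fun x => complex.Im (f x) + complex.Im (g x))).
  by move=> x _; case: (f x); case: (g x).
exact: measurable_funD.
Qed.

Lemma cmeasurable_mul f g : cmeasurable f -> cmeasurable g -> cmeasurable (fun x => f x * g x).
Proof.
move=> [rf jf] [rg jg]; split.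
  apply: (eq_measurable_fun (fun x => complex.Re (f x) * complex.Re (g x) -
     complex.Im (f x) * complex.Im (g x))).
    by move=> x _; case: (f x); case: (g x).
  by apply: measurable_funB; exact: measurable_funM.
apply: (eq_measurable_fun (fun x => complex.Re (f x) * complex.Im (g x) +
     complex.Im (f x) * complex.Re (g x))).
  by move=> x _; case: (f x); case: (g x).
by apply: measurable_funD; exact: measurable_funM.
Qed.

Lemma cmeasurable_cst (c : R[i]) : @cmeasurable d X R (fun=> c).
Proof. by split; exact: measurable_cst. Qed.

Lemma cmeasurable_comp f (T : X -> X) : measurable_fun setT T -> cmeasurable f ->
  cmeasurable (fun x => f (T x)).
Proof. by move=> mT [rf jf]; split; [exact: (measurableT_comp rf)|exact: (measurableT_comp jf)]. Qed.

Lemma cmeasurable_sum (I : Type) (r : seq I) (F : I -> X -> R[i]) :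
  (forall i, cmeasurable (F i)) -> cmeasurable (fun x => \sum_(i <- r) F i x).
Proof.
move=> mF; elim: r => [|i r IHr].
  by have -> : (fun x => \sum_(i <- [::]) F i x) = fun=> 0 by apply/funext => x; rewrite big_nil.
have -> : (fun x => \sum_(j <- i :: r) F j x) = fun x => F i x + \sum_(j <- r) F j x.
  by apply/funext => x; rewrite big_cons.
exact: cmeasurable_add.
Qed.

Lemma cmeasurable_prod (I : Type) (r : seq I) (F : I -> X -> R[i]) :
  (forall i, cmeasurable (F i)) -> cmeasurable (fun x => \prod_(i <- r) F i x).
Proof.
move=> mF; elim: r => [|i r IHr].
  by have -> : (fun x => \prod_(i <- [::]) F i x) = fun=> 1 by apply/funext => x; rewrite big_nil.
have -> : (fun x => \prod_(j <- i :: r) F j x) = fun x => F i x * \prod_(j <- r) F j x.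
  by apply/funext => x; rewrite big_cons.
exact: cmeasurable_mul.
Qed.

Lemma bmeas_add f g : bmeas f -> bmeas g -> bmeas (fun x => f x + g x).
Proof.
move=> [mf [B fB]] [mg [C gC]]; split; first exact: cmeasurable_add.
by exists (B + C) => x; apply: le_trans (le_normcD _ _) _; exact: lerD.
Qed.

Lemma bmeas_mul f g : bmeas f -> bmeas g -> bmeas (fun x => f x * g x).
Proof.
move=> [mf [B fB]] [mg [C gC]]; split; first exact: cmeasurable_mul.
exists (B * C) => x; rewrite ComplexField.Normc.normcM.
by apply: ler_pM; rewrite ?normc_ge0.
Qed.

Lemma bmeas_cst (c : R[i]) : bmeas (fun=> c).
Proof. by split; [exact: cmeasurable_cst|exists (normc c)]. Qed.

Lemma bmeas_conj f : bmeas f -> bmeas (fun x => conjc (f x)).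
Proof.
move=> [[rf jf] [B fB]]; split; last by exists B => x; rewrite normc_conj.
split.
  by apply: (eq_measurable_fun _ _ rf) => x _; case: (f x).
apply: (eq_measurable_fun (fun x => 0 - complex.Im (f x))).
  by move=> x _; case: (f x) => ? ? /=; rewrite sub0r.
exact: measurable_funB.
Qed.

Lemma bmeas_comp f (T : X -> X) : measurable_fun setT T -> bmeas f -> bmeas (fun x => f (T x)).
Proof.
by move=> mT [mf [B fB]]; split; [exact: cmeasurable_comp|exists B].
Qed.

Definition bmeas_pred : {pred X -> R[i]} := fun f => `[< bmeas f >].

Lemma bmeas_submod_closed : submod_closed bmeas_pred.
Proof.
split; first by apply/asboolP; exact: bmeas_cst.
move=> c f g /asboolP bf /asboolP bg; apply/asboolP.
by apply: bmeas_add => //; apply: (@bmeas_mul (fun=> c)) => //; exact: bmeas_cst.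
Qed.

HB.instance Definition _ := GRing.isSubmodClosed.Build R[i] (X -> R[i]) bmeas_pred bmeas_submod_closed.

(** Functions bounded everywhere rather than classes modulo null sets: products and compositions
    stay in the type, and values at points make sense. *)
Record bfun := BFun { bval :> X -> R[i]; bvalP : bval \in bmeas_pred }.

HB.instance Definition _ := [isSub for bval].
HB.instance Definition _ := [Choice of bfun by <:].
HB.instance Definition _ := [SubChoice_isSubLmodule of bfun by <:].

Definition mkbfun f (bf : bmeas f) : bfun := BFun (asboolT bf).

Lemma bfunP (f : bfun) : bmeas f.
Proof. by apply/asboolP; exact: bvalP. Qed.

Lemma bfunD (f g : bfun) x : (f + g) x = f x + g x. Proof. by []. Qed.
Lemma bfunZ c (f : bfun) x : (c *: f) x = c * f x. Proof. by []. Qed.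
Lemma bfunB (f g : bfun) x : (f - g) x = f x - g x. Proof. by []. Qed.
Lemma bfun_sum (I : Type) (r : seq I) (P : pred I) (F : I -> bfun) x :
  (\sum_(i <- r | P i) F i) x = \sum_(i <- r | P i) F i x.
Proof. by elim/big_rec2: _ => // i u v _ <-. Qed.

End Bounded_measurable.
Arguments bfun {d} X R.

(** * Complex integrals and the quadratic seminorm *)

Section Integration.
Context {d : measure_display} {X : measurableType d} {R : realType} (mu : probability X R).
Implicit Types f g : bfun X R.

Let mu1 : (mu : {measure set X -> \bar R}) setT = 1%E.
Proof. exact: probability_setT. Qed.

Lemma bounded_measurable_integrable (h : X -> R) (B : R) : measurable_fun setT h ->
  (forall x, `|h x| <= B) -> mu.-integrable setT (EFin \o h).
Proof.
move=> mh hB; apply: measurable_bounded_integrable => //.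
  by rewrite (le_lt_trans (probability_le1 mu _)) ?ltry.
by exists B; split; rewrite ?num_real // => y yB x _; apply: le_trans (hB x) (ltW yB).
Qed.

Lemma normc_ReIm (z : R[i]) : `|complex.Re z| <= normc z /\ `|complex.Im z| <= normc z.
Proof.
by case: z => a b; rewrite /ComplexField.Normc.normc; split; rewrite -sqrtr_sqr ler_wsqrtr // ?lerDl ?lerDr sqr_ge0.
Qed.

Lemma integrable_Re f : mu.-integrable setT (EFin \o (fun x => complex.Re (f x))).
Proof.
have [[mr _] [B fB]] := bfunP f; apply: (bounded_measurable_integrable mr (B := B)) => x.
by apply: le_trans (fB x); case: (normc_ReIm (f x)).
Qed.

Lemma integrable_Im f : mu.-integrable setT (EFin \o (fun x => complex.Im (f x))).
Proof.
have [[_ mi] [B fB]] := bfunP f; apply: (bounded_measurable_integrable mi (B := B)) => x.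
by apply: le_trans (fB x); case: (normc_ReIm (f x)).
Qed.

Lemma eq_cintegral (u v : X -> R[i]) : u =1 v -> cintegral mu u = cintegral mu v.
Proof. by move=> /funext ->. Qed.

Lemma cintegralD f g : cintegral mu (fun x => f x + g x) = cintegral mu f + cintegral mu g.
Proof.
rewrite /cintegral; congr (_ +i* _).
  rewrite -RintegralD //; [|exact: integrable_Re|exact: integrable_Re].
  by apply: eq_Rintegral => x _; case: (f x); case: (g x).
rewrite -RintegralD //; [|exact: integrable_Im|exact: integrable_Im].
by apply: eq_Rintegral => x _; case: (f x); case: (g x).
Qed.

Lemma cintegralZ (c : R[i]) f : cintegral mu (fun x => c * f x) = c * cintegral mu f.
Proof.
case: c => a b; rewrite /cintegral /=; apply/eqP; rewrite eq_complex /=; apply/andP; split; apply/eqP.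
  rewrite -!RintegralZl //; [|exact: integrable_Im|exact: integrable_Re].
  rewrite -RintegralB //; [|exact: integrableZl (integrable_Re f)|exact: integrableZl (integrable_Im f)].
  by apply: eq_Rintegral => x _; case: (f x).
rewrite -!RintegralZl //; [|exact: integrable_Re|exact: integrable_Im].
rewrite -RintegralD //; [|exact: integrableZl (integrable_Im f)|exact: integrableZl (integrable_Re f)].
by apply: eq_Rintegral => x _; case: (f x) => ? ? /=; rewrite addrC.
Qed.

Lemma cintegral_conj f : cintegral mu (fun x => conjc (f x)) = conjc (cintegral mu f).
Proof.
rewrite /cintegral /=; congr (_ +i* _); first by apply: eq_Rintegral => x _; case: (f x).
rewrite -mulN1r -RintegralZl //; last exact: integrable_Im.
by apply: eq_Rintegral => x _; case: (f x) => ? ? /=; rewrite mulN1r.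
Qed.

Lemma cintegral_cst (c : R[i]) : cintegral mu (fun=> c) = c.
Proof.
case: c => a b; rewrite /cintegral /= !Rintegral_cst // mu1.
by rewrite /= !mulr1.
Qed.

Lemma ae_eq_cintegral (u v : X -> R[i]) : cmeasurable u -> cmeasurable v ->
  (\forall x \ae mu, u x = v x) -> cintegral mu u = cintegral mu v.
Proof.
move=> [ru iu] [rv iv] uv; rewrite /cintegral /Rintegral; congr (fine _ +i* fine _).
  by apply: ae_eq_integral; try exact/measurable_EFinP; rewrite //; apply: filterS uv => x + _ => /= ->.
by apply: ae_eq_integral; try exact/measurable_EFinP; rewrite //; apply: filterS uv => x + _ => /= ->.
Qed.

Lemma cintegral_ae_eq f g : (\forall x \ae mu, f x = g x) -> cintegral mu f = cintegral mu g.
Proof. by apply: ae_eq_cintegral; [case: (bfunP f)|case: (bfunP g)]. Qed.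

Definition bmul f g : bfun X R := mkbfun (bmeas_mul (bfunP f) (bfunP g)).
Definition bconj f : bfun X R := mkbfun (bmeas_conj (bfunP f)).
Definition bcst (c : R[i]) : bfun X R := mkbfun (@bmeas_cst d X R c).

Definition inner f g : R[i] := cintegral mu (bmul f (bconj g)).

Lemma innerDl f g h : inner (f + g) h = inner f h + inner g h.
Proof. by rewrite /inner -cintegralD; apply: eq_cintegral => x /=; rewrite mulrDl. Qed.

Lemma innerZl c f g : inner (c *: f) g = c * inner f g.
Proof. by rewrite /inner -cintegralZ; apply: eq_cintegral => x /=; rewrite mulrA. Qed.

Lemma innerJ f g : inner g f = conjc (inner f g).
Proof.
rewrite /inner -cintegral_conj; apply: eq_cintegral => x /=.
by rewrite conjcM conjcK mulrC.
Qed.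

Lemma inner_self f : complex.Re (inner f f) = \int[mu]_x (normc (f x) ^+ 2).
Proof. by rewrite /inner /cintegral /=; apply: eq_Rintegral => x _; rewrite mulcJ. Qed.

Lemma inner_ge0 f : 0 <= complex.Re (inner f f).
Proof. by rewrite inner_self; apply: Rintegral_ge0 => x _; exact: sqr_ge0. Qed.

Definition L2 : sesquilinear_psd (bfun X R) := SesquilinearPsd innerDl innerZl innerJ inner_ge0.

Lemma measurable_normc (f : X -> R[i]) : cmeasurable f -> measurable_fun setT (fun x => normc (f x)).
Proof.
move=> [mr mi]; apply: (eq_measurable_fun (fun x => Num.sqrt (complex.Re (f x) ^+ 2 + complex.Im (f x) ^+ 2))).
  by move=> x _; case: (f x).
have ms : measurable_fun setT (@Num.sqrt R) by exact: continuous_measurable_fun (@sqrt_continuous R).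
apply: (measurableT_comp ms).
by apply: measurable_realfun.measurable_funD; exact: measurable_funX.
Qed.

Lemma integrable_sqr_normc f : mu.-integrable setT (EFin \o (fun x => normc (f x) ^+ 2)).
Proof.
have [mf [B fB]] := bfunP f; apply: (bounded_measurable_integrable (B := B ^+ 2)).
  by apply: measurable_funX; exact: measurable_normc.
move=> x; rewrite ger0_norm ?sqr_ge0 // lerXn2r ?nnegrE ?normc_ge0 //.
by apply: le_trans (fB x); exact: normc_ge0.
Qed.

Lemma nrm2_integral f : (\int[mu]_x (normc (f x) ^+ 2)%:E = (nrm2 L2 f)%:E)%E.
Proof.
rewrite /nrm2 [L2 f f]/(inner f f) inner_self /Rintegral fineK //.
exact: integrable_fin_num (integrable_sqr_normc f).
Qed.

Lemma nrm2_le f (B : R) : (forall x, normc (f x) <= B) -> nrm2 L2 f <= B ^+ 2.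
Proof.
move=> fB; rewrite -lee_fin -nrm2_integral.
apply: (@le_trans _ _ (\int[mu]_x (cst (B ^+ 2)%:E x))%E).
  apply: ge0_le_integral => //.
  - by move=> x _; rewrite lee_fin sqr_ge0.
  - exact: (measurable_int mu (integrable_sqr_normc f)).
  - move=> x _; rewrite lee_fin lerXn2r ?nnegrE ?normc_ge0 //.
    by apply: le_trans (fB x); exact: normc_ge0.
by rewrite integral_cst // mu1 mule1.
Qed.

Lemma nrm2_eq0 f : nrm2 L2 f = 0 -> \forall x \ae mu, f x = 0.
Proof.
move=> f0; have := nrm2_integral f; rewrite f0 => h.
have : (\int[mu]_x `|(normc (f x) ^+ 2)%:E| = 0)%E.
  by apply: (etrans _ h); apply: eq_integral => x _; rewrite gee0_abs // lee_fin sqr_ge0.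
move/(ae_eq_integral_abs mu measurableT (measurable_int mu (integrable_sqr_normc f))).
apply: filterS => x /(_ I) /= [] /eqP; rewrite sqrf_eq0 normc_eq0 => /eqP //.
Qed.

Lemma nrm2_ae_eq f g : (\forall x \ae mu, f x = g x) -> nrm2 L2 f = nrm2 L2 g.
Proof.
move=> fg; congr complex.Re; apply: (cintegral_ae_eq (f := bmul f (bconj f)) (g := bmul g (bconj g))).
by apply: filterS fg => x /= ->.
Qed.

Lemma nrm2_bmul_le f g (B : R) : (forall x, normc (f x) <= B) ->
  nrm2 L2 (bmul f g) <= B ^+ 2 * nrm2 L2 g.
Proof.
move=> fB; rewrite -lee_fin EFinM -!nrm2_integral -ge0_integralZl //; last first.
- by rewrite lee_fin sqr_ge0.
- by move=> x _; rewrite lee_fin sqr_ge0.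
- exact: (measurable_int mu (integrable_sqr_normc g)).
apply: ge0_le_integral => //.
- by move=> x _; rewrite lee_fin sqr_ge0.
- exact: (measurable_int mu (integrable_sqr_normc (bmul f g))).
- apply: measurable_funeM; exact: (measurable_int mu (integrable_sqr_normc g)).
move=> x _; rewrite -EFinM lee_fin /= ComplexField.Normc.normcM exprMn ler_wpM2r ?sqr_ge0 //.
rewrite lerXn2r ?nnegrE ?normc_ge0 //.
by apply: le_trans (fB x); exact: normc_ge0.
Qed.

Lemma Lnormc_2 f : Lnormc mu 2%:E f = (Num.sqrt (nrm2 L2 f))%:E.
Proof.
rewrite /Lnormc unlock /Lnorm.
have -> : (\int[mu]_x (`| (normc (f x))%:E | `^ 2%R) = (nrm2 L2 f)%:E)%E.
  rewrite -nrm2_integral; apply: eq_integral => x _.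
  by rewrite abse_EFin poweR_EFin ger0_norm ?normc_ge0 // powR_mulrn ?normc_ge0.
by rewrite poweR_EFin powR12_sqrt // nrm2_ge0.
Qed.

Lemma Lnormc_ae_eq p (u v : X -> R[i]) : cmeasurable u -> cmeasurable v ->
  (\forall x \ae mu, u x = v x) -> Lnormc mu p%:E u = Lnormc mu p%:E v.
Proof.
move=> mu_ mv uv; rewrite /Lnormc unlock /Lnorm; congr (_ `^ _)%E.
have mabs (w : X -> R[i]) : cmeasurable w -> measurable_fun setT (fun x => `|(normc (w x))%:E| `^ p)%E.
  move=> mw; apply: (measurableT_comp (measurable_poweR p)).
  apply: measurableT_comp => //; apply/measurable_EFinP; exact: (measurable_normc mw).
apply: ge0_ae_eq_integral => //; try exact: mabs.
- by move=> x _; exact: poweR_ge0.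
- by move=> x _; exact: poweR_ge0.
by apply: filterS uv => x -> _.
Qed.

End Integration.

(** * Measure preserving maps and their Koopman operators *)

Section Measure_preserving.
Context {d : measure_display} {X : measurableType d} {R : realType} (mu : probability X R).

Definition mpres (T : X -> X) : Prop := measurable_fun setT T /\
  forall A, measurable A -> mu (T @^-1` A) = mu A.

Lemma mpres_comp (T S : X -> X) : mpres T -> mpres S -> mpres (fun x => T (S x)).
Proof.
move=> [mT pT] [mS pS]; split; first exact: (measurableT_comp mT).
move=> A mA; rewrite -(pT A mA) -(pS (T @^-1` A)) //.
by rewrite -[T @^-1` A]setTI; exact: mT.
Qed.

Lemma mpres_id : mpres id.
Proof. by split; first exact: measurable_id. Qed.

Lemma mpres_iter (T : X -> X) n : mpres T -> mpres (iter n T).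
Proof.
by move=> pT; elim: n => [|n IHn]; [exact: mpres_id|exact: mpres_comp].
Qed.

Lemma mpres_mp_fun (T : mp_aut mu) : mpres T.
Proof. by split; [exact: mp_fun_measurable|move=> A mA; exact: (mp_preserving T)]. Qed.

Lemma mpres_mp_inv (T : mp_aut mu) : mpres (mp_inv T).
Proof.
split; first exact: mp_inv_measurable.
move=> A mA; rewrite -(mp_preserving T); last first.
  by rewrite -[_ @^-1` A]setTI; exact: mp_inv_measurable.
congr (mu _); apply/seteqP; split => x /=; by rewrite mp_funK.
Qed.

Lemma mpres_iterz (T : mp_aut mu) n : mpres (iterz T n).
Proof.
case: n => n; apply: mpres_iter; [exact: mpres_mp_fun|exact: mpres_mp_inv].
Qed.

Lemma mpres_ge0_integral (T : X -> X) (f : X -> \bar R) : mpres T ->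
  measurable_fun setT f -> (forall x, (0 <= f x)%E) ->
  (\int[mu]_x f (T x) = \int[mu]_x f x)%E.
Proof.
move=> [mT pT] mf f0.
pose Tm : {mfun X >-> X} := HB.pack T (isMeasurableFun.Build _ _ _ _ T mT).
have := @ge0_integral_pushforward _ _ _ _ _ T mT mu setT f measurableT mf (fun x _ => f0 x).
rewrite preimage_setT => <-.
by apply: (@eq_measure_integral _ _ _ _ mu (pushforward mu Tm)) => A mA _; exact: pT.
Qed.

Lemma mpres_integral (T : X -> X) (h : X -> R) : mpres T -> measurable_fun setT h ->
  (exists B, forall x, `|h x| <= B) ->
  (\int[mu]_x (h (T x))%:E = \int[mu]_x (h x)%:E)%E.
Proof.
move=> [mT pT] mh [B hB].
pose Tm : {mfun X >-> X} := HB.pack T (isMeasurableFun.Build _ _ _ _ T mT).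
have mE : measurable_fun setT (EFin \o h) by exact/measurable_EFinP.
have ih : mu.-integrable (T @^-1` setT) ((EFin \o h) \o T).
  rewrite preimage_setT; apply: (@bounded_measurable_integrable _ _ _ mu (h \o T) B).
    exact: (measurableT_comp mh).
  by move=> x; exact: hB.
have := integral_pushforward mT mE ih measurableT.
rewrite preimage_setT => <-.
by apply: (@eq_measure_integral _ _ _ _ mu (pushforward mu Tm)) => A mA _; exact: pT.
Qed.

Definition koop (T : X -> X) (pT : mpres T) (f : bfun X R) : bfun X R :=
  mkbfun (bmeas_comp pT.1 (bfunP f)).

Lemma cintegral_koop T (pT : mpres T) f : cintegral mu (koop pT f) = cintegral mu f.
Proof.
have [[mr mi] [B fB]] := bfunP f; rewrite /cintegral /Rintegral /=; congr (fine _ +i* fine _).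
  apply: mpres_integral pT mr _; exists B => x.
  by apply: le_trans (fB x); case: (normc_ReIm (f x)).
apply: mpres_integral pT mi _; exists B => x.
by apply: le_trans (fB x); case: (normc_ReIm (f x)).
Qed.

Lemma inner_koop T (pT : mpres T) f g : inner mu (koop pT f) (koop pT g) = inner mu f g.
Proof. exact: (cintegral_koop pT (bmul f (bconj g))). Qed.

Lemma mpres_ae (T : X -> X) (P : X -> Prop) : mpres T ->
  (\forall x \ae mu, P x) -> \forall x \ae mu, P (T x).
Proof.
move=> [mT pT] [N [mN N0 sN]]; exists (T @^-1` N); split.
- by rewrite -[_ @^-1` N]setTI; exact: mT.
- by rewrite pT.
- by move=> x /= Px; apply: sN.
Qed.

End Measure_preserving.

(** * Integer powers of an automorphism *)

Section Integer_iterates.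
Context {d : measure_display} {X : measurableType d} {R : realType} {mu : probability X R}.
Implicit Types T S : mp_aut mu.

Lemma iterzS T n x : iterz T (n + 1) x = T (iterz T n x).
Proof.
case: n => [n|[|n]]; first by rewrite -PoszD addn1.
  by rewrite /= mp_invK.
have -> : (Negz n.+1 + 1 = Negz n) by lia.
by rewrite /= mp_invK.
Qed.

Lemma iterzD T m n x : iterz T (m + n) x = iterz T m (iterz T n x).
Proof.
elim/int_rec: m x => [x|m IHm x|m IHm x]; first by rewrite add0r.
  have -> : (m.+1%:Z + n = (m%:Z + n) + 1) by lia.
  by rewrite iterzS IHm -iterzS; congr (iterz T _ _); lia.
apply: (can_inj (mp_funK T)).
rewrite -iterzS -[RHS]iterzS.
have -> : (- m.+1%:Z + n + 1 = - m%:Z + n) by lia.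
by rewrite IHm; congr (iterz T _ _); lia.
Qed.

Lemma iterz1 T x : iterz T 1 x = T x. Proof. by []. Qed.

Lemma iterzN T n x : iterz T n (iterz T (- n) x) = x.
Proof. by rewrite -iterzD subrr. Qed.

Lemma iterz_comm (T : X -> X) S : (forall x, T (S x) = S (T x)) ->
  forall n x, T (iterz S n x) = iterz S n (T x).
Proof.
move=> TS; elim/int_rec => // m IHm x.
  have -> : (m.+1%:Z = m%:Z + 1) by lia.
  by rewrite !iterzS TS IHm.
apply: (can_inj (mp_funK S)); rewrite -TS -!iterzS.
by have -> : (- m.+1%:Z + 1 = - m%:Z) by lia.
Qed.

Lemma iterz_comm2 T S : (forall x, T (S x) = S (T x)) ->
  forall m n x, iterz T m (iterz S n x) = iterz S n (iterz T m x).
Proof.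
move=> TS m n x; symmetry; apply: (@iterz_comm (iterz S n) T) => y.
by rewrite (iterz_comm TS).
Qed.

Definition Un T n (f : bfun X R) : bfun X R := koop (mpres_iterz T n) f.

Lemma UnE T n f x : Un T n f x = f (iterz T n x). Proof. by []. Qed.

End Integer_iterates.

(** * Completeness for uniformly bounded sequences *)

Section Completeness.
Context {d : measure_display} {X : measurableType d} {R : realType} (mu : probability X R).

(** Adding [2 K / 2 ^ n] makes the sequence nonincreasing and keeps it bounded below. *)
Lemma fast_cauchy_cvg (u : R ^nat) (B K : R) : (forall n, `|u n| <= B) ->
  (forall n, `|u n.+1 - u n| <= K * 2^-1 ^+ n) -> cvgn u.
Proof.
move=> uB uK; pose v n := u n + 2 * K * 2^-1 ^+ n.
have K0 : 0 <= K by have := le_trans (normr_ge0 _) (uK 0%N); rewrite expr0 mulr1.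
have p0 n : 0 <= 2^-1 ^+ n :> R by rewrite exprn_ge0.
have cv : cvgn v.
  apply: nonincreasing_is_cvgn.
    apply/nonincreasing_seqP => n; rewrite /v exprS.
    have := le_trans (ler_norm _) (uK n); lra.
  exists (- B) => _ [n _ <-]; rewrite /v.
  by have := uB n; rewrite ler_norml => /andP[h _]; have := mulr_ge0 K0 (p0 n); lra.
have cp : cvgn (geometric (2 * K) (2^-1 : R)).
  by apply/cvg_ex; exists 0; apply: cvg_geometric; rewrite ger0_norm ?invr_ge0 // invf_lt1 // ltr1n.
have -> : u = (v \- geometric (2 * K) 2^-1)%R.
  by apply/funext => n; rewrite /v /geometric /= addrK.
exact: is_cvgB cv cp.
Qed.

(** The decay leaves room for a factor [4 ^ n]: the series of [4 ^ n |D n x| ^ 2] has finite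
    integral, hence is finite almost everywhere, and its sum bounds each term. *)
Lemma fast_ae_cvg (D : nat -> bfun X R) : (forall n, nrm2 (L2 mu) (D n) <= 8^-1 ^+ n) ->
  \forall x \ae mu, exists K : R, forall n, normc (D n x) <= K * 2^-1 ^+ n.
Proof.
move=> D8; pose S n x := (4 ^+ n * normc (D n x) ^+ 2)%:E.
have mS n : measurable_fun setT (S n).
  apply/measurable_EFinP; apply: measurable_realfun.measurable_funM; first exact: measurable_cst.
  by apply: measurable_funX; apply: measurable_normc; have [] := bfunP (D n).
have S0 n x : setT x -> (0 <= S n x)%E.
  by move=> _; rewrite lee_fin mulr_ge0 ?sqr_ge0 ?exprn_ge0.
have iS n : (\int[mu]_x S n x <= (2^-1 ^+ n)%:E)%E.
  rewrite /S; under eq_integral do rewrite EFinM.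
  rewrite ge0_integralZl //; last first.
  - by move=> x _; rewrite lee_fin sqr_ge0.
  - exact: (measurable_int mu (integrable_sqr_normc mu (D n))).
  rewrite nrm2_integral -EFinM lee_fin.
  apply: (@le_trans _ _ (4 ^+ n * 8^-1 ^+ n)); first by rewrite ler_wpM2l ?exprn_ge0.
  rewrite -exprMn (_ : 4 * 8^-1 = 2^-1 :> R) //; lra.
have total : (\int[mu]_x (\sum_(0 <= n <oo) S n x) < +oo)%E.
  rewrite integral_nneseries //.
  apply: (@le_lt_trans _ _ 2%:E); last exact: ltry.
  apply: lime_le.
    by apply: is_cvg_nneseries => n _ _; apply: integral_ge0 => x; exact: S0.
  near=> N.
  apply: (@le_trans _ _ (\sum_(0 <= n < N) (2^-1 ^+ n)%:E)%E); first by apply: lee_sum => n _; exact: iS.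
  rewrite sumEFin lee_fin.
  suff -> : \sum_(0 <= n < N) 2^-1 ^+ n = 2 - 2 * 2^-1 ^+ N :> R.
    by rewrite gerBl mulr_ge0 // exprn_ge0.
  elim: (N) => [|n IHn]; first by rewrite big_geq // expr0; lra.
  by rewrite big_nat_recr //= IHn exprS; lra.
have int : mu.-integrable setT (fun x => \sum_(0 <= n <oo) S n x)%E.
  apply/integrableP; split.
    by apply: ge0_emeasurable_sum => // n x _ _; exact: S0.
  rewrite (eq_integral (fun x => \sum_(0 <= n <oo) S n x)%E) // => x _.
  by rewrite gee0_abs // nneseries_ge0 // => n _ _; exact: S0.
have := integrable_ae measurableT int; apply: filterS => x /(_ I) fin.
pose C := fine (\sum_(0 <= n <oo) S n x)%E.
exists (Num.sqrt C) => n.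
have SC : 4 ^+ n * normc (D n x) ^+ 2 <= C.
  rewrite -lee_fin /C fineK //.
  apply: le_trans (nneseries_lim_ge (m := 0) n.+1 _); last by move=> i _ _; exact: S0.
  rewrite big_nat_recr //= leeDr //; apply: sume_ge0 => i _; exact: S0.
have C0 : 0 <= C by apply: (le_trans _ SC); rewrite mulr_ge0 ?exprn_ge0 ?normc_ge0.
rewrite -ler_sqr ?nnegrE ?normc_ge0 ?mulr_ge0 ?sqrtr_ge0 ?exprn_ge0 //; move: SC.
have -> : 4 = 2 ^+ 2 :> R by rewrite expr2; lra.
rewrite [(Num.sqrt C * _) ^+ 2]exprMn sqr_sqrtr // !exprVn -!exprM mulnC => SC'.
by rewrite ler_pdivlMr ?exprn_gt0 // mulrC.
Unshelve. all: by end_near. Qed.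

Definition clamp (B x : R) : R := Num.min B (Num.max (- B) x).

Lemma clamp_id (B x : R) : `|x| <= B -> clamp B x = x.
Proof.
by rewrite ler_norml => /andP[h1 h2]; rewrite /clamp (max_idPr h1) (min_idPr h2).
Qed.

Lemma clamp_le (B x : R) : 0 <= B -> `|clamp B x| <= B.
Proof.
move=> B0; rewrite ler_norml /clamp ge_min lexx andbT le_min le_max lexx /= andbT; lra.
Qed.

(** A fast subsequence converges almost everywhere. The clamped upper limits of its real and
    imaginary parts are measurable and bounded everywhere, so they form a [bfun]; dominated
    convergence and the Cauchy property conclude. *)
Lemma riesz_fischer (A : nat -> bfun X R) (B : R) :
  (forall n x, normc (A n x) <= B) ->
  (forall e, 0 < e -> exists J0, forall J K, (J0 <= J)%N -> (J0 <= K)%N ->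
     nrm2 (L2 mu) (A J - A K) <= e) ->
  exists g : bfun X R, forall e, 0 < e -> exists J0, forall J, (J0 <= J)%N ->
     nrm2 (L2 mu) (A J - g) <= e.
Proof.
move=> AB cau; have e8 n : 0 < 8^-1 ^+ n :> R by rewrite exprn_gt0.
have [j hj] := choice (fun n => cau _ (e8 n)).
pose phi := fix phi n := if n is m.+1 then maxn (j n) (phi m).+1 else j 0%N.
have phij n : (j n <= phi n)%N by case: n => [|n] //=; rewrite leq_maxl.
have phiS n : (phi n < phi n.+1)%N by rewrite /= leq_maxr.
have phin n : (n <= phi n)%N by elim: n => // n IHn; apply: leq_ltn_trans IHn (phiS n).
pose G n := A (phi n).
have GD n : nrm2 (L2 mu) (G n.+1 - G n) <= 8^-1 ^+ n.
  by apply: hj => //; apply: leq_trans (phij n) (ltnW (phiS n)).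
have mRe n : measurable_fun setT (fun x => complex.Re (G n x)) by have [[]] := bfunP (G n).
have mIm n : measurable_fun setT (fun x => complex.Im (G n x)) by have [[]] := bfunP (G n).
have ReB n x : `|complex.Re (G n x)| <= B by exact: le_trans (normc_ReIm _).1 (AB (phi n) x).
have ImB n x : `|complex.Im (G n x)| <= B by exact: le_trans (normc_ReIm _).2 (AB (phi n) x).
have [x0|noX] := pselect (exists x : X, True); last first.
  exists (A 0%N) => e e0; exists 0%N => J _.
  rewrite (_ : A J - A 0%N = 0) ?nrm2_0 ?(ltW e0) //.
  by apply/val_inj/funext => x; exfalso; apply: noX; exists x.
have B0 : 0 <= B by case: x0 => x _; exact: le_trans (normc_ge0 _) (AB 0%N x).
pose gf x := clamp B (limn_sup (fun n => complex.Re (G n x))) +i*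
             clamp B (limn_sup (fun n => complex.Im (G n x))).
have mlim (h : nat -> X -> R) : (forall n, measurable_fun setT (h n)) ->
    (forall n x, `|h n x| <= B) -> measurable_fun setT (fun x => clamp B (limn_sup (h ^~ x))).
  move=> mh hB; apply: measurable_minr; first exact: measurable_cst.
  apply: measurable_maxr; first exact: measurable_cst.
  apply: measurable_fun_limn_sup => // x _.
    by exists B => _ [n _ <-]; apply: le_trans (ler_norm _) (hB n x).
  by exists (- B) => _ [n _ <-]; have := hB n x; rewrite ler_norml => /andP[].
have hgB x : normc (gf x) <= B + B.
  have -> : gf x = (clamp B (limn_sup (fun n => complex.Re (G n x))))%:C + 'i%C *
     (clamp B (limn_sup (fun n => complex.Im (G n x))))%:C by rewrite [LHS]complexE.
  apply: le_trans (le_normcD _ _) _; rewrite ComplexField.Normc.normcM !normc_real.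
  have -> : normc ('i%C : R[i]) = 1.
    by rewrite /ComplexField.Normc.normc expr0n add0r expr1n sqrtr1.
  by rewrite mul1r lerD ?clamp_le.
have bg : bmeas gf.
  split; first by split; [exact: (mlim _ mRe)|exact: (mlim _ mIm)].
  by exists (B + B).
pose g := mkbfun bg; exists g.
have ae_cvg : \forall x \ae mu, normc (G n x - g x) ^+ 2 @[n --> \oo] --> (0 : R).
  have := fast_ae_cvg GD; apply: filterS => x [K hK].
  have cRe : cvgn (fun n => complex.Re (G n x)).
    apply: (@fast_cauchy_cvg _ B K) => // n; apply: le_trans (hK n).
    have := (normc_ReIm ((G n.+1 - G n) x)).1; rewrite bfunB.
    by case: (G n.+1 x); case: (G n x).
  have cIm : cvgn (fun n => complex.Im (G n x)).
    apply: (@fast_cauchy_cvg _ B K) => // n; apply: le_trans (hK n).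
    have := (normc_ReIm ((G n.+1 - G n) x)).2; rewrite bfunB.
    by case: (G n.+1 x); case: (G n x).
  have limB (u : R ^nat) : (forall n, `|u n| <= B) -> cvgn u -> `|limn u| <= B.
    move=> uB cu; rewrite ler_norml; apply/andP; split.
      by apply: limr_ge => //; near=> n; have := uB n; rewrite ler_norml => /andP[].
    by apply: limr_le => //; near=> n; apply: le_trans (ler_norm _) (uB n).
  have gE : g x = limn (fun n => complex.Re (G n x)) +i* limn (fun n => complex.Im (G n x)).
    rewrite /g /= /gf !cvg_limn_supE // !clamp_id //; apply: limB => //.
  have -> : (fun n => normc (G n x - g x) ^+ 2) =
     (fun n => (complex.Re (G n x) - limn (fun n => complex.Re (G n x))) ^+ 2 +
               (complex.Im (G n x) - limn (fun n => complex.Im (G n x))) ^+ 2).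
    by apply/funext => n; rewrite sqr_normcE gE; case: (G n x).
  have z (u : R ^nat) : cvgn u -> (u n - limn u) ^+ 2 @[n --> \oo] --> (0 : R).
    move=> cu; have h : u n - limn u @[n --> \oo] --> (0 : R).
      by rewrite -(subrr (limn u)); apply: cvgB => //; exact: cvg_cst.
    rewrite -[X in _ --> X](mulr0 (0 : R)); under eq_fun do rewrite expr2.
    exact: (cvgM h h).
  by rewrite -[X in _ --> X]addr0; apply: cvgD; exact: z.
have gB x : normc (g x) <= B + B by exact: hgB.
have mf n : measurable_fun setT (fun x => (normc ((G n - g) x) ^+ 2)%:E).
  exact: (measurable_int mu (integrable_sqr_normc mu (G n - g))).
have hcvg : \forall x \ae mu, setT x -> (normc ((G n - g) x) ^+ 2)%:E @[n --> \oo] --> (0%R)%:E.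
  by apply: filterS ae_cvg => x h _; apply: (cvg_comp _ _ h).
have hdom : \forall x \ae mu, forall n, setT x ->
    (`|(normc ((G n - g) x) ^+ 2)%:E| <= ((B + (B + B)) ^+ 2)%:E)%E.
  apply: nearW => x n _; rewrite abse_EFin lee_fin ger0_norm ?sqr_ge0 //.
  rewrite lerXn2r ?nnegrE ?normc_ge0 ?addr_ge0 // bfunB.
  by apply: le_trans (le_normcD _ _) _; rewrite normcN lerD // AB.
have icst : mu.-integrable setT (cst ((B + (B + B)) ^+ 2)%:E).
  exact: finite_measure_integrable_cst.
have [_ _] := dominated_convergence measurableT mf (measurable_cst _) hcvg icst hdom.
rewrite integral0 => dom.
have {}dom : (nrm2 (L2 mu) (G n - g))%:E @[n --> \oo] --> (0%R)%:E.
  rewrite (_ : (fun n => _) = (fun n => \int[mu]_x (normc ((G n - g) x) ^+ 2)%:E)%E) //.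
  by apply/funext => n; rewrite nrm2_integral.
move=> e e0; have e4 : 0 < e / 4 by rewrite divr_gt0.
have [J0 hJ0] := cau _ e4; exists J0 => J JJ.
have : \forall n \near \oo, nrm2 (L2 mu) (G n - g) <= e / 4.
  move/fine_cvgP : dom => [_ /cvgrPdist_le /(_ _ e4)]; apply: filterS => n /=.
  by rewrite sub0r normrN ger0_norm // nrm2_ge0.
move=> [n0 _ hn0]; pose n := maxn n0 J0.
have -> : A J - g = (A J - G n) + (G n - g) by rewrite addrA subrK.
apply: le_trans (nrm2D_le _ _ _) _.
have h1 : nrm2 (L2 mu) (A J - G n) <= e / 4.
  by apply: hJ0 => //; apply: leq_trans (phin n); rewrite /n leq_maxr.
have h2 : nrm2 (L2 mu) (G n - g) <= e / 4 by apply: hn0; rewrite /= /n leq_maxl.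
lra.
Unshelve. all: by end_near. Qed.

End Completeness.

Arguments L2 : simpl never.

(** * Eigenfunctions as limits of twisted averages *)

Section Eigenfunctions.
Context {d : measure_display} {X : measurableType d} {R : realType} {mu : probability X R}.
Implicit Types (T : mp_aut mu) (f g : bfun X R).

Lemma bfun_ext f g : f =1 g -> f = g.
Proof. by move=> fg; apply/val_inj/funext. Qed.

Lemma UnD T n f g : Un T n (f + g) = Un T n f + Un T n g.
Proof. exact: bfun_ext. Qed.

Lemma UnZ T n c f : Un T n (c *: f) = c *: Un T n f.
Proof. exact: bfun_ext. Qed.

Lemma UnB T n f g : Un T n (f - g) = Un T n f - Un T n g.
Proof. exact: bfun_ext. Qed.

Lemma Un_sum T n (I : Type) (r : seq I) (F : I -> bfun X R) :
  Un T n (\sum_(i <- r) F i) = \sum_(i <- r) Un T n (F i).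
Proof. by apply: bfun_ext => x; rewrite UnE !bfun_sum. Qed.

Lemma Un_Un T m n f : Un T m (Un T n f) = Un T (n + m) f.
Proof. by apply: bfun_ext => x; rewrite !UnE iterzD. Qed.

Lemma L2_Un T n f g : L2 mu (Un T n f) (Un T n g) = L2 mu f g.
Proof. exact: inner_koop. Qed.

Lemma nrm2_Un T n f : nrm2 (L2 mu) (Un T n f) = nrm2 (L2 mu) f.
Proof. by rewrite /nrm2 L2_Un. Qed.

Definition twist T (s : R) f (n : nat) : bfun X R := expi (- (s * n%:R)) *: Un T n f.

Lemma twist_form T s f n m : L2 mu (twist T s f n) (twist T s f m) =
  expi (- s * (n%:Z - m%:Z)%:~R) * L2 mu (Un T (n%:Z - m%:Z) f) f.
Proof.
rewrite formZl formZr mulrA -expiN -expiD opprK; congr (_ * _).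
  by congr expi; rewrite intrB; ring.
rewrite -(L2_Un T m%:Z (Un T (n%:Z - m%:Z) f) f) Un_Un subrK.
by [].
Qed.

Lemma twist_stationary T s f : stationary (L2 mu) (twist T s f).
Proof.
move=> n m; rewrite !twist_form.
by have -> : (n.+1%:Z - m.+1%:Z = n%:Z - m%:Z) by lia.
Qed.

Lemma Un1_twist T s f n : Un T 1 (twist T s f n) = expi s *: twist T s f (n + 1)%N.
Proof.
rewrite /twist UnZ Un_Un scalerA -expiD; congr (expi _ *: Un T _ f).
by rewrite natrD; ring.
Qed.

Lemma nrm2_small_eq0 f : (forall e, 0 < e -> nrm2 (L2 mu) f <= e) -> nrm2 (L2 mu) f = 0.
Proof.
move=> h; apply/eqP; rewrite eq_le nrm2_ge0 andbT.
by apply/ler_addgt0Pr => e e0; rewrite add0r; exact: h.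
Qed.

Lemma nrm2_bcst1 : nrm2 (L2 mu) (bcst 1) = 1.
Proof.
rewrite /nrm2 -[L2 mu _ _]/(cintegral mu (fun=> 1 * conjc 1)).
by rewrite cintegral_cst mul1r conjc1.
Qed.

Lemma cintegral_inner (f : bfun X R) : cintegral mu f = L2 mu f (bcst 1).
Proof. by apply: eq_cintegral => x; rewrite -[RHS]/(f x * conjc 1) conjc1 mulr1. Qed.

Lemma sqr_normc_cintegral (f : bfun X R) : normc (cintegral mu f) ^+ 2 <= nrm2 (L2 mu) f.
Proof. by rewrite cintegral_inner; apply: bessel1; exact: nrm2_bcst1. Qed.

Lemma cintegral_sub f g : cintegral mu (f - g) = cintegral mu f - cintegral mu g.
Proof. by rewrite !cintegral_inner -scaleN1r formDl formZl mulN1r. Qed.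

Lemma normc_cintegral_le (f : bfun X R) (C : R) : 0 <= C -> (forall x, normc (f x) <= C) ->
  normc (cintegral mu f) <= C.
Proof.
move=> C0 fC; rewrite -ler_sqr ?nnegrE ?normc_ge0 //.
by apply: le_trans (sqr_normc_cintegral _) _; exact: nrm2_le.
Qed.

Lemma cintegral_Un T n f : cintegral mu (Un T n f) = cintegral mu f.
Proof. exact: cintegral_koop. Qed.

Lemma bfun_Eig T l g : l != 0 -> nrm2 (L2 mu) g != 0 -> (\forall x \ae mu, g (T x) = l * g x) ->
  Eig T l.
Proof.
move=> l0 g0 Tg; split=> //; exists g; split=> //.
  by split; [have [] := bfunP g|rewrite Lnormc_2 ltry].
move=> gae; move/eqP: g0; apply; rewrite (nrm2_ae_eq (g := 0)) ?nrm2_0 //.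
Qed.

(** The dyadic averages of the stationary sequence [twist T s f] converge. The limit is nonzero
    because they stay away from 0, an eigenfunction because a shift by one hardly changes a long
    average, and it inherits a zero mean. *)
Lemma eigenfunction_of_averages T s f :
  ~ (forall e, 0 < e -> exists J, nrm2 (L2 mu) (vavg (twist T s f) (2 ^ J)) <= e) ->
  exists g : bfun X R, [/\ nrm2 (L2 mu) g != 0, \forall x \ae mu, g (T x) = expi s * g x &
    cintegral mu f = 0 -> cintegral mu g = 0].
Proof.
move=> /existsNP[e1 /not_implyP[e10 /forallNP big]].
have [_ [B fB]] := bfunP f.
pose A J := vavg (twist T s f) (2 ^ J).
have AB J x : normc (A J x) <= B.
  have fB0 : 0 <= B := le_trans (normc_ge0 _) (fB x).
  rewrite /A /vavg bfunZ bfun_sum; apply: le_trans (normc_favg _ _) _.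
  apply: le_trans (favg_cst (2 ^ J) fB0); apply: ler_favg => n _.
  by rewrite bfunZ ComplexField.Normc.normcM normc_expi mul1r UnE.
have [g gA] := riesz_fischer AB (stationary_cauchy (twist_stationary T s f)).
have sA n : nrm2 (L2 mu) (twist T s f n) <= B ^+ 2.
  rewrite nrm2Z normc_expi expr1n mul1r nrm2_Un; exact: nrm2_le.
have eqg : nrm2 (L2 mu) (Un T 1 g - expi s *: g) = 0.
  apply: nrm2_small_eq0 => e e0; have e8 : 0 < e / 16 by rewrite divr_gt0.
  have [J0 hJ0] := gA _ e8.
  have van : vanish (fun J => 4 * 1%:R ^+ 2 * B ^+ 2 * (J%:R^-1 ^+ 2) : R).
    apply: vanishZ; first by rewrite expr1n mulr1 mulr_ge0 ?sqr_ge0.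
    apply: vanish_sqr => [N|]; first by rewrite invr_ge0.
    by apply: (vanish_le (vanish_invn 1)) => N; rewrite mul1r.
  have [J1 _ hJ1] := van _ e8.
  pose J := (J0 + J1)%N.
  have JJ : (J1 <= 2 ^ J)%N by apply: (@leq_trans J); [exact: leq_addl|exact/ltnW/ltn_expl].
  have h1 := hJ0 J (leq_addr _ _).
  have h2 : nrm2 (L2 mu) (A J - vavg (fun n => twist T s f (n + 1)%N) (2 ^ J)) <= e / 16.
    apply: le_trans (nrm2_vavg_shift _ _ sA) _; have := hJ1 _ JJ; by rewrite exprVn.
  have UA : Un T 1 (A J) = expi s *: vavg (fun n => twist T s f (n + 1)%N) (2 ^ J).
    rewrite /A /vavg UnZ Un_sum [RHS]scalerA [expi s * _]mulrC -[RHS]scalerA; congr (_ *: _).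
    rewrite scaler_sumr.
    by apply: eq_bigr => n _; exact: Un1_twist.
  set A' := vavg (fun n => _) _ in h2 UA.
  have -> : Un T 1 g - expi s *: g = Un T 1 (g - A J) + expi s *: ((A' - A J) + (A J - g)).
    by rewrite UnB UA addrA subrK scalerBr addrA subrK.
  apply: le_trans (nrm2D_le _ _ _) _; rewrite nrm2_Un nrm2Z normc_expi expr1n mul1r.
  have h3 := nrm2D_le (L2 mu) (A' - A J) (A J - g).
  rewrite nrm2B_comm; rewrite (nrm2B_comm _ A') in h3; lra.
have gN0 : nrm2 (L2 mu) g != 0.
  apply/eqP => g0; have e4 : 0 < e1 / 2 by rewrite divr_gt0.
  have [J hJ] := gA _ e4; apply: (big J).
  have -> : vavg (twist T s f) (2 ^ J) = (A J - g) + g by rewrite subrK.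
  by apply: le_trans (nrm2D_le _ _ _) _; rewrite g0; have := hJ J (leqnn _); lra.
exists g; split=> //.
  have := nrm2_eq0 eqg; apply: filterS => x /eqP.
  by rewrite bfunB bfunZ UnE subr_eq0 => /eqP.
move=> f0; have A0 J : cintegral mu (A J) = 0.
  rewrite cintegral_inner /A /vavg formZl form_suml big1 ?mulr0 // => n _.
  by rewrite formZl -cintegral_inner cintegral_Un f0 mulr0.
apply/eqP; rewrite -normc_eq0 -sqrf_eq0 eq_le sqr_ge0 andbT.
apply/ler_addgt0Pr => e e0; rewrite add0r.
have [J hJ] := gA _ e0; apply: le_trans (hJ J (leqnn _)); rewrite -[cintegral mu g]subr0 -(A0 J) -cintegral_sub.
rewrite nrm2B_comm; exact: sqr_normc_cintegral.
Qed.

Lemma eigenvalue_of_averages T s f :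
  ~ (forall e, 0 < e -> exists J, nrm2 (L2 mu) (vavg (twist T s f) (2 ^ J)) <= e) ->
  Eig T (expi s).
Proof.
by move=> /eigenfunction_of_averages[g [g0 Tg _]]; apply: bfun_Eig Tg; rewrite ?expi_neq0.
Qed.

End Eigenfunctions.

(** * Averages of the joint orbit against a character *)

Section Weighted_averages.
Context {d : measure_display} {X : measurableType d} {R : realType} {mu : probability X R}.
Context {k : nat}.


Definition bprod (F : 'I_k -> bfun X R) : bfun X R :=
  \big[@bmul d X R/bcst 1]_i F i.

Lemma bprodE (F : 'I_k -> bfun X R) x : bprod F x = \prod_i F i x.
Proof. by rewrite /bprod; elim/big_rec2: _ => //= i u v _ ->. Qed.

Lemma eq_bprod (F G : 'I_k -> bfun X R) : (forall i, F i = G i) -> bprod F = bprod G.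
Proof. by move=> FG; apply: eq_bigr. Qed.

Lemma common_bound (f : 'I_k -> bfun X R) : exists2 C : R, 1 <= C & forall i x, normc (f i x) <= C.
Proof.
have [C hC] := choice (fun i => (bfunP (f i)).2).
exists (1 + \sum_i `|C i|); first by rewrite lerDl sumr_ge0.
move=> i x; apply: le_trans (hC i x) _; apply: le_trans (ler_norm _) _.
by rewrite (bigD1 i) //= addrCA lerDl addr_ge0 // sumr_ge0.
Qed.

Definition joint_iterate (T : 'I_k -> mp_aut mu) (f : 'I_k -> bfun X R) (m : int) : bfun X R :=
  bprod (fun i => Un (T i) m (f i)).

(** Convergence of the integrals only; it identifies the limits of the correlations in
    [van_der_corput]. *)
Definition weakly_joint (T : 'I_k -> mp_aut mu) : Prop := forall g : 'I_k -> bfun X R,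
  vanish (fun N => normc (favg (fun m => cintegral mu (joint_iterate T g m%:Z)) N
    - \prod_i cintegral mu (g i))).

(** Weak joint ergodicity makes the limiting correlations products of autocorrelations of the [f i],
    and [product_mean_small] bounds their means. The condition on [s] says that eigenvalues detected
    by the [f i] never multiply to [expi (- t)]. *)
Lemma weighted_vanish (T : 'I_k -> mp_aut mu) (f : 'I_k -> bfun X R) (t : R) :
  weakly_joint T ->
  (forall s : 'I_k -> R, expi (t + \sum_i s i) = 1 -> exists i, forall e, 0 < e ->
     exists J, nrm2 (L2 mu) (vavg (twist (T i) (s i) (f i)) (2 ^ J)) <= e) ->
  vanish (fun N => nrm2 (L2 mu) (vavg (fun m => expi (t * m%:R) *: joint_iterate T f m%:Z) N)).
Proof.
move=> wj spec; have [C C1 fC] := common_bound f.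
have C0 : 0 <= C by apply: le_trans C1.
pose c i l := L2 mu (Un (T i) l (f i)) (f i).
have B1 : 1 <= C ^+ 2 by rewrite exprn_ege1.
have cB i l : normc (c i l) <= C ^+ 2.
  apply: (normc_cintegral_le (sqr_ge0 C)) => x /=.
  by rewrite ComplexField.Normc.normcM normc_conj expr2; apply: ler_pM; rewrite ?normc_ge0 //.
pose sig i N s := nrm2 (L2 mu) (vavg (twist (T i) s (f i)) N).
have sigE i N s : (sig i N s)%:C = N%:R^-1 ^+ 2 *
    \sum_(n < N) \sum_(m < N) expi (- s * (n%:Z - m%:Z)%:~R) * c i (n%:Z - m%:Z).
  rewrite /sig -form_nrm2 /vavg formZl formZr conjc_natV mulrA -expr2; congr (_ * _).
  rewrite form_suml big_add1 big_mkord succnK; apply: eq_bigr => n _.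
  rewrite form_sumr big_add1 big_mkord succnK; apply: eq_bigr => m _.
  rewrite twist_form; have -> // : (n.+1%:Z - m.+1%:Z = n%:Z - m%:Z) by lia.
apply: (@van_der_corput _ _ (L2 mu) _ ((C ^+ k) ^+ 2) (fun h h' => expi (t * (h%:Z - h'%:Z)%:~R) *
    \prod_i c i (h%:Z - h'%:Z))).
- move=> m; rewrite nrm2Z normc_expi expr1n mul1r; apply: nrm2_le => x.
  rewrite bprodE normc_prod -[X in C ^+ X](card_ord k) -prodr_const.
  by apply: ler_prod => i _; rewrite normc_ge0 UnE fC.
- move=> h h'.
  (* The correlation at lags [h] and [h'] is the integral of the joint orbit of these functions. *)
  pose g i := bmul (Un (T i) h%:Z (f i)) (bconj (Un (T i) h'%:Z (f i))).
  apply: (vanish_le (wj g)) => N.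
  have gE i : cintegral mu (g i) = c i (h%:Z - h'%:Z).
    rewrite -[LHS]/(L2 mu (Un (T i) h%:Z (f i)) (Un (T i) h'%:Z (f i))).
    by rewrite /c -(L2_Un (T i) h'%:Z (Un (T i) (h%:Z - h'%:Z) (f i)) (f i)) Un_Un subrK.
  have -> : favg (fun m => L2 mu (expi (t * (m + h)%N%:R) *: joint_iterate T f (m + h)%N)
      (expi (t * (m + h')%N%:R) *: joint_iterate T f (m + h')%N)) N =
      expi (t * (h%:Z - h'%:Z)%:~R) * favg (fun m => cintegral mu (joint_iterate T g m%:Z)) N.
    rewrite -favgZ; apply: eq_favg => m _; rewrite formZl formZr mulrA -expiN -expiD.
    congr (expi _ * _); first by rewrite intrB !natrD; ring.
    apply: eq_cintegral => x /=; rewrite !bprodE conjc_prod -big_split; apply: eq_bigr => i _.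
    by rewrite /= -!iterD !(addnC m).
  rewrite (eq_bigr _ (fun i _ => gE i)) -mulrBr ComplexField.Normc.normcM normc_expi mul1r.
  by [].
have sig0 i N s : 0 <= sig i N s by exact: nrm2_ge0.
have sigD i N s : sig i (2 * N)%N s <= sig i N s.
  exact: (nrm2_vavg_double N (twist_stationary (T i) s (f i))).
move=> e e0; exact: (product_mean_small B1 cB sigE sig0 sigD spec e0).
Qed.

End Weighted_averages.

(** * Eigenvalues and eigenfunctions of ergodic maps *)

Section Unimodular_eigenfunctions.
Context {d : measure_display} {X : measurableType d} {R : realType} {mu : probability X R}.
Implicit Types (T S : mp_aut mu) (g h : bfun X R).

Definition csgn (z : R[i]) : R[i] := z * ((normc z)^-1)%:C.

Lemma normc_csgn z : normc (csgn z) = (z != 0)%:R.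
Proof.
rewrite ComplexField.Normc.normcM normc_real ger0_norm ?invr_ge0 ?normc_ge0 //.
have [->|z0] := eqVneq z 0; first by rewrite normc0E mul0r.
by rewrite divff // normc_eq0.
Qed.

Lemma csgn_eq0 z : (csgn z == 0) = (z == 0).
Proof. by rewrite -normc_eq0 normc_csgn pnatr_eq0 eqb0 negbK. Qed.

Lemma csgnM l z : normc l = 1 -> csgn (l * z) = l * csgn z.
Proof. by move=> l1; rewrite /csgn ComplexField.Normc.normcM l1 mul1r mulrA. Qed.

Lemma bmeas_csgn (f : X -> R[i]) : cmeasurable f -> bmeas (fun x => csgn (f x)).
Proof.
move=> cf; split; last by exists 1 => x; rewrite normc_csgn lern1 leq_b1.
have mV : measurable_fun setT (fun x => (normc (f x))^-1).
  apply: (eq_measurable_fun (fun x => normc (f x) `^ (-1))).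
    by move=> x _; rewrite powR_inv1 ?normc_ge0.
  exact: (measurableT_comp (measurable_powR (-1)) (measurable_normc cf)).
split.
  apply: (eq_measurable_fun (fun x => complex.Re (f x) * (normc (f x))^-1)).
    by move=> x _; rewrite /csgn; case: (f x) => a b /=; rewrite mulr0 subr0.
  by apply: measurable_funM => //; case: cf.
apply: (eq_measurable_fun (fun x => complex.Im (f x) * (normc (f x))^-1)).
  by move=> x _; rewrite /csgn; case: (f x) => a b /=; rewrite mulr0 add0r.
by apply: measurable_funM => //; case: cf.
Qed.

(** An eigenfunction and its composition with [T] have the same squared norm, which is finite and
    nonzero. *)
Lemma Eig_normc T l : Eig T l -> normc l = 1.
Proof.
move=> [l0 [f [[cf flt] f0 Tf]]].
have mh : measurable_fun setT (fun x => (normc (f x) ^+ 2)%:E).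
  by apply/measurable_EFinP; apply: measurable_funX; exact: measurable_normc.
set I := (\int[mu]_x (normc (f x) ^+ 2)%:E)%E.
have I0 : (0 <= I)%E by apply: integral_ge0 => x _; rewrite lee_fin sqr_ge0.
have Ilt : (I < +oo)%E.
  move: flt; rewrite /Lnormc unlock /Lnorm.
  have -> : (\int[mu]_x (`| (normc (f x))%:E | `^ 2%R) = I)%E.
    apply: eq_integral => x _.
    by rewrite abse_EFin poweR_EFin ger0_norm ?normc_ge0 // powR_mulrn ?normc_ge0.
  case: (I) I0 => [r _ _|_|]; [exact: ltry| |by []].
  by rewrite poweRyr ?invr_eq0 ?pnatr_eq0.
have II : I = ((normc l ^+ 2)%:E * I)%E.
  rewrite -ge0_integralZl //; [|by move=> x _; rewrite lee_fin sqr_ge0|by rewrite lee_fin sqr_ge0].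
  rewrite /I -(mpres_ge0_integral (f := fun x => (normc (f x) ^+ 2)%:E) (mpres_mp_fun T) mh); last by move=> x; rewrite lee_fin sqr_ge0.
  apply: ge0_ae_eq_integral => //.
  - exact: (measurableT_comp mh (mp_fun_measurable T)).
  - exact: measurable_funeM.
  - by move=> x _; rewrite lee_fin sqr_ge0.
  - by move=> x _; rewrite -EFinM lee_fin mulr_ge0 ?sqr_ge0.
  by apply: filterS Tf => x -> _; rewrite ComplexField.Normc.normcM exprMn EFinM.
have Ifin : I = (fine I)%:E by rewrite fineK // ge0_fin_numE.
have IN0 : fine I != 0.
  apply/eqP => If; apply: f0; have h : I = 0%E by rewrite Ifin If.
  have : (\int[mu]_x `|(normc (f x) ^+ 2)%:E| = 0)%E.
    by rewrite -h; apply: eq_integral => x _; rewrite gee0_abs // lee_fin sqr_ge0.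
  move/(ae_eq_integral_abs mu measurableT mh).
  by apply: filterS => x /(_ Logic.I) /= [] /eqP; rewrite sqrf_eq0 normc_eq0 => /eqP.
have : normc l ^+ 2 = 1.
  move: II; rewrite Ifin -EFinM => -[] /eqP.
  by rewrite -{1}[fine I]mul1r (inj_eq (mulIf IN0)) => /eqP.
by move=> /eqP; rewrite sqrp_eq1 ?normc_ge0 // => /eqP.
Qed.

Definition ergodic T : Prop := forall g : bfun X R,
  (\forall x \ae mu, g (T x) = g x) -> \forall x \ae mu, g x = cintegral mu g.

(** Since [|l| = 1], the phase of an eigenfunction is again an eigenfunction. Its zero set is
    invariant, hence null, and the value 1 is put there to have modulus 1 everywhere. *)
Lemma ergodic_Eig T l : ergodic T -> Eig T l ->
  exists2 g : bfun X R, (forall x, normc (g x) = 1) & \forall x \ae mu, g (T x) = l * g x.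
Proof.
move=> ergT El; have l1 := Eig_normc El; have [l0 [f [[cf _] f0 Tf]]] := El.
pose s := mkbfun (bmeas_csgn cf).
pose r : bfun X R := bmul s (bconj s).
have rE x : r x = (f x != 0)%:R.
  rewrite /= mulcJ normc_csgn; case: (_ != _); first by rewrite expr1n.
  by rewrite expr0n.
pose g : bfun X R := s + (bcst 1 - r).
have gE x : g x = if f x == 0 then 1 else csgn (f x).
  rewrite bfunD bfunB rE -[bcst 1 x]/(1 : R[i]).
  have [f0x|fN0] := eqVneq (f x) 0; last by rewrite subrr addr0.
  by rewrite -[s x]/(csgn (f x)) f0x subr0 /csgn mul0r add0r.
have fae : \forall x \ae mu, f x != 0.
  have rT : \forall x \ae mu, r (T x) = r x.
    by apply: filterS Tf => x Tfx; rewrite !rE Tfx mulf_eq0 negb_or l0.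
  have [c0|cN0] := eqVneq (cintegral mu r) 0; last first.
    apply: filterS (ergT r rT) => x; rewrite rE => rc; move: cN0; rewrite -rc.
    by case: (f x != 0); rewrite ?eqxx.
  exfalso; apply: f0; apply: filterS (ergT r rT) => x; rewrite rE c0.
  by case: eqP => // _ /eqP; rewrite oner_eq0.
exists g => [x|].
  rewrite gE; case: eqP => [_|/eqP fN0]; first exact: normc1E.
  by rewrite normc_csgn fN0.
apply: filterS2 fae Tf => x fN0 Tfx.
by rewrite !gE Tfx mulf_eq0 (negbTE l0) (negbTE fN0) csgnM.
Qed.

Lemma unimodular_nrm2 g : (forall x, normc (g x) = 1) -> nrm2 (L2 mu) g = 1.
Proof.
move=> g1; rewrite /nrm2 -[L2 mu g g]/(cintegral mu (fun x => g x * conjc (g x))).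
rewrite (@eq_cintegral _ _ _ _ _ (fun=> 1)) ?cintegral_cst // => x.
by rewrite mulcJ g1 expr1n.
Qed.

Lemma unimodular_Eig T l g : l != 0 -> (forall x, normc (g x) = 1) ->
  (\forall x \ae mu, g (T x) = l * g x) -> Eig T l.
Proof. by move=> l0 g1; apply: bfun_Eig; rewrite // unimodular_nrm2 ?oner_eq0. Qed.

Lemma eigenfunction_cintegral T l g : (\forall x \ae mu, g (T x) = l * g x) ->
  l != 1 -> cintegral mu g = 0.
Proof.
move=> Tg l1; have : cintegral mu (Un T 1 g) = l * cintegral mu g.
  rewrite -cintegralZ; apply: (cintegral_ae_eq (g := l *: g)).
  by apply: filterS Tg => x; rewrite bfunZ.
rewrite cintegral_Un => /eqP; rewrite -{1}[cintegral _ _]mul1r -subr_eq0 -mulrBl mulf_eq0.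
by rewrite subr_eq0 eq_sym (negbTE l1) => /eqP.
Qed.

Lemma eigenfunction_iterz T l g : l != 0 -> (\forall x \ae mu, g (T x) = l * g x) ->
  forall n : int, \forall x \ae mu, g (iterz T n x) = l ^ n * g x.
Proof.
move=> l0 Tg; elim/int_rec => [|n IHn|n IHn].
- by apply: nearW => x; rewrite expr0z mul1r.
- have := mpres_ae (mpres_iterz T n) Tg; apply: filterS2 IHn => x IHx.
  rewrite -iterzS; have -> : (n.+1%:Z = n%:Z + 1) by lia.
  by move=> ->; rewrite IHx mulrA exprzDr ?unitfE // expr1z [l * _]mulrC.
have := mpres_ae (mpres_iterz T (- n.+1%:Z)) Tg; apply: filterS2 IHn => x IHx.
rewrite -iterzS; have -> : (- n.+1%:Z + 1 = - n%:Z) by lia.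
rewrite IHx => h; apply: (mulfI l0); rewrite -h mulrA; congr (_ * _).
by rewrite -[X in X * _]expr1z -exprzDr ?unitfE //; congr (_ ^ _); lia.
Qed.

Lemma Eig1 T : Eig T 1.
Proof.
apply: (@unimodular_Eig T 1 (bcst 1)); first exact: oner_neq0.
  by move=> x; exact: normc1E.
by apply: nearW => x; rewrite mul1r.
Qed.

Lemma EigM T l m : ergodic T -> Eig T l -> Eig T m -> Eig T (l * m).
Proof.
move=> eT El Em; have [g g1 Tg] := ergodic_Eig eT El; have [h h1 Th] := ergodic_Eig eT Em.
have lm0 : l * m != 0 by rewrite mulf_neq0 ?El.1 ?Em.1.
apply: (@unimodular_Eig T _ (bmul g h)) => //.
  by move=> x /=; rewrite ComplexField.Normc.normcM g1 h1 mulr1.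
by apply: filterS2 Tg Th => x /= -> ->; rewrite mulrACA.
Qed.

Lemma EigX T l n : ergodic T -> Eig T l -> Eig T (l ^+ n).
Proof.
by move=> eT El; elim: n => [|n IHn]; [exact: Eig1|rewrite exprS; exact: EigM].
Qed.

Lemma EigJ T l : Eig T l -> ergodic T -> Eig T (conjc l).
Proof.
move=> El eT; have [g g1 Tg] := ergodic_Eig eT El.
apply: (@unimodular_Eig T _ (bconj g)).
- by rewrite -normc_eq0 normc_conj normc_eq0 El.1.
- by move=> x /=; rewrite normc_conj.
by apply: filterS Tg => x /= ->; rewrite conjcM.
Qed.

Lemma ergodic_ext T S : T =1 S -> ergodic T -> ergodic S.
Proof.
by move=> TS eT g Sg; apply: eT; apply: filterS Sg => x; rewrite TS.
Qed.

(** The quotient of [h] by [g], which is [h] times the conjugate of [g], is invariant. *)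
Lemma eigenspace_1dim T l g h : ergodic T -> normc l = 1 -> (forall x, normc (g x) = 1) ->
  (\forall x \ae mu, g (T x) = l * g x) -> (\forall x \ae mu, h (T x) = l * h x) ->
  \forall x \ae mu, h x = cintegral mu (bmul h (bconj g)) * g x.
Proof.
move=> eT l1 g1 Tg Th.
have inv : \forall x \ae mu, bmul h (bconj g) (T x) = bmul h (bconj g) x.
  apply: filterS2 Tg Th => x /= -> ->; rewrite conjcM mulrACA mulcJ l1 expr1n.
  by rewrite mul1r.
apply: filterS (eT _ inv) => x <- /=.
by rewrite -mulrA [conjc _ * _]mulrC mulcJ g1 expr1n mulr1.
Qed.

End Unimodular_eigenfunctions.

(** * From essentially bounded functions to bounded ones *)

Section Transfer.
Context {d : measure_display} {X : measurableType d} {R : realType} {mu : probability X R}.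

Let mu1 : (mu : {measure set X -> \bar R}) setT = 1%E.
Proof. exact: probability_setT. Qed.

Lemma ae_forall_finite (I : finType) (P : I -> X -> Prop) :
  (forall i, \forall x \ae mu, P i x) -> \forall x \ae mu, forall i, P i x.
Proof.
move=> aeP; suff : \forall x \ae mu, forall i, i \in enum I -> P i x.
  by apply: filterS => x Px i; apply: Px; rewrite mem_enum.
elim: (enum I) => [|i s IHs]; first exact: nearW.
apply: filterS2 (aeP i) IHs => x Pix Psx j; rewrite inE => /orP[/eqP ->//|]; exact: Psx.
Qed.

Lemma Linfty_bfun (f : X -> R[i]) : in_Lp mu +oo%E f ->
  exists g : bfun X R, \forall x \ae mu, f x = g x.
Proof.
move=> [cf]; rewrite /Lnormc unlock /Lnorm.
have -> : (0 < (mu : {measure set X -> \bar R}) [set: X])%E.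
  by rewrite mu1 lte_fin.
have -> : abse \o (fun x => (normc (f x))%:E) = EFin \o (fun x => normc (f x)).
  by apply/funext => x /=; rewrite ger0_norm ?normc_ge0.
move=> /ess_supr_bounded[M fM].
have bg : bmeas (fun x => if normc (f x) <= M then f x else 0).
  split.
    have ml : measurable_fun setT (fun x => normc (f x) <= M).
      by apply: measurable_fun_ler; [exact: measurable_normc|exact: measurable_cst].
    split.
      apply: (eq_measurable_fun (fun x => if normc (f x) <= M then complex.Re (f x) else 0)).
        by move=> x _; case: ifP.
      by apply: measurable_fun_ifT; [|case: cf|exact: measurable_cst].
    apply: (eq_measurable_fun (fun x => if normc (f x) <= M then complex.Im (f x) else 0)).
      by move=> x _; case: ifP.
    by apply: measurable_fun_ifT; [|case: cf|exact: measurable_cst].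
  exists `|M| => x; case: ifP => [h|_]; last by rewrite normc0E.
  by apply: le_trans h _; exact: ler_norm.
by exists (mkbfun bg); apply: filterS fM => x /= ->.
Qed.

Lemma bfun_Linfty (f : bfun X R) : in_Lp mu +oo%E f.
Proof.
have [mf [B fB]] := bfunP f; split=> //; rewrite /Lnormc unlock /Lnorm.
have -> : (0 < (mu : {measure set X -> \bar R}) [set: X])%E.
  by rewrite mu1 lte_fin.
apply: (@le_lt_trans _ _ B%:E); last exact: ltry.
apply/ess_supP; apply: nearW => x /=.
by rewrite lee_fin ger0_norm ?normc_ge0.
Qed.

Lemma vanish_cvg (a : nat -> R) : (forall N, 0 <= a N) ->
  vanish a <-> (a N @[N --> \oo] --> (0 : R)).
Proof.
move=> a0; split.
  move=> va; apply/cvgrPdist_le => e e0; apply: filterS (va e e0) => N.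
  by rewrite sub0r normrN ger0_norm.
move=> /cvgrPdist_le ca e e0; apply: filterS (ca e e0) => N.
by rewrite sub0r normrN ger0_norm.
Qed.

Lemma vanish_sqrt_cvg (a : nat -> R) : (forall N, 0 <= a N) ->
  vanish a <-> ((Num.sqrt (a N))%:E @[N --> \oo] --> (0 : \bar R)).
Proof.
move=> a0; split=> [va|].
  apply/fine_cvgP; split; first exact: nearW.
  apply/(vanish_cvg (a := fun N => Num.sqrt (a N))) => [N|]; first exact: sqrtr_ge0.
  move=> e e0; apply: filterS (va _ (exprn_gt0 2 e0)) => N h.
  by rewrite -(ger0_norm (ltW e0)) -sqrtr_sqr ler_wsqrtr.
move=> /fine_cvgP[_] /(vanish_cvg (a := fun N => Num.sqrt (a N))) h.
have {}h := h (fun N => sqrtr_ge0 _).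
apply: (vanish_le (vanish_sqr (fun N => sqrtr_ge0 _) h)) => N.
by rewrite sqr_sqrtr.
Qed.

Context {k : nat} (T : 'I_k -> mp_aut mu).

Definition joint_along (phi : nat -> int) : Prop := forall f : 'I_k -> bfun X R,
  vanish (fun N => nrm2 (L2 mu)
    (vavg (fun n => joint_iterate T f (phi n)) N - bcst (\prod_i cintegral mu (f i)))).

Lemma joint_averageE (phi : int -> int) (f : 'I_k -> bfun X R) N x :
  mult_avg T phi f N x - \prod_i cintegral mu (f i) =
  (vavg (fun n => joint_iterate T f (phi n%:Z)) N - bcst (\prod_i cintegral mu (f i))) x.
Proof.
rewrite bfunB /vavg bfunZ bfun_sum; congr (_ * _ - _).
by apply: eq_bigr => n _; rewrite bprodE.
Qed.

(** Essentially bounded functions are modified on null sets. Countably many iterates are involved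
    and each pulls null sets back to null sets, so all averages are unchanged almost everywhere. *)
Lemma jointly_ergodic_alongP (phi : int -> int) :
  jointly_ergodic_along T phi <-> joint_along (fun n => phi n%:Z).
Proof.
split=> [je f|je f fL].
  have := je f (fun i => bfun_Linfty (f i)).
  rewrite (_ : (fun N => _) = fun N => (Num.sqrt (nrm2 (L2 mu)
    (vavg (fun n => joint_iterate T f (phi n%:Z)) N - bcst (\prod_i cintegral mu (f i)))))%:E).
    by move/(vanish_sqrt_cvg (fun N => nrm2_ge0 _ _)).
  apply/funext => N; rewrite -Lnormc_2; congr Lnormc.
  by apply/funext => x; exact: joint_averageE.
have [g fg] := choice (fun i => Linfty_bfun (fL i)).
rewrite (_ : (fun N => _) = fun N => (Num.sqrt (nrm2 (L2 mu)
    (vavg (fun n => joint_iterate T g (phi n%:Z)) N - bcst (\prod_i cintegral mu (g i)))))%:E).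
  by apply/(vanish_sqrt_cvg (fun N => nrm2_ge0 _ _)).
apply/funext => N; rewrite -Lnormc_2.
have ci i : cintegral mu (f i) = cintegral mu (g i).
  by apply: ae_eq_cintegral; [case: (fL i)|case: (bfunP (g i))|].
apply: Lnormc_ae_eq.
- apply: cmeasurable_add; last exact: cmeasurable_cst.
  apply: cmeasurable_mul; first exact: cmeasurable_cst.
  apply: cmeasurable_sum => n; apply: cmeasurable_prod => i.
  by apply: cmeasurable_comp; [exact: (mpres_iterz (T i) (phi n)).1|case: (fL i)].
- by case: (bfunP (vavg (fun n => joint_iterate T g (phi n%:Z)) N - bcst (\prod_i cintegral mu (g i)))).
have : \forall x \ae mu, forall n i, f i (iterz (T i) (phi (Posz n)) x) = g i (iterz (T i) (phi (Posz n)) x).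
  apply/ae_foralln => n; apply: ae_forall_finite => i.
  exact: (mpres_ae (mpres_iterz (T i) (phi n)) (fg i)).
apply: filterS => x hx; rewrite -joint_averageE (eq_bigr _ (fun i _ => ci i)); congr (_ * _ - _).
by apply: eq_bigr => n _; apply: eq_bigr => i _.
Qed.

End Transfer.

(** * Inverses and products of automorphisms *)

Section Automorphisms.
Context {d : measure_display} {X : measurableType d} {R : realType} {mu : probability X R}.
Implicit Types T S : mp_aut mu.

Definition mp_inverse T : mp_aut mu :=
  MpAut (mp_invK T) (mp_funK T) (mp_inv_measurable T) (mp_fun_measurable T) (mpres_mp_inv T).2.

Lemma mp_comp_funK T S : cancel (T \o S) (mp_inv S \o mp_inv T).
Proof. by move=> x /=; rewrite !mp_funK. Qed.

Lemma mp_comp_invK T S : cancel (mp_inv S \o mp_inv T) (T \o S).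
Proof. by move=> x /=; rewrite !mp_invK. Qed.

Definition mp_comp T S : mp_aut mu :=
  MpAut (mp_comp_funK T S) (mp_comp_invK T S)
    (mpres_comp (mpres_mp_fun T) (mpres_mp_fun S)).1
    (mpres_comp (mpres_mp_inv S) (mpres_mp_inv T)).1
    (mpres_comp (mpres_mp_fun T) (mpres_mp_fun S)).2.

Lemma iterz_unique T (F : int -> X -> X) : (forall x, F 0 x = x) ->
  (forall n x, F (n + 1) x = T (F n x)) -> forall n x, iterz T n x = F n x.
Proof.
move=> F0 FS; elim/int_rec => [x|n IHn x|n IHn x]; first by rewrite F0.
  have -> : (n.+1%:Z = n%:Z + 1) by lia.
  by rewrite iterzS FS IHn.
apply: (can_inj (mp_funK T)); rewrite -iterzS -FS.
by have -> : (- n.+1%:Z + 1 = - n%:Z) by lia.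
Qed.

Lemma iterz_inverse T n x : iterz (mp_inverse T) n x = iterz T (- n) x.
Proof.
apply: (@iterz_unique (mp_inverse T) (fun n x => iterz T (- n) x)) => // m y.
apply: (can_inj (mp_funK T)); rewrite -iterzS mp_invK.
by congr (iterz T _ _); lia.
Qed.

Lemma commute_inverse (T : X -> X) S : (forall x, T (S x) = S (T x)) ->
  forall x, T (mp_inv S x) = mp_inv S (T x).
Proof. by move=> TS x; apply: (can_inj (mp_funK S)); rewrite -TS !mp_invK. Qed.

Lemma iterz_comp T S : (forall x, T (S x) = S (T x)) ->
  forall n x, iterz (mp_comp T S) n x = iterz T n (iterz S n x).
Proof.
move=> TS; apply: iterz_unique => // n x.
by rewrite !iterzS /= (iterz_comm (T := S) (S := T)) // => y; rewrite TS.
Qed.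

Lemma ergodic_inverse T : ergodic T -> ergodic (mp_inverse T).
Proof.
move=> eT g Tg; apply: eT; apply: filterS (mpres_ae (mpres_mp_fun T) Tg) => x.
by rewrite /= mp_funK.
Qed.

Lemma Eig_inverse T l : Eig T l -> Eig (mp_inverse T) l^-1.
Proof.
move=> [l0 [f [fL f0 Tf]]]; split; first by rewrite invr_eq0.
exists f; split=> //; apply: filterS (mpres_ae (mpres_mp_inv T) Tf) => x.
by rewrite mp_invK => ->; rewrite mulrA mulVf // mul1r.
Qed.

Lemma Eig_inverseE T l : Eig (mp_inverse T) l -> Eig T l^-1.
Proof.
move=> [l0 [f [fL f0 Tf]]]; split; first by rewrite invr_eq0.
exists f; split=> //; apply: filterS (mpres_ae (mpres_mp_fun T) Tf) => x.
by rewrite /= mp_funK => ->; rewrite mulrA mulVf // mul1r.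
Qed.

End Automorphisms.

(** * Necessary conditions for joint ergodicity *)

Section Consequences_of_joint_ergodicity.
Context {d : measure_display} {X : measurableType d} {R : realType} {mu : probability X R}.

Lemma nrm2_eq0_ae (f g : bfun X R) : nrm2 (L2 mu) (f - g) = 0 -> \forall x \ae mu, f x = g x.
Proof.
by move=> /nrm2_eq0; apply: filterS => x /eqP; rewrite bfunB subr_eq0 => /eqP.
Qed.

Lemma nrm2_ae0 (f : bfun X R) : (\forall x \ae mu, f x = 0) -> nrm2 (L2 mu) f = 0.
Proof. by move=> f0; rewrite (nrm2_ae_eq (g := 0)) ?nrm2_0. Qed.

Lemma vavg_ae_const (u : nat -> bfun X R) (g : bfun X R) N : (0 < N)%N ->
  (forall n, \forall x \ae mu, u n x = g x) -> \forall x \ae mu, vavg u N x = g x.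
Proof.
move=> N0 ug; apply: filterS (ae_foralln ug) => x hx.
rewrite /vavg bfunZ bfun_sum.
rewrite (eq_bigr (fun=> g x * 1)) => [|n _]; last by rewrite mulr1.
by rewrite -mulr_sumr mulrCA -[X in _ * X]/(favg (fun=> 1) N) favg_cst1 // mulr1.
Qed.

Context {k : nat} (T : 'I_k -> mp_aut mu).

Lemma vanish_cst (c : R) : vanish (fun=> c) -> c <= 0.
Proof.
move=> vc; apply/ler_addgt0Pr => e e0; rewrite add0r.
have [N _ hN] := vc e e0; exact: (hN N (leqnn N)).
Qed.

Lemma joint_along_const (phi : nat -> int) (f : 'I_k -> bfun X R) (g : bfun X R) :
  joint_along T phi -> (forall n, \forall x \ae mu, joint_iterate T f (phi n) x = g x) ->
  \forall x \ae mu, g x = \prod_i cintegral mu (f i).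
Proof.
move=> je fg; apply: (@nrm2_eq0_ae g (bcst (\prod_i cintegral mu (f i)))).
apply/eqP; rewrite eq_le nrm2_ge0 andbT; apply: vanish_cst.
apply: (vanish_near (je f)); near=> N.
rewrite -(@nrm2_ae_eq _ _ _ _ (vavg (fun n => joint_iterate T f (phi n)) N - bcst (\prod_i cintegral mu (f i)))) //.
have N0 : (0 < N)%N by near: N; exact: nbhs_infty_gt.
by apply: filterS (vavg_ae_const N0 fg) => x; rewrite !bfunB => ->.
Unshelve. all: by end_near. Qed.

Lemma cintegral_vavg (u : nat -> bfun X R) N :
  cintegral mu (vavg u N) = favg (fun n => cintegral mu (u n)) N.
Proof.
rewrite cintegral_inner /vavg formZl form_suml; congr (_ * _).
by apply: eq_bigr => n _; rewrite -cintegral_inner.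
Qed.

Lemma weakly_joint_of_joint : joint_along T Posz -> weakly_joint T.
Proof.
move=> je g; apply: vanish_sqr_inv => [N|]; first exact: normc_ge0.
apply: (vanish_le (je g)) => N; apply: le_trans (sqr_normc_cintegral _).
by rewrite cintegral_sub cintegral_vavg cintegral_cst.
Qed.

Lemma joint_iterate_eigen (l : 'I_k -> R[i]) (g : 'I_k -> bfun X R) m :
  (forall i, l i != 0) -> (forall i, \forall x \ae mu, g i (T i x) = l i * g i x) ->
  \forall x \ae mu, joint_iterate T g m x = (\prod_i l i) ^ m * bprod g x.
Proof.
move=> l0 Tg.
have := ae_forall_finite (fun i => eigenfunction_iterz (l0 i) (Tg i) m).
apply: filterS => x hx; rewrite !bprodE.
have -> : (\prod_i l i) ^ m = \prod_i l i ^ m.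
  exact: (big_morph (fun z => z ^ m) (fun y z => expfzMl y z m) (exp1rz _ m)).
by rewrite -big_split; apply: eq_bigr => i _; rewrite UnE hx.
Qed.

Lemma ergodic_of_joint : joint_along T Posz -> forall i, ergodic (T i).
Proof.
move=> je i h Th; pose f j := if j == i then h else bcst 1.
have ci : \prod_j cintegral mu (f j) = cintegral mu h.
  rewrite (bigD1 i) //= /f eqxx big1 ?mulr1 // => j /negPf ->.
  exact: cintegral_cst.
rewrite -ci; apply: (joint_along_const je) => n.
have Th1 : \forall x \ae mu, h (T i x) = 1 * h x by apply: filterS Th => x ->; rewrite mul1r.
apply: filterS (eigenfunction_iterz (oner_neq0 _) Th1 n%:Z) => x.
rewrite exp1rz mul1r => <-; rewrite bprodE (bigD1 i) //= {1}/f eqxx big1 ?mulr1 // => j /negPf ji.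
by rewrite /f ji.
Qed.

(** If [h] is invariant, its orbits under [T i] and [T j] agree. With [h] at [i] and its conjugate
    at [j], the integrals constantly equal the squared norm of [h], and their mean tends to the
    squared modulus of its integral; the equality forces [h] to be constant. *)
Lemma ergodic_pair_of_joint : commuting T -> joint_along T Posz ->
  forall i j, i != j -> ergodic (mp_comp (T i) (mp_inverse (T j))).
Proof.
move=> cT je i j ij h Sh.
pose f l := if l == i then h else if l == j then bconj h else bcst 1.
have ji : j != i by rewrite eq_sym.
have prodf (F : bfun X R -> 'I_k -> R[i]) : (forall l, F (bcst 1) l = 1) ->
    \prod_l F (f l) l = F h i * F (bconj h) j.
  move=> F1; rewrite (bigD1 i) //= (bigD1 j) //= /f eqxx (negPf ji) eqxx big1 ?mulr1 // => l.
  by case/andP => /negPf -> /negPf ->; exact: F1.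
have Sh1 : \forall x \ae mu, h (mp_comp (T i) (mp_inverse (T j)) x) = 1 * h x.
  by apply: filterS Sh => x ->; rewrite mul1r.
have hij n : \forall x \ae mu, h (iterz (T i) n x) = h (iterz (T j) n x).
  have := mpres_ae (mpres_iterz (T j) n) (eigenfunction_iterz (oner_neq0 _) Sh1 n).
  apply: filterS => x; rewrite exp1rz mul1r => <-.
  rewrite iterz_comp; last by move=> y /=; rewrite (commute_inverse (cT i j)).
  by rewrite iterz_inverse -iterzD addNr.
have wk := weakly_joint_of_joint je f.
have avgE N : (0 < N)%N ->
    favg (fun m => cintegral mu (joint_iterate T f m%:Z)) N = (nrm2 (L2 mu) h)%:C.
  move=> N0; rewrite (@eq_favg _ _ (fun=> (nrm2 (L2 mu) h)%:C * 1)).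
    by rewrite favgZ favg_cst1 // mulr1.
  move=> m _; rewrite mulr1 -form_nrm2 -(L2_Un (T j) m%:Z h h).
  apply: (@cintegral_ae_eq _ _ _ _ _ (bmul (Un (T j) m%:Z h) (bconj (Un (T j) m%:Z h)))).
  apply: filterS (hij m%:Z) => x hx; rewrite bprodE.
  by rewrite (prodf (fun g l => Un (T l) m%:Z g x)) // UnE hx.
have hh : (nrm2 (L2 mu) h)%:C = cintegral mu h * conjc (cintegral mu h).
  apply/eqP; rewrite -subr_eq0 -normc_eq0 eq_le normc_ge0 andbT; apply: vanish_cst.
  apply: (vanish_near wk); near=> N.
  have N0 : (0 < N)%N by near: N; exact: nbhs_infty_gt.
  rewrite avgE // (prodf (fun g _ => cintegral mu g)) => [|l]; last exact: cintegral_cst.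
  by rewrite -cintegral_conj.
apply: (@nrm2_eq0_ae h (bcst (cintegral mu h))).
have -> : bcst (cintegral mu h) = cintegral mu h *: bcst 1 :> bfun X R.
  by apply: bfun_ext => x; rewrite bfunZ [RHS]mulr1.
rewrite nrm2B nrm2Z nrm2_bcst1 formZr -cintegral_inner [conjc _ * _]mulrC -hh.
by move: hh; rewrite mulcJ => -[->] /=; ring.
Unshelve. all: by end_near. Qed.

(** A product of unimodular eigenfunctions is fixed by the joint action when the [l i] multiply to
    1, so it equals the product of their integrals. That product is 0 if some [l i] differs from
    1. *)
Lemma independent_Eig_of_joint : joint_along T Posz ->
  forall l : 'I_k -> R[i], (forall i, Eig (T i) (l i)) -> \prod_i l i = 1 -> forall i, l i = 1.
Proof.
move=> je l El l1 i; apply/eqP; apply/negPn/negP => li1.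
have gE j := ergodic_Eig (@ergodic_of_joint je j) (El j).
pose g j := sval (cid2 (gE j)).
have g1 j x : normc (g j x) = 1 by rewrite /g; case: (cid2 _) => g' /= h _; exact: h.
have Tg j : \forall x \ae mu, g j (T j x) = l j * g j x by rewrite /g; case: (cid2 _).
have gc : \forall x \ae mu, bprod g x = \prod_j cintegral mu (g j).
  apply: (joint_along_const je) => n.
  apply: filterS (joint_iterate_eigen n%:Z (fun j => (El j).1) Tg) => x ->.
  by rewrite l1 exp1rz mul1r.
have g0 : \prod_j cintegral mu (g j) = 0.
  by rewrite (bigD1 i) //= (eigenfunction_cintegral (Tg i) li1) mul0r.
rewrite g0 in gc; have := nrm2_ae0 gc; rewrite unimodular_nrm2 => [/eqP|x].
  by rewrite oner_eq0.
by rewrite bprodE normc_prod big1.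
Qed.

End Consequences_of_joint_ergodicity.

(** * Sufficiency of these conditions, and joint ergodicity of the inverses *)

Section Sufficient_conditions.
Context {d : measure_display} {X : measurableType d} {R : realType} {mu : probability X R}.

(** A characterization of joint ergodicity that is visibly symmetric under passing to the
    inverses. *)
Record joint_conditions {k : nat} (T : 'I_k -> mp_aut mu) : Prop := JointConditions {
  cond_ergodic : forall i, ergodic (T i);
  cond_pair : forall i j, i != j -> ergodic (mp_comp (T i) (mp_inverse (T j)));
  cond_Eig : forall l : 'I_k -> R[i], (forall i, Eig (T i) (l i)) ->
    \prod_i l i = 1 -> forall i, l i = 1 }.

Lemma unimodular_scale_inj (a b : R[i]) (g : bfun X R) : (forall x, normc (g x) = 1) ->
  (\forall x \ae mu, a * g x = b * g x) -> a = b.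
Proof.
move=> g1 ab; have := @nrm2_ae0 _ _ _ mu ((a - b) *: g).
rewrite nrm2Z unimodular_nrm2 // mulr1 => h.
apply/eqP; rewrite -subr_eq0 -normc_eq0 -sqrf_eq0; apply/eqP/h.
by apply: filterS ab => x; rewrite bfunZ mulrBl => ->; rewrite subrr.
Qed.

(** Composition with [T] preserves the eigenspace of [S], which is one-dimensional. *)
Lemma commuting_eigenfunction (S T : mp_aut mu) l (g : bfun X R) : ergodic S ->
  (forall x, S (T x) = T (S x)) -> normc l = 1 -> (forall x, normc (g x) = 1) ->
  (\forall x \ae mu, g (S x) = l * g x) ->
  exists2 c, c != 0 & \forall x \ae mu, g (T x) = c * g x.
Proof.
move=> eS ST l1 g1 Sg.
have SUg : \forall x \ae mu, Un T 1 g (S x) = l * Un T 1 g x.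
  by apply: filterS (mpres_ae (mpres_mp_fun T) Sg) => x; rewrite !UnE !iterz1 ST.
have Tg := eigenspace_1dim eS l1 g1 Sg SUg.
exists (cintegral mu (bmul (Un T 1 g) (bconj g))) => //.
apply/eqP => c0; rewrite c0 in Tg; have := @nrm2_ae0 _ _ _ mu (Un T 1 g).
rewrite nrm2_Un unimodular_nrm2 // => h; move/eqP: (oner_neq0 R); apply; apply: h.
by apply: filterS Tg => x ->; rewrite mul0r.
Qed.

Lemma Eig_prod (I : Type) (r : seq I) (T : mp_aut mu) (l : I -> R[i]) : ergodic T ->
  (forall i, Eig T (l i)) -> Eig T (\prod_(i <- r) l i).
Proof. by move=> eT El; elim/big_ind: _ => //; [exact: Eig1|move=> x y; exact: EigM]. Qed.

Definition quotients {k : nat} (T : 'I_k.+1 -> mp_aut mu) (i : 'I_k) : mp_aut mu :=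
  mp_comp (T (lift ord0 i)) (mp_inverse (T ord0)).

Lemma commuting_quotients k (T : 'I_k.+1 -> mp_aut mu) : commuting T -> commuting (quotients T).
Proof.
move=> cT i j x /=; rewrite -!(commute_inverse (cT _ ord0)).
by rewrite cT.
Qed.

(** An eigenfunction [g i] of the [i]-th quotient is one of every [T j], with eigenvalue [c i j],
    and [c i (i + 1) = l i * c i 0]. So the [c i (i + 1)] and the conjugate of the product of the
    [c i 0] multiply to the product of the [l i], which is 1; by independence for [T] each is 1.
    Then [g i] is invariant under an ergodic map, hence constant, and [l i = 1]. *)
Lemma cond_quotients k (T : 'I_k.+1 -> mp_aut mu) : commuting T -> joint_conditions T ->
  joint_conditions (quotients T).
Proof.
move=> cT [eT pT iT].
have eS i : ergodic (quotients T i) by apply: pT; rewrite -val_eqE.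
split=> //.
  move=> i j ij; apply: (@ergodic_ext _ _ _ _ (mp_comp (T (lift ord0 i)) (mp_inverse (T (lift ord0 j))))).
    by move=> x /=; rewrite mp_funK.
  by apply: pT; rewrite (inj_eq lift_inj).
move=> l El l1.
have gE j := ergodic_Eig (eS j) (El j).
pose g j := sval (cid2 (gE j)).
have g1 j x : normc (g j x) = 1 by rewrite /g; case: (cid2 _) => g' /= h _; exact: h.
have Sg j : \forall x \ae mu, g j (quotients T j x) = l j * g j x by rewrite /g; case: (cid2 _).
have ST i j x : quotients T i (T j x) = T j (quotients T i x).
  by rewrite /= -(commute_inverse (cT j ord0)) cT.
have cE i j := commuting_eigenfunction (eS i) (ST i j) (Eig_normc (El i)) (g1 i) (Sg i).
pose c i j := sval (cid2 (cE i j)).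
have c0 i j : c i j != 0 by rewrite /c; case: (cid2 _).
have Tg i j : \forall x \ae mu, g i (T j x) = c i j * g i x by rewrite /c; case: (cid2 _).
have cl i : c i (lift ord0 i) = l i * c i ord0.
  apply: (unimodular_scale_inj (g1 i)).
  have := mpres_ae (mpres_mp_fun (T ord0)) (Sg i); apply: filterS3 (Tg i ord0) (Tg i (lift ord0 i)) => x.
  by rewrite /= mp_funK => -> <- ->; rewrite mulrA.
have Ec i j : Eig (T j) (c i j) by apply: unimodular_Eig (Tg i j).
have c1 i : c i (lift ord0 i) = 1.
  pose m j := if unlift ord0 j is Some i then c i (lift ord0 i) else conjc (\prod_i c i ord0).
  have mL i' : m (lift ord0 i') = c i' (lift ord0 i') by rewrite /m liftK.
  have m0 : m ord0 = conjc (\prod_i c i ord0) by rewrite /m unlift_none.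
  rewrite -mL; apply: iT => [j|].
    rewrite /m; case: unliftP => [i' ->|->] //.
    by apply: EigJ => //; apply: Eig_prod.
  rewrite big_ord_recl m0 (eq_bigr _ (fun i _ => mL i)) (eq_bigr _ (fun i _ => cl i)).
  rewrite big_split /= l1 mul1r mulrC mulcJ normc_prod big1 ?expr1n // => i' _.
  exact: Eig_normc (Ec i' ord0).
move=> i; have Tgi : \forall x \ae mu, g i (T (lift ord0 i) x) = g i x.
  by apply: filterS (Tg i (lift ord0 i)) => x; rewrite c1 mul1r.
have gc := eT _ _ Tgi; apply: (unimodular_scale_inj (g1 i)).
apply: filterS3 gc (mpres_ae (mpres_mp_fun (quotients T i)) gc) (Sg i) => x gx gSx Sgx.
by rewrite mul1r -Sgx gSx gx.
Qed.

Lemma joint_iterate_quotients k (T : 'I_k.+1 -> mp_aut mu) (g : 'I_k.+1 -> bfun X R) m :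
  commuting T -> cintegral mu (joint_iterate T g m) =
  cintegral mu (bmul (g ord0) (joint_iterate (quotients T) (fun i => g (lift ord0 i)) m)).
Proof.
move=> cT; rewrite -(cintegral_Un (T ord0) (- m)); apply: eq_cintegral => x.
rewrite UnE bprodE big_ord_recl UnE iterzN /= bprodE; congr (_ * _).
apply: eq_bigr => i _; rewrite !UnE iterz_comp ?iterz_inverse // => y.
exact: commute_inverse (cT _ _) y.
Qed.

Lemma bmul_vavg (g : bfun X R) (u : nat -> bfun X R) N :
  bmul g (vavg u N) = vavg (fun m => bmul g (u m)) N.
Proof.
apply: bfun_ext => x; rewrite -[LHS]/(g x * vavg u N x) /vavg !bfunZ !bfun_sum mulrCA mulr_sumr.
by [].
Qed.

Lemma bmulB (g u v : bfun X R) : bmul g (u - v) = bmul g u - bmul g v.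
Proof. by apply: bfun_ext => x; exact: mulrBr. Qed.

Lemma bmul_bcst (g : bfun X R) c : bmul g (bcst c) = c *: g.
Proof. by apply: bfun_ext => x; exact: mulrC. Qed.

(** Undoing the power of [T ord0] under the integral leaves [g ord0] fixed and turns the other maps
    into quotients; their strong convergence is integrated against [g ord0]. *)
Lemma weakly_joint_of_quotients k (T : 'I_k.+1 -> mp_aut mu) : commuting T ->
  joint_along (quotients T) Posz -> weakly_joint T.
Proof.
move=> cT je g; apply: vanish_sqr_inv => [N|]; first exact: normc_ge0.
have [_ [C gC]] := bfunP (g ord0).
apply: (vanish_le (vanishZ (sqr_ge0 C) (je (fun i => g (lift ord0 i))))) => N.
apply: le_trans (nrm2_bmul_le mu _ gC); apply: le_trans (sqr_normc_cintegral _).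
set u := vavg _ N.
have -> : bmul (g ord0) (u - bcst (\prod_i cintegral mu (g (lift ord0 i)))) =
    vavg (fun m => bmul (g ord0) (joint_iterate (quotients T) (fun i => g (lift ord0 i)) m%:Z)) N -
    (\prod_i cintegral mu (g (lift ord0 i))) *: g ord0.
  by rewrite bmulB bmul_vavg bmul_bcst.
rewrite cintegral_sub cintegral_vavg [in X in _ <= X]cintegral_inner formZl -cintegral_inner.
rewrite big_ord_recl mulrC (eq_favg (v := fun m => cintegral mu (joint_iterate T g m%:Z))) // => m _.
by rewrite joint_iterate_quotients.
Qed.

(** Split each [f i] into its mean and a part of mean zero. Products with a mean-zero factor average
    to 0 by [weighted_vanish] at frequency 0: eigenvalues with product 1 are all 1, and an invariant
    limit of averages of a mean-zero function is 0 by ergodicity. *)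
Lemma joint_of_weakly_joint k (T : 'I_k -> mp_aut mu) : joint_conditions T ->
  weakly_joint T -> joint_along T Posz.
Proof.
move=> [eT _ iT] wj f.
pose u i : bfun X R := f i - bcst (cintegral mu (f i)).
have u0 i : cintegral mu (u i) = 0 by rewrite cintegral_sub cintegral_cst subrr.
pose h (J : {set 'I_k}) i := if i \in J then u i else bcst (cintegral mu (f i)).
have hv J : J != finset.set0 -> vanish (fun N => nrm2 (L2 mu) (vavg (fun m => joint_iterate T (h J) m%:Z) N)).
  case/finset.set0Pn => i0 i0J.
  have := @weighted_vanish _ _ _ _ _ T (h J) 0 wj.
  rewrite (_ : (fun N => nrm2 _ (vavg (fun m => expi _ *: _) N)) =
     (fun N => nrm2 (L2 mu) (vavg (fun m => joint_iterate T (h J) m%:Z) N))); last first.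
    apply/funext => N; congr (nrm2 _ (vavg _ N)); apply/funext => m.
    by rewrite mul0r expi0 scale1r.
  apply=> s; rewrite add0r => s1; apply/not_existsP => hs.
  have Es i : Eig (T i) (expi (s i)) by apply: eigenvalue_of_averages (hs i).
  have s0 := iT _ Es (esym (etrans (esym s1) (expi_sum _ _ _))) i0.
  have [g [g0 Tg gm]] := eigenfunction_of_averages (hs i0).
  move/eqP: g0; apply; apply: nrm2_ae0.
  have {}Tg : \forall x \ae mu, g (T i0 x) = g x.
    by apply: filterS Tg => x; rewrite s0 mul1r.
  by apply: filterS (eT _ _ Tg) => x ->; apply: gm; rewrite /h i0J u0.
pose r : seq {set 'I_k} := [seq J <- index_enum _ | J != finset.set0].
have rv : vanish (fun N => (size r)%:R *
    \sum_(J <- r) nrm2 (L2 mu) (vavg (fun m => joint_iterate T (h J) m%:Z) N)).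
  apply: vanishZ => //; rewrite /r; apply: (vanish_near (vanish_sum (index_enum _) hv)).
  by apply: nearW => N; rewrite big_filter.
apply: (vanish_near rv); near=> N; have N0 : (0 < N)%N by near: N; exact: nbhs_infty_gt.
apply: le_trans (nrm2_sum_le _ _ _); rewrite le_eqVlt; apply/orP; left; apply/eqP; congr nrm2.
have expand m : joint_iterate T f m%:Z = \sum_(J <- r) joint_iterate T (h J) m%:Z
    + bcst (\prod_i cintegral mu (f i)).
  apply: bfun_ext => x; rewrite bfunD bfun_sum big_filter bprodE.
  rewrite (eq_bigr (fun i => Un (T i) m%:Z (u i) x + cintegral mu (f i))); last first.
    by move=> i _; rewrite [X in X + _]bfunB subrK.
  rewrite bigA_distr (bigD1 finset.set0) //= addrC /=; congr (_ + _).
    apply: eq_bigr => J _; rewrite bprodE; apply: eq_bigr => i _.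
    by rewrite /h; case: ifP.
  by apply: eq_bigr => i _; rewrite inE.
rewrite /vavg -scaler_sumr exchange_big /= (eq_bigr _ (fun m _ => expand m)) big_split scalerDr /=.
rewrite -addrA [X in _ + X](_ : _ = 0) ?addr0 //; apply/eqP; rewrite subr_eq0; apply/eqP.
apply: bfun_ext => x; rewrite bfunZ bfun_sum.
rewrite (eq_bigr (fun=> (\prod_i cintegral mu (f i)) * 1)) => [|n _]; last by rewrite mulr1.
by rewrite -mulr_sumr mulrCA -[X in _ * X]/(favg (fun=> 1) N) favg_cst1 // mulr1.
Unshelve. all: by end_near. Qed.

Lemma joint_of_conditions k (T : 'I_k -> mp_aut mu) : commuting T -> joint_conditions T ->
  joint_along T Posz.
Proof.
elim: k T => [|k IHk] T cT hT; last first.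
  apply: joint_of_weakly_joint => //; apply: weakly_joint_of_quotients => //.
  by apply: IHk; [exact: commuting_quotients|exact: cond_quotients].
apply: joint_of_weakly_joint => // g e e0; near=> N.
have N0 : (0 < N)%N by near: N; exact: nbhs_infty_gt.
rewrite (@eq_favg _ _ (fun=> 1)) => [|m _]; last first.
  by rewrite /joint_iterate /bprod big_ord0; exact: cintegral_cst.
by rewrite favg_cst1 // big_ord0 subrr normc0E ltW.
Unshelve. all: by end_near. Qed.

Lemma joint_inverse k (T : 'I_k -> mp_aut mu) : commuting T -> joint_along T Posz ->
  joint_along (fun i => mp_inverse (T i)) Posz.
Proof.
move=> cT je; have cinv i j x : T i (mp_inv (T j) x) = mp_inv (T j) (T i x).
  exact: commute_inverse (cT i j) x.
apply: joint_of_conditions.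
  move=> i j x /=; apply: (can_inj (mp_funK (T i))).
  by rewrite mp_invK cinv mp_invK.
split=> [i|i j ij|l El l1 i].
- exact: ergodic_inverse (@ergodic_of_joint _ _ _ _ _ _ je i).
- apply: (@ergodic_ext _ _ _ _ (mp_comp (T j) (mp_inverse (T i)))).
    by move=> x /=; rewrite cinv.
  by apply: ergodic_pair_of_joint => //; rewrite eq_sym.
have Einv j : Eig (T j) (l j)^-1 by exact: Eig_inverseE.
have := independent_Eig_of_joint je Einv; rewrite prodfV l1 invr1 => /(_ erefl i) h.
by rewrite -[l i]invrK h invr1.
Qed.

End Sufficient_conditions.

(** * Almost periodic weights orthogonal to given frequencies *)

Section Weights.
Context {R : realType}.
Variable M : nat -> nat.
Hypothesis M_infty : forall A, \forall N \near \oo, (A <= M N)%N.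

Lemma vanish_subseq (a : nat -> R) : vanish a -> vanish (fun N => a (M N)).
Proof.
move=> va e e0; have [A _ hA] := va e e0.
by apply: filterS (M_infty A) => N; exact: hA.
Qed.

Lemma favg_conj (u : nat -> R[i]) N : favg (fun n => conjc (u n)) N = conjc (favg u N).
Proof. by rewrite /favg conjcM conjc_natV conjc_sum. Qed.

(* The frequencies in [bad] are orthogonal to [w], so dropping them from a trigonometric
   approximation of [w] does not increase the mean square error in the limit. *)
Lemma good_approximation (w : nat -> R[i]) (bad : R -> Prop) :
  bap w ->
  (forall t s, bad t -> expi t = expi s -> bad s) ->
  (forall t, bad t -> vanish (fun N => normc (favg (fun m => w m * expi (- t * m%:R)) (M N)))) ->
  forall e, 0 < e -> exists K (c : nat -> R[i]) (t : nat -> R),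
    (forall i, bad (t i) -> c i = 0) /\
    \forall N \near \oo,
      favg (fun m => normc (w m - \sum_(i < K) c i * expi (t i * m%:R)) ^+ 2) (M N) <= e.
Proof.
move=> bw bad_ext bad0 e e0; have e2 : 0 < e / 2 by rewrite divr_gt0.
have [p [K [c [t pE]]] wp] := bw _ e2.
pose g i := if `[< bad (t i) >] then 0 else c i.
pose b i := if `[< bad (t i) >] then c i else 0.
exists K, g, t; split=> [i bi|]; first by rewrite /g (asboolT bi).
pose pg m := \sum_(i < K) g i * expi (t i * m%:R).
pose pb m := \sum_(i < K) b i * expi (t i * m%:R).
have pgb m : p m = pg m + pb m.
  rewrite pE /pg /pb -big_split /=; apply: eq_bigr => i _; rewrite -mulrDl /g /b.
  by case: asboolP => _; rewrite ?add0r ?addr0.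
(* This involves means of [w] against bad frequencies, null by hypothesis, and of good against bad
   frequencies, null because the difference is a nontrivial character. *)
have cross : vanish (fun N => 2 * normc (favg (fun m => (w m - pg m) * conjc (pb m)) (M N))).
  apply: vanishZ => //.
  pose err i N := normc (favg (fun m => w m * expi (- t i * m%:R)) (M N)) +
    \sum_(j < K) normc (g j) * normc (favg (fun m => expi ((t j - t i) * m%:R)) (M N)).
  have verr : vanish (fun N => \sum_(i < K) normc (b i) * err i N).
    apply: (vanish_sum (index_enum _)) => i _.
    have [bi|nbi] := pselect (bad (t i)); last first.
      by apply: (vanish_le vanish0) => N; rewrite /b asboolF // normc0E mul0r.
    apply: vanishZ; first exact: normc_ge0.
    apply: vanishD; first exact: bad0.
    apply: (vanish_sum (index_enum _)) => j _.
    have [bj|nbj] := pselect (bad (t j)).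
      by apply: (vanish_le vanish0) => N; rewrite /g asboolT // normc0E mul0r.
    apply: vanishZ; first exact: normc_ge0.
    apply: (vanish_subseq (a := fun N => normc (favg (fun m => expi ((t j - t i) * m%:R)) N))).
    apply: vanish_expi; apply/eqP => tji; apply: nbj; apply: (bad_ext (t i)) => //.
    by rewrite -[t j](subrK (t i)) expiD tji mul1r.
  apply: (vanish_le verr) => N.
  have -> : favg (fun m => (w m - pg m) * conjc (pb m)) (M N) = \sum_(i < K) conjc (b i) *
      (favg (fun m => w m * expi (- t i * m%:R)) (M N) -
       \sum_(j < K) g j * favg (fun m => expi ((t j - t i) * m%:R)) (M N)).
    rewrite (@eq_favg _ _ (fun m => \sum_(i < K) conjc (b i) * (w m * expi (- t i * m%:R) -
       \sum_(j < K) g j * expi ((t j - t i) * m%:R)))).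
      rewrite favg_sum; apply: eq_bigr => i _; rewrite favgZ; congr (_ * _).
      rewrite /favg sumrB mulrBr; congr (_ - _); rewrite -/(favg _ _) -/(favg _ _).
      rewrite -[LHS]/(favg (fun m => \sum_(j < K) g j * expi ((t j - t i) * m%:R)) (M N)).
      by rewrite favg_sum; apply: eq_bigr => j _; rewrite favgZ.
    move=> m _; rewrite conjc_sum mulr_sumr; apply: eq_bigr => i _.
    rewrite conjcM -expiN mulrCA; congr (_ * _); rewrite mulrBl mulNr; congr (_ - _).
    rewrite mulr_suml; apply: eq_bigr => j _; rewrite -mulrA -expiD; congr (_ * expi _).
    by rewrite mulrBl.
  apply: le_trans (normc_sum _ _ _) _; apply: ler_sum => i _.
  rewrite ComplexField.Normc.normcM normc_conj ler_wpM2l ?normc_ge0 //.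
  apply: le_trans (le_normcD _ _) _; rewrite normcN lerD2l.
  apply: le_trans (normc_sum _ _ _) _; apply: ler_sum => j _.
  by rewrite ComplexField.Normc.normcM.
have wpM : \forall N \near \oo, favg (fun n => normc (w n - p n) ^+ 2) (M N) <= e / 2.
  have [A _ hA] := wp; by apply: filterS (M_infty A) => N; exact: hA.
apply: filterS2 wpM (cross _ e2) => N h1 h2.
rewrite (splitr e); apply: (le_trans _ (lerD h1 h2)).
(* Used with [z = w - pg] and [y = pb]: the mean square error of [pg] exceeds that of [p] by at most
   the cross term. *)
have key (z : R[i]) (y : R[i]) : normc z ^+ 2 <= normc (z - y) ^+ 2 + 2 * complex.Re (z * conjc y).
  by case: z y => a a' [f f']; rewrite !sqr_normcE /=; nra.
apply: le_trans (_ : favg (fun m => normc (w m - p m) ^+ 2 +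
    2 * complex.Re ((w m - pg m) * conjc (pb m))) (M N) <= _).
  apply: ler_favg => m _; apply: le_trans (key _ (pb m)) _.
  by rewrite pgb opprD addrA.
rewrite favgD lerD2l favgZ -Re_favg ler_wpM2l //; exact: ler_Re.
Qed.

End Weights.

(** * Averages of functions with almost periodic weights *)

Lemma truncn_ge_half (R : realType) (x : R) : 2 <= x -> x / 2 <= (Num.truncn x)%:R.
Proof. by have := Num.Theory.truncnS_gt x; rewrite -natr1; lra. Qed.

Section Weighted_averages_of_functions.
Context {d : measure_display} {X : measurableType d} {R : realType} {mu : probability X R}.

Lemma vavg_trigpoly (G : nat -> bfun X R) K (c : nat -> R[i]) (t : nat -> R) N :
  vavg (fun m => (\sum_(i < K) c i * expi (t i * m%:R)) *: G m) N =
  \sum_(i < K) c i *: vavg (fun m => expi (t i * m%:R) *: G m) N.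
Proof.
rewrite /vavg (eq_bigr (fun m => \sum_(i < K) (c i * expi (t i * m%:R)) *: G m)); last first.
  by move=> m _; rewrite scaler_suml.
rewrite exchange_big scaler_sumr; apply: eq_bigr => i _.
rewrite scalerA [c i * _]mulrC -scalerA; congr (_ *: _).
by rewrite scaler_sumr; apply: eq_bigr => m _; rewrite scalerA.
Qed.

(** Replace [w] by a trigonometric polynomial without bad frequencies: each remaining frequency
    averages to 0, and the error is small in mean square while [G] is bounded. *)
Lemma vavg_weighted_vanish (M : nat -> nat) (w : nat -> R[i]) (bad : R -> Prop)
    (G : nat -> bfun X R) (B : R) :
  (forall A, \forall N \near \oo, (A <= M N)%N) -> bap w ->
  (forall t s, bad t -> expi t = expi s -> bad s) ->
  (forall t, bad t -> vanish (fun N => normc (favg (fun m => w m * expi (- t * m%:R)) (M N)))) ->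
  (forall m x, normc (G m x) <= B) ->
  (forall t, ~ bad t -> vanish (fun N => nrm2 (L2 mu) (vavg (fun m => expi (t * m%:R) *: G m) N))) ->
  vanish (fun N => nrm2 (L2 mu) (vavg (fun m => w m *: G m) (M N))).
Proof.
move=> Moo bw bad_ext bad0 GB good; apply: vanish_approx => e e0.
have B1 : 0 < 2 * (B ^+ 2 + 1) by rewrite mulr_gt0 // ltr_wpDl ?sqr_ge0.
have [K [c [t [cbad hp]]]] := good_approximation Moo bw bad_ext bad0 (divr_gt0 e0 B1).
pose p m := \sum_(i < K) c i * expi (t i * m%:R).
exists (fun N => 2 * nrm2 (L2 mu) (vavg (fun m => p m *: G m) (M N))).
  apply: vanishZ => //.
  pose s N i := nrm2 (L2 mu) (c i *: vavg (fun m => expi (t i * m%:R) *: G m) (M N)).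
  apply: (vanish_le (b := fun N => (size (index_enum 'I_K))%:R * \sum_(i < K) s N i)) => [|N].
    apply: vanishZ => //; apply: (vanish_sum (index_enum _)) => i _.
    have [/cbad c0|nb] := pselect (bad (t i)).
      by apply: (vanish_le vanish0) => N; rewrite /s c0 scale0r nrm2_0.
    rewrite /s; under eq_fun do rewrite nrm2Z.
    by apply: vanishZ; [exact: sqr_ge0|apply: (vanish_subseq Moo (good _ nb))].
  by rewrite vavg_trigpoly; exact: nrm2_sum_le.
apply: filterS hp => N hN.
have -> : vavg (fun m => w m *: G m) (M N) =
    vavg (fun m => p m *: G m) (M N) + vavg (fun m => (w m - p m) *: G m) (M N).
  rewrite /vavg -scalerDr -big_split /=; congr (_ *: _); apply: eq_bigr => m _.
  by rewrite -scalerDl addrC subrK.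
apply: le_trans (nrm2D_le _ _ _) _; rewrite lerD2l.
have h : nrm2 (L2 mu) (vavg (fun m => (w m - p m) *: G m) (M N)) <=
    B ^+ 2 * (e / (2 * (B ^+ 2 + 1))).
  apply: le_trans (nrm2_vavg _ _ _) _; apply: le_trans (ler_wpM2l (sqr_ge0 B) hN).
  rewrite -favgZ; apply: ler_favg => m _; rewrite nrm2Z mulrC ler_wpM2r ?sqr_ge0 //.
  exact: nrm2_le.
apply: le_trans (ler_wpM2l _ h) _ => //.
have -> : 2 * (B ^+ 2 * (e / (2 * (B ^+ 2 + 1)))) = e * (B ^+ 2 / (B ^+ 2 + 1)).
  by field; rewrite gt_eqF // ltr_wpDl ?sqr_ge0.
rewrite ler_piMr ?(ltW e0) // ler_pdivrMr ?mul1r ?lerDl //.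
by rewrite ltr_wpDl ?sqr_ge0.
Qed.

Lemma truncn_infty (a : R) : 0 < a ->
  forall A, \forall N \near \oo, (A <= Num.truncn (a * N%:R))%N.
Proof.
move=> a0 A; near=> N.
have : A%:R / a <= N%:R by near: N; exact: nbhs_infty_ger.
rewrite ler_pdivrMr // mulrC => h.
rewrite Num.Theory.truncn_ge_nat //; by rewrite mulr_ge0 ?(ltW a0).
Unshelve. all: by end_near. Qed.

(* Averages along [phi] are averages of [G] itself weighted by the number of [n] that
   [phi] maps to a given integer. *)
Lemma vavg_along (phi : int -> int) (f : R -> R) (a C : R) (G : int -> bfun X R) (B : R)
    (bad : R -> Prop) :
  gen_linear f -> (forall n : int, f n%:~R = (phi n)%:~R) -> 0 < a ->
  (forall x, `|f x - a * x| <= C) ->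
  (forall t s, bad t -> expi t = expi s -> bad s) ->
  (forall t, bad t -> vanish (fun N => normc (favg (fun n => expi (- t * (phi n%:Z)%:~R)) N))) ->
  (forall m x, normc (G m x) <= B) ->
  (forall t, ~ bad t -> vanish (fun N => nrm2 (L2 mu) (vavg (fun m => expi (t * m%:R) *: G m%:Z) N))) ->
  vanish (fun N => nrm2 (L2 mu) (vavg (fun n => G (phi n%:Z)) N)).
Proof.
move=> gf fphi a0 fC bad_ext bad0 GB good.
have phiC n : `|(phi n)%:~R - a * n%:~R| <= C by rewrite -fphi.
have [J [K hJK]] := fiber_sum_approx a0 phiC.
pose w m : R[i] := (fiber_count phi a J m)%:R.
pose M N := Num.truncn (a * N%:R).
have Moo := truncn_infty a0.
have B0 (x : X) : 0 <= B := le_trans (normc_ge0 _) (GB 0 x).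
(* The mean of [w] against a character is, up to a boundary term, a bounded multiple of the mean of
   this character along [phi], because [M N] is comparable to [N]. *)
have badM t : bad t ->
    vanish (fun N => normc (favg (fun m => w m * expi (- t * m%:R)) (M N))).
  move=> bt.
  have a2 : 0 <= 2 / a by rewrite divr_ge0 // ltW.
  apply: (vanish_near (vanishZ a2 (vanishD (bad0 t bt) (vanish_invn K%:R)))).
  near=> N.
  have N0 : 0 < N%:R :> R by near: N; exact: nbhs_infty_gtr.
  have aN : 2 <= a * N%:R.
    have : 2 / a <= N%:R by near: N; exact: nbhs_infty_ger.
    by rewrite ler_pdivrMr // mulrC.
  have MN : a * N%:R / 2 <= (M N)%:R.
    exact: truncn_ge_half.
  have aN2 : 0 < a * N%:R / 2 by rewrite divr_gt0 // mulr_gt0.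
  have M0 : 0 < (M N)%:R :> R by apply: lt_le_trans MN.
  have n1 (m : int) : normc (expi (- t * m%:~R)) <= 1 by rewrite normc_expi.
  have hs := hJK (fun m => expi (- t * m%:~R)) 1 N n1.
  rewrite mulr1 in hs.
  set S1 := \sum_(1 <= n < N.+1) _ in hs; set S2 := \sum_(1 <= m < _) _ in hs.
  have -> : favg (fun m => w m * expi (- t * m%:R)) (M N) = (M N)%:R^-1 * S2 by [].
  have -> : favg (fun n => expi (- t * (phi n%:Z)%:~R)) N = N%:R^-1 * S1 by [].
  rewrite !ComplexField.Normc.normcM !normc_natV.
  have S2le : normc S2 <= normc S1 + K%:R.
    rewrite -[S2](subrK S1) addrC; apply: le_trans (le_normcD _ _) _.
    by rewrite lerD2l normcB_comm.
  have Minv : (M N)%:R^-1 <= 2 / a * N%:R^-1.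
    have -> : 2 / a * N%:R^-1 = (a * N%:R / 2)^-1 by rewrite !invfM invrK [RHS]mulrC mulrA.
    by rewrite lef_pV2 ?posrE.
  apply: le_trans (ler_pM _ _ Minv S2le) _; rewrite ?invr_ge0 ?normc_ge0 //.
  by rewrite [K%:R / _]mulrC -mulrDr mulrA.
have bw : bap w by apply: (fiber_count_bap J gf fphi a0); exists C.
have wG := vavg_weighted_vanish Moo bw bad_ext badM (fun m => GB m%:Z) good.
have van : vanish (fun N => 2 * (a ^+ 2 * nrm2 (L2 mu) (vavg (fun m => w m *: G m%:Z) (M N))) +
    2 * ((K%:R * `|B|) * N%:R^-1) ^+ 2).
  apply: vanishD; apply: vanishZ => //; first by apply: vanishZ; [exact: sqr_ge0|].
  apply: vanish_sqr => [N|]; first by rewrite !mulr_ge0 ?invr_ge0.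
  exact: vanish_invn.
apply: (vanish_near van); near=> N.
have N0 : 0 < N%:R :> R by near: N; exact: nbhs_infty_gtr.
have M1 : (0 < M N)%N by near: N; exact: (Moo 1%N).
have M0 : 0 < (M N)%:R :> R by rewrite ltr0n.
have aM : (M N)%:R <= a * N%:R by rewrite Num.Theory.truncn_le mulr_ge0 // ltW.
set V := vavg (fun m => w m *: G m%:Z) (M N).
pose r : R := (M N)%:R / N%:R.
have -> : vavg (fun n => G (phi n%:Z)) N = r%:C *: V + (vavg (fun n => G (phi n%:Z)) N - r%:C *: V).
  by rewrite addrC subrK.
apply: le_trans (nrm2D_le _ _ _) _; apply: lerD; apply: ler_wpM2l => //.
  rewrite nrm2Z normc_real; apply: ler_wpM2r; first exact: nrm2_ge0.
  rewrite lerXn2r ?nnegrE //; first exact: ltW.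
  by rewrite ger0_norm ?divr_ge0 // ler_pdivrMr.
apply: nrm2_le => x.
have rM : r%:C * (M N)%:R^-1 = N%:R^-1 :> R[i].
  rewrite -[(M N)%:R]/((M N)%:R) -(rmorph_nat (real_complex R) (M N)) -fmorphV -rmorphM.
  rewrite -(rmorph_nat (real_complex R) N) -fmorphV; congr (_%:C); rewrite /r.
  by field; rewrite !gt_eqF.
rewrite bfunB bfunZ /V /vavg !bfunZ !bfun_sum mulrA rM -mulrBr ComplexField.Normc.normcM normc_natV.
rewrite mulrC ler_wpM2r ?invr_ge0 //.
apply: le_trans (_ : K%:R * B <= _); last by rewrite ler_wpM2l // ler_norm.
exact: (hJK (fun m => G m x) B N (fun m => GB m x)).
Unshelve. all: by end_near. Qed.

End Weighted_averages_of_functions.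

(** * The eigenvalue criterion along a generalized linear sequence *)

Section Along_generalized_linear.
Context {d : measure_display} {X : measurableType d} {R : realType} {mu : probability X R}.

Lemma normc_cvg0 (u : nat -> R[i]) :
  (u N @[N --> \oo] --> (0 : R[i]^o)) <-> vanish (fun N => normc (u N)).
Proof.
have [dist_of_cvg cvg_of_dist] := @cvgrPdist_le R[i] R[i]^o nat \oo _ u 0; split.
  move=> /dist_of_cvg h e e0; have e0' : 0 < e%:C by rewrite ltcR.
  apply: filterS (h _ e0') => N.
  by rewrite sub0r normrN -[`|u N|]/((normc (u N))%:C) lecR.
move=> h; apply: cvg_of_dist => e e0.
have [er e1] : 0 < complex.Re e /\ e = (complex.Re e)%:C.
  by move: e0; case: e => a b; rewrite ltcE /= => /andP[/eqP -> ?].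
apply: filterS (h _ er) => N; rewrite sub0r normrN e1 => hN.
by rewrite -[`|u N|]/((normc (u N))%:C) lecR.
Qed.

Context {k : nat}.

Lemma unimodular_family (T : 'I_k -> mp_aut mu) (l : 'I_k -> R[i]) :
  (forall i, ergodic (T i)) -> (forall i, Eig (T i) (l i)) ->
  exists g : 'I_k -> bfun X R, (forall i x, normc (g i x) = 1) /\
    forall i, \forall x \ae mu, g i (T i x) = l i * g i x.
Proof.
move=> eT El; have gE i := ergodic_Eig (eT i) (El i).
exists (fun i => sval (cid2 (gE i))); split=> i; by case: (cid2 _).
Qed.

(** On unimodular eigenfunctions the average along [phi] is [power_avg l phi] times a function of
    modulus 1; the limit is 0 because a factor with eigenvalue other than 1 has mean 0. *)
Lemma power_avg_of_joint_along (T : 'I_k -> mp_aut mu) (phi : int -> int) (l : R[i]) :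
  joint_along T Posz -> joint_along T (fun n => phi n%:Z) -> joint_Eig T l -> l != 1 ->
  vanish (fun N => normc (power_avg l phi N)).
Proof.
move=> je jphi [m El lE] l1.
have [g [g1 Tg]] := unimodular_family (@ergodic_of_joint _ _ _ _ _ _ je) El.
have [i mi] : exists i, m i != 1.
  apply/not_existsP => m1; move/eqP: l1; apply; rewrite -lE big1 // => i _.
  by apply/eqP/negPn/negP; exact: m1.
have g0 : \prod_j cintegral mu (g j) = 0.
  by rewrite (bigD1 i) //= (eigenfunction_cintegral (Tg i) mi) mul0r.
apply: vanish_sqr_inv => [N|]; first exact: normc_ge0.
apply: (vanish_le (jphi g)) => N; rewrite g0.
have -> : nrm2 (L2 mu) (vavg (fun n => joint_iterate T g (phi n%:Z)) N - bcst 0) =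
    nrm2 (L2 mu) (power_avg l phi N *: bprod g).
  apply: nrm2_ae_eq.
  have h n := joint_iterate_eigen (phi (Posz n)) (fun j => (El j).1) Tg.
  apply: filterS (ae_foralln h) => x hx.
  rewrite bfunB [X in _ - X]/(0 : R[i]) subr0 bfunZ /vavg bfunZ bfun_sum /power_avg -mulrA.
  rewrite mulr_suml; congr (_ * _); apply: eq_bigr => n _.
  by rewrite hx lE.
rewrite nrm2Z unimodular_nrm2 ?mulr1 // => x.
by rewrite bprodE normc_prod big1.
Qed.

(** [vavg_along] is applied to the joint orbit minus its expected limit. The hypothesis on
    [power_avg] takes care of the bad frequencies. For the others, either the character is trivial
    and joint ergodicity of [T] applies, or [expi (- t)] is no joint eigenvalue and
    [weighted_vanish] applies. *)
Lemma joint_along_positive_slope (T : 'I_k -> mp_aut mu) (phi : int -> int) (f : R -> R) (a C : R) :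
  joint_along T Posz -> gen_linear f -> (forall n : int, f n%:~R = (phi n)%:~R) ->
  0 < a -> (forall x, `|f x - a * x| <= C) ->
  (forall l, joint_Eig T l -> l != 1 -> vanish (fun N => normc (power_avg l phi N))) ->
  joint_along T (fun n => phi n%:Z).
Proof.
move=> je gf fphi a0 fC pow h.
pose c := \prod_i cintegral mu (h i).
pose G m := joint_iterate T h m - bcst c.
pose bad t := expi t != 1 /\ joint_Eig T (expi (- t)).
have Ginfo : exists B, forall m x, normc (G m x) <= B.
  have [D D1 hD] := common_bound h.
  exists (D ^+ k + normc c) => m x; rewrite bfunB; apply: le_trans (le_normcD _ _) _.
  rewrite normcN lerD2r bprodE normc_prod -[X in D ^+ X](card_ord k) -prodr_const.
  by apply: ler_prod => i _; rewrite normc_ge0 UnE hD.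
have [B GB] := Ginfo.
have avgG (u : nat -> int) N : (0 < N)%N ->
    vavg (fun n => G (u n)) N = vavg (fun n => joint_iterate T h (u n)) N - bcst c.
  move=> N0; rewrite -vavgB; congr (_ - _); apply: bfun_ext => x.
  rewrite /vavg bfunZ bfun_sum (eq_bigr (fun=> c * 1)) => [|n _]; last by rewrite mulr1.
  by rewrite -mulr_sumr mulrCA -[X in _ * X]/(favg (fun=> 1) N) favg_cst1 // mulr1.
have hG : vanish (fun N => nrm2 (L2 mu) (vavg (fun n => G (phi n%:Z)) N)).
  apply: (@vavg_along _ _ _ _ phi f a C G B bad) => //.
  - by move=> t s [t1 Et] ts; split; rewrite -?ts // expiN -ts -expiN.
  - move=> t [t1 Et]; have := pow _ Et; have -> : expi (- t) != 1 by apply: contra t1 => /eqP e1; rewrite -[t]opprK expiN e1 conjc1.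
    move=> /(_ isT) hp; apply: (vanish_le hp) => N; rewrite /power_avg /favg.
    by under [X in _ <= normc (_ * X)]eq_bigr => n _ do rewrite expiXz.
  move=> t nbad; have [t1|t1] := eqVneq (expi t) 1.
    have hj := je h; apply: (vanish_near hj); near=> N.
    have N0 : (0 < N)%N by near: N; exact: nbhs_infty_gt.
    rewrite -(avgG Posz) //; rewrite le_eqVlt; apply/orP; left; apply/eqP; congr (nrm2 _ (vavg _ N)).
    by apply/funext => m; rewrite -expiX t1 expr1n scale1r.
  have wj := weakly_joint_of_joint je.
  have w1 : vanish (fun N => nrm2 (L2 mu) (vavg (fun m => expi (t * m%:R) *: joint_iterate T h m%:Z) N)).
    apply: weighted_vanish => // s s1; apply/not_existsP => hs; apply: nbad; split=> //.
    have Es i : Eig (T i) (expi (s i)) by apply: eigenvalue_of_averages (hs i).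
    exists (fun i => expi (s i)) => //; rewrite -expi_sum.
    by rewrite -[\sum_i s i](addKr t) expiD s1 mulr1.
  have w2 : vanish (fun N => nrm2 (L2 mu) (vavg (fun m => expi (t * m%:R) *: bcst c) N)).
    have := vanish_sqr (fun N => normc_ge0 _) (vanish_expi t1).
    move=> /(vanishZ (nrm2_ge0 (L2 mu) (bcst c))) h2; apply: (vanish_le h2) => N.
    by rewrite /vavg -scaler_suml scalerA nrm2Z mulrC.
  apply: (vanish_le (vanishD (vanishZ (ler0n _ 2) w1) (vanishZ (ler0n _ 2) w2))) => N.
  have -> : vavg (fun m => expi (t * m%:R) *: G m%:Z) N =
      vavg (fun m => expi (t * m%:R) *: joint_iterate T h m%:Z) N -
      vavg (fun m => expi (t * m%:R) *: bcst c) N.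
    by rewrite vavgB; congr (vavg _ N); apply/funext => m; rewrite scalerBr.
  by apply: le_trans (nrm2D_le _ _ _) _; rewrite nrm2N.
apply: (vanish_near hG); near=> N.
have N0 : (0 < N)%N by near: N; exact: nbhs_infty_gt.
by rewrite avgG.
Unshelve. all: by end_near. Qed.

Lemma joint_along_inverse (T : 'I_k -> mp_aut mu) (u : nat -> int) :
  joint_along T u <-> joint_along (fun i => mp_inverse (T i)) (fun n => - u n).
Proof.
have E f n : joint_iterate (fun i => mp_inverse (T i)) f (- u n) = joint_iterate T f (u n).
  by apply: bfun_ext => x; rewrite !bprodE; apply: eq_bigr => i _; rewrite !UnE iterz_inverse opprK.
have Ef f : (fun n => joint_iterate (fun i => mp_inverse (T i)) f (- u n)) =
    (fun n => joint_iterate T f (u n)) by apply/funext => n; exact: E.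
by split=> h f; apply: (vanish_le (h f)) => N; rewrite Ef.
Qed.

(** A zero slope would make [phi] bounded. A negative one is reversed by passing to the inverses of
    the [T i] and to [- phi], which replaces each eigenvalue by its inverse. *)
Lemma joint_along_gen_linear (T : 'I_k -> mp_aut mu) (phi : int -> int) :
  commuting T -> joint_along T Posz -> gen_linear_int R phi -> unbounded phi ->
  (forall l, joint_Eig T l -> l != 1 -> vanish (fun N => normc (power_avg l phi N))) ->
  joint_along T (fun n => phi n%:Z).
Proof.
move=> cT je [f gf fphi] unb pow; have [a [C fC]] := gen_linear_slope gf.
case: (ltgtP a 0) => [a0|a0|a0]; last 1 first.
- exfalso; apply: unb; exists (Num.ceil C) => n.
  have := fC n%:~R; rewrite a0 mul0r subr0 fphi => h.
  by rewrite -(ler_int R) intr_norm (le_trans h) // Num.Theory.ceil_ge.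
- apply/joint_along_inverse.
  apply: (@joint_along_positive_slope _ (fun n => - phi n) (fun x => -1 * f x) (- a) C).
  + exact: joint_inverse.
  + exact: gen_linear_scale.
  + by move=> n; rewrite fphi mulN1r intrN.
  + by rewrite oppr_gt0.
  + by move=> x; rewrite mulN1r mulNr -opprD normrN.
  move=> l [m Em lE] l1.
  have El : joint_Eig T l^-1.
    exists (fun i => (m i)^-1); first by move=> i; exact: Eig_inverseE.
    by rewrite prodfV lE.
  have := pow _ El; rewrite invr_eq1 => /(_ l1) h; apply: (vanish_le h) => N.
  rewrite /power_avg.
  by under [X in _ <= normc (_ * X)]eq_bigr => n _ do rewrite exprz_inv.
exact: (joint_along_positive_slope je gf fphi a0 fC pow).
Qed.

End Along_generalized_linear.

(** * Fejér approximation along the multiples of an irrational number *)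

Section Floor_of_multiples.
Context {R : realType}.
Implicit Types (alpha s t : R).

Lemma irrational_mul_int alpha (p m : int) : irrational alpha -> p != 0 ->
  alpha * p%:~R = m%:~R -> False.
Proof.
move=> irr p0 e; apply: irr; exists (m%:~R / p%:~R) => //.
rewrite fmorph_div !rmorph_int -e mulfK //.
by rewrite intr_eq0.
Qed.

Lemma irrational_neq0 alpha : irrational alpha -> alpha != 0.
Proof.
move=> irr; apply/eqP => a0; apply: (@irrational_mul_int alpha 1 0 irr) => //.
by rewrite a0 mul0r.
Qed.

Lemma expi_floor t x : expi t ^ Num.floor x = expi (t * x) * expi (- t * frac x).
Proof. by rewrite expiXz -expiD /frac; congr expi; ring. Qed.

Lemma floor_half (x : R) :
  Num.floor (x + 1 / 2) = Num.floor x \/ Num.floor (x + 1 / 2) = Num.floor x + 1.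
Proof.
have /andP[f1 f2] := floor_itv x; have /andP[g1 g2] := floor_itv (x + 1 / 2).
move: f1 f2 g1 g2; move: (Num.floor x) (Num.floor (x + 1 / 2)) => i j f1 f2 g1 g2.
have h1 : (i%:~R : R) < (j + 1)%:~R by lra.
have h2 : (j%:~R : R) < (i + 1 + 1)%:~R by move: f1 f2 g1 g2; rewrite !intrD; lra.
by move: h1 h2; rewrite !ltr_int; clear; lia.
Qed.

(** By irrationality [alpha * n] is never an integer for [n > 0], so every point close to an integer
    is counted by [gen_linear_small_density]; elsewhere [fejer_approx] applies. *)
Lemma fejer_density_approx alpha t e : irrational alpha -> 0 < e ->
  exists2 N, (0 < N)%N & \forall L \near \oo,
    favg (fun n => normc (fejer t N (alpha * n%:R) - expi (- t * frac (alpha * n%:R)))) L <= e.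
Proof.
move=> irr e0; pose v x := alpha * x - (Num.floor (alpha * x + 1 / 2))%:~R.
have gv : gen_linear v.
  apply: gen_linear_sub; last by apply: gen_linear_floor; exact: gen_linear_affine.
  have := gen_linear_affine alpha 0; congr gen_linear; apply/funext => x; exact: addr0.
have e4 : 0 < e / 4 by rewrite divr_gt0.
have [d d0 hd] := gen_linear_small_density gv e4.
have t1 : 0 < `|t| + 1 by rewrite ltr_wpDl.
pose a := Num.min (Num.min d (1 / 2)) (e / 4 / (`|t| + 1)).
have a0 : 0 < a by rewrite !lt_min d0 !divr_gt0.
have ad : a <= d by rewrite /a !ge_min lexx.
have a2 : a <= 1 / 2 by rewrite /a !ge_min lexx orbT.
have at_ : `|t| * a <= e / 4.
  have : a <= e / 4 / (`|t| + 1) by rewrite /a ge_min lexx orbT.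
  rewrite ler_pdivlMr // mulrDr mulr1 mulrC => h; apply: le_trans h.
  by rewrite lerDl ltW.
pose D := 8 / (2 - 2 * cos (2 * pi * a)).
have D0 : 0 < D.
  have : cos (2 * pi * a) < 1 by apply: cos_2pi_lt1; rewrite a0.
  by move=> c1; rewrite divr_gt0 //; move: c1; lra.
pose N := (Num.truncn (D / (e / 4))).+1.
have DN : D / N%:R <= e / 4.
  rewrite ler_pdivrMr ?ltr0n // mulrC -ler_pdivrMr //.
  exact/ltW/Num.Theory.truncnS_gt.
exists N => //; apply: filterS hd => L hL.
have bound n : (0 < n)%N ->
    normc (fejer t N (alpha * n%:R) - expi (- t * frac (alpha * n%:R))) <=
    e / 2 * 1 + 2 * (0 < `|v n%:R| < d)%R%:R.
  move=> n0; set x := alpha * n%:R.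
  have vE : v n%:R = x - (Num.floor (x + 1 / 2))%:~R by [].
  have vN0 : v n%:R != 0.
    rewrite vE subr_eq0; apply/eqP => xe.
    apply: (@irrational_mul_int alpha n (Num.floor (x + 1 / 2)) irr) => //.
    by rewrite -lt0n.
  have b2 : normc (fejer t N x - expi (- t * frac x)) <= 2.
    apply: le_trans (le_normcD _ _) _; rewrite normcN normc_expi.
    by have := normc_fejer t N x; lra.
  rewrite normr_gt0 vN0 /=; case: ltP => dv; last first.
    rewrite mulr0 addr0 mulr1; have fx : a <= frac x <= 1 - a.
      move: dv; rewrite vE /frac; have /andP[f1 f2] := floor_itv x.
      have /andP[g1 g2] := floor_itv (x + 1 / 2).
      have [fl|fl] := floor_half x.
      - rewrite fl => dv; rewrite fl in g1 g2; move: f1 f2 g1 g2 dv; rewrite !intrD.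
        move: (Num.floor x)%:~R => y f1 f2 g1 g2.
        rewrite ger0_norm; lra.
      rewrite fl => dv; rewrite fl in g1 g2; move: f1 f2 g1 g2 dv; rewrite !intrD.
      move: (Num.floor x)%:~R => y f1 f2 g1 g2.
      rewrite ler0_norm; lra.
    have := fejer_approx t (isT : (0 < N)%N) a0 fx; rewrite -/D; move: DN at_; lra.
  by apply: le_trans b2 _; rewrite !mulr1 lerDr ltW // divr_gt0.
apply: le_trans (_ : favg (fun n => e / 2 * 1 + 2 * (0 < `|v n%:R| < d)%R%:R) L <= _).
  rewrite /favg ler_wpM2l ?invr_ge0 // big_nat [leRHS]big_nat; apply: ler_sum => n /andP[n0 _].
  exact: bound.
rewrite favgD !favgZ [leRHS]splitr; apply: lerD.
  by rewrite ler_piMr ?divr_ge0 ?(ltW e0) //; exact: favg_cst.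
by move: hL; set q := favg _ L; lra.
Qed.

(** Along [alpha * n] the Fejér polynomial is a finite combination of characters. Their means are
    the parameter [z], so the lemma serves both the vanishing and the nonvanishing case. *)
Lemma fejer_mean alpha s t N (z : int -> R[i]) :
  (forall k : int, vanish (fun L =>
     normc (favg (fun n => expi ((s + 2 * pi * k%:~R * alpha) * n%:R)) L - z k))) ->
  vanish (fun L => normc (favg (fun n => expi (s * n%:R) * fejer t N (alpha * n%:R)) L -
    N%:R^-1 * \sum_(j < N) expi (- t * (j%:R / N%:R)) * (N%:R^-1 *
      \sum_(k < N) \sum_(l < N) expi (- (2 * pi * (k%:Z - l%:Z)%:~R * (j%:R / N%:R))) * z (k%:Z - l%:Z)))).
Proof.
move=> hz; pose A (k : int) L := favg (fun n => expi ((s + 2 * pi * k%:~R * alpha) * n%:R)) L.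
pose err L := N%:R^-1 * \sum_(j < N) (N%:R^-1 * \sum_(k < N) \sum_(l < N)
  normc (A (k%:Z - l%:Z) L - z (k%:Z - l%:Z))).
have verr : vanish err.
  apply: vanishZ; first by rewrite invr_ge0.
  apply: (vanish_sum (index_enum _)) => j _; apply: vanishZ; first by rewrite invr_ge0.
  apply: (vanish_sum (index_enum _)) => k _; apply: (vanish_sum (index_enum _)) => l _.
  exact: hz.
apply: (vanish_le verr) => L.
have -> : favg (fun n => expi (s * n%:R) * fejer t N (alpha * n%:R)) L =
    N%:R^-1 * \sum_(j < N) expi (- t * (j%:R / N%:R)) * (N%:R^-1 *
      \sum_(k < N) \sum_(l < N) expi (- (2 * pi * (k%:Z - l%:Z)%:~R * (j%:R / N%:R))) * A (k%:Z - l%:Z) L).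
  rewrite (@eq_favg _ _ (fun n => N%:R^-1 * \sum_(j < N) expi (- t * (j%:R / N%:R)) * (N%:R^-1 *
      \sum_(k < N) \sum_(l < N) expi (- (2 * pi * (k%:Z - l%:Z)%:~R * (j%:R / N%:R))) *
      expi ((s + 2 * pi * (k%:Z - l%:Z)%:~R * alpha) * n%:R)))).
    rewrite favgZ favg_sum; congr (_ * _); apply: eq_bigr => j _.
    rewrite favgZ favgZ favg_sum; congr (_ * (_ * _)); apply: eq_bigr => k _.
    by rewrite favg_sum; apply: eq_bigr => l _; rewrite favgZ.
  move=> n _; rewrite /fejer mulrCA; congr (_ * _); rewrite mulr_sumr; apply: eq_bigr => j _.
  rewrite mulrCA; congr (_ * _); rewrite fejer_kernelE mulrCA; congr (_ * _).
  rewrite mulr_sumr; apply: eq_bigr => k _; rewrite mulr_sumr; apply: eq_bigr => l _.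
  by rewrite -!expiD; congr expi; ring.
rewrite -mulrBr -sumrB ComplexField.Normc.normcM normc_natV ler_wpM2l ?invr_ge0 //.
apply: le_trans (normc_sum _ _ _) _; apply: ler_sum => j _.
rewrite -mulrBr ComplexField.Normc.normcM normc_expi mul1r -mulrBr ComplexField.Normc.normcM.
rewrite normc_natV ler_wpM2l ?invr_ge0 // -sumrB.
apply: le_trans (normc_sum _ _ _) _; apply: ler_sum => k _; rewrite -sumrB.
apply: le_trans (normc_sum _ _ _) _; apply: ler_sum => l _.
by rewrite -mulrBr ComplexField.Normc.normcM normc_expi mul1r.
Qed.

End Floor_of_multiples.

(** * Means of powers with exponent [floor (alpha * n)] *)

Section Floor_power_averages.
Context {R : realType}.
Implicit Types (alpha t : R).

Let fphi alpha (n : int) : int := Num.floor (alpha * n%:~R).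

Lemma floor_power_avgE alpha t L : power_avg (expi t) (fphi alpha) L =
  favg (fun n => expi (t * alpha * n%:R) * expi (- t * frac (alpha * n%:R))) L.
Proof.
by apply: eq_favg => n _; rewrite /fphi expi_floor mulrA.
Qed.

(** Once the factor depending on [frac (alpha * n)] is replaced by its Fejér polynomial, only the
    characters of the hypothesis remain, all nontrivial. *)
Lemma floor_power_avg_vanish alpha t : irrational alpha ->
  (forall k : int, expi ((t * alpha + 2 * pi * k%:~R * alpha)) != 1) ->
  vanish (fun L => normc (power_avg (expi t) (fphi alpha) L)).
Proof.
move=> irr hk; apply: vanish_approx => e e0.
have [N N0 hN] := fejer_density_approx t irr e0.
exists (fun L => normc (favg (fun n => expi (t * alpha * n%:R) * fejer t N (alpha * n%:R)) L)).
  have hz k : vanish (fun L =>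
      normc (favg (fun n => expi ((t * alpha + 2 * pi * k%:~R * alpha) * n%:R)) L - (fun=> 0) k)).
    by apply: (vanish_le (vanish_expi (hk k))) => L; rewrite subr0.
  apply: (vanish_le (fejer_mean t N hz)) => L.
  rewrite [X in _ - X](_ : _ = 0) ?subr0 // big1 ?mulr0 // => j _; rewrite big1 ?mulr0 // => i _.
  by rewrite big1 // => l _; rewrite mulr0.
apply: filterS hN => L hL; rewrite floor_power_avgE -[X in normc X](subrK
  (favg (fun n => expi (t * alpha * n%:R) * fejer t N (alpha * n%:R)) L)) addrC.
apply: le_trans (le_normcD _ _) _; rewrite lerD2l normcB_comm.
apply: le_trans hL; rewrite /favg -mulrBr -sumrB.
apply: le_trans (normc_favg _ _) _; apply: ler_favg => n _.
by rewrite -mulrBr ComplexField.Normc.normcM normc_expi mul1r.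
Qed.

(* The mean of [expi (- c * frac (alpha * n))] is the integral of [expi (- c * y)] over
   the unit interval, here compared with its Riemann sums, which are geometric. *)
Lemma floor_power_avg_large alpha c : irrational alpha ->
  (exists p : int, c * alpha = 2 * pi * p%:~R) -> expi c != 1 ->
  ~ vanish (fun L => normc (power_avg (expi c) (fphi alpha) L)).
Proof.
move=> irr [p cp] c1 vc; pose e := normc (1 - expi (- c)).
have e0 : 0 < e.
  rewrite lt_neqAle normc_ge0 andbT eq_sym normc_eq0 subr_eq0 eq_sym.
  by apply: contra c1 => /eqP h; rewrite -[c]opprK expiN h conjc1.
have c0 : 0 < `|c| + 1 by rewrite ltr_wpDl.
pose b := e / (`|c| + 1) / 4; have b0 : 0 < b by rewrite !divr_gt0.
have [N N0 hN] := fejer_density_approx c irr b0.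
(* As [c * alpha] is an integer multiple of [2 pi], only the frequency [k = 0] has a nonzero mean,
   and the mean of the Fejér approximation is this Riemann sum. *)
pose m : R[i] := N%:R^-1 * \sum_(j < N) expi (- c * (j%:R / N%:R)).
have mE : N%:R^-1 * \sum_(j < N) expi (- c * (j%:R / N%:R)) * (N%:R^-1 *
      \sum_(k < N) \sum_(l < N) expi (- (2 * pi * (k%:Z - l%:Z)%:~R * (j%:R / N%:R))) *
        (k%:Z - l%:Z == 0)%:R) = m.
  congr (_ * _); apply: eq_bigr => j _; rewrite [X in _ * X](_ : _ = 1) ?mulr1 //.
  rewrite (eq_bigr (fun=> 1)) => [|k _]; first by rewrite sumr_const card_ord mulVf // pnatr_eq0 -lt0n.
  rewrite (bigD1 k) //= subrr eqxx mulr0 mul0r oppr0 expi0 mulr1 big1 ?addr0 // => l lk.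
  rewrite subr_eq0 eqz_nat; case: eqP => [kl|_]; last by rewrite mulr0.
  by move/eqP: lk; case; apply: val_inj.
have hm : vanish (fun L => normc (favg (fun n => expi (c * alpha * n%:R) * fejer c N (alpha * n%:R)) L - m)).
  rewrite -mE; apply: (@fejer_mean R alpha _ c N (fun k => (k == 0)%:R)) => k.
  have cE n : expi ((c * alpha + 2 * pi * k%:~R * alpha) * n%:R) = expi (2 * pi * k%:~R * alpha * n%:R).
    by rewrite cp mulrDl expiD -[2 * pi * p%:~R * _]mulrA (pmulrn 1 n) -intrM expi_2pi_int mul1r.
  apply: (@vanish_le _ _ (fun L => normc (favg (fun n => expi (2 * pi * k%:~R * alpha * n%:R)) L - (k == 0)%:R))).
    have [->|k0] := eqVneq k 0.
      move=> r r0; near=> L; have L0 : (0 < L)%N by near: L; exact: nbhs_infty_gt.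
      rewrite (@eq_favg _ _ (fun=> 1)) => [|n _]; last by rewrite mulr0 !mul0r expi0.
      by rewrite favg_cst1 // subrr normc0E ltW.
    under eq_fun do rewrite subr0.
    apply: vanish_expi; apply/eqP; rewrite -mulrA => /expi_eq1 h.
    by apply: (irrational_mul_int irr k0 (m := Num.floor (k%:~R * alpha))); rewrite mulrC.
  move=> L; rewrite (@eq_favg _ _ (fun n => expi (2 * pi * k%:~R * alpha * n%:R))) //.
have small : normc m <= 3 * b.
  have h : \forall L \near \oo, normc m <= 3 * b.
    apply: filterS3 hN (hm _ b0) (vc _ b0) => L h1 h2 h3.
    have h4 : normc (favg (fun n => expi (c * alpha * n%:R) * fejer c N (alpha * n%:R)) L -
        power_avg (expi c) (fphi alpha) L) <= b.
      apply: le_trans h1; rewrite floor_power_avgE /favg -mulrBr -sumrB.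
      apply: le_trans (normc_favg _ _) _; apply: ler_favg => n _.
      by rewrite -mulrBr ComplexField.Normc.normcM normc_expi mul1r.
    move: h2 h3 h4; set F := favg _ L; set P := power_avg _ _ L => h2 h3 h4.
    have -> : m = (m - F) + ((F - P) + P) by rewrite subrK subrK.
    apply: le_trans (le_normcD _ _) _; have := le_normcD (F - P) P.
    by move: h2; rewrite normcB_comm; lra.
  by have [L _ hL] := h; exact: (hL L (leqnn L)).
(* The geometric sum is [(1 - expi (- c)) / (1 - z)] with [|1 - z| <= |c| / N]. The choice of [b]
   makes the same quantity at most [3 e / 4], a contradiction. *)
have geom : e <= `|c| * normc m.
  pose z := expi (- c / N%:R).
  have NN : N%:R != 0 :> R by rewrite pnatr_eq0 -lt0n.
  have zj j : expi (- c * (j%:R / N%:R)) = z ^+ j by rewrite /z expiX; congr expi; ring.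
  have zN : z ^+ N = expi (- c) by rewrite /z expiX divfK.
  have -> : e = normc (1 - z) * normc (\sum_(j < N) z ^+ j).
    rewrite -ComplexField.Normc.normcM /e -zN; congr normc.
    by rewrite -[RHS]opprK -mulNr opprB -subrX1 opprB.
  have -> : normc m = N%:R^-1 * normc (\sum_(j < N) z ^+ j).
    by rewrite /m ComplexField.Normc.normcM normc_natV (eq_bigr _ (fun (j : 'I_N) _ => zj j)).
  rewrite mulrA ler_wpM2r ?normc_ge0 //; apply: (@le_trans _ _ `|- c / N%:R|).
    by rewrite normcB_comm normc_expiB1.
  by rewrite normrM normrN normfV [`|N%:R|]ger0_norm.
have : `|c| * normc m <= 3 * (e / 4).
  apply: le_trans (ler_wpM2l (normr_ge0 c) small) _.
  have : `|c| * b <= e / 4.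
    rewrite /b mulrA ler_wpM2r // mulrA ler_pdivrMr // mulrC ler_wpM2l ?(ltW e0) //.
    by rewrite lerDl.
  by move=> cb; rewrite [leLHS]mulrCA; apply: ler_wpM2l.
by move: geom e0; clear; lra.
Unshelve. all: by end_near. Qed.

Lemma floor_gen_linear_int alpha : gen_linear_int R (fphi alpha).
Proof.
exists (fun x => (Num.floor (alpha * x + 0))%:~R).
  by apply: gen_linear_floor; exact: gen_linear_affine.
by move=> n; rewrite addr0.
Qed.

Lemma floor_unbounded alpha : alpha != 0 -> unbounded (fphi alpha).
Proof.
move=> a0 [M hM]; pose B : R := (M%:~R + 1) / `|alpha|.
have a1 : 0 < `|alpha| by rewrite normr_gt0.
pose n := (Num.truncn B).+1.
have : B < n%:R by exact: Num.Theory.truncnS_gt.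
rewrite ltr_pdivrMr // => h.
have : M%:~R + 1 < `|alpha * n%:R| by rewrite normrM [`|n%:R|]ger0_norm // mulrC.
have := hM n; rewrite -(ler_int R) intr_norm /fphi -pmulrn => hMn.
have /andP[f1 f2] := floor_itv (alpha * n%:R).
rewrite ltNge => /negP; apply.
rewrite -[X in `|X|](subrK (Num.floor (alpha * n%:R))%:~R) addrC.
apply: le_trans (ler_normD _ _) _; apply: lerD => //.
by rewrite ger0_norm ?subr_ge0 // lerBlDl ltW // -[X in _ + X]/(1%:~R) -intrD.
Qed.

End Floor_power_averages.

(** * Assembly of the two equivalences *)

Unset Implicit Arguments.

Theorem corollary0p6 (d : measure_display) (X : measurableType d)
    (R : realType) (mu : probability X R) (k : nat) (hk : (0 < k)%N)
    (T : 'I_k -> mp_aut mu) (hcomm : commuting T) (hT : jointly_ergodic T) :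
  (forall phi : int -> int, gen_linear_int R phi -> unbounded phi ->
     jointly_ergodic_along T phi <->
     (forall l : R[i], (joint_Eig T `\ 1) l ->
        power_avg l phi N @[N --> \oo] --> (0 : R[i]^o)))
  /\
  (forall alpha : R, irrational alpha ->
     jointly_ergodic_along T (fun n : int => Num.floor (alpha * n%:~R)) <->
     [set expi (2 * pi * (alpha^-1 * ratr q)) | q in [set: rat]]
       `&` joint_Eig T = [set 1]).
Proof.
have je : joint_along T Posz by apply/(jointly_ergodic_alongP T id).
have part1 (phi : int -> int) : gen_linear_int R phi -> unbounded phi ->
    jointly_ergodic_along T phi <-> (forall l, joint_Eig T l -> l != 1 ->
      vanish (fun N => normc (power_avg l phi N))).
  move=> gphi uphi; split=> [/jointly_ergodic_alongP jphi l El l1|pow].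
    exact: power_avg_of_joint_along je jphi El l1.
  by apply/jointly_ergodic_alongP; exact: joint_along_gen_linear.
split=> [phi gphi uphi|alpha irr].
  split=> [jphi l [El l1]|pow].
    apply/normc_cvg0; apply: (part1 phi gphi uphi).1 => //.
    by apply/eqP => l1'; exact: l1.
  apply/(part1 phi gphi uphi) => l El l1; apply/normc_cvg0; apply: pow; split=> //.
  by move=> l1'; move/eqP: l1.
have a0 := irrational_neq0 irr.
have JE1 : joint_Eig T 1.
  by exists (fun=> 1); [move=> i; exact: Eig1|rewrite big1].
have floor1 := part1 _ (floor_gen_linear_int alpha) (floor_unbounded a0).
have JE_unit l : joint_Eig T l -> exists t, l = expi t.
  move=> [m Em <-]; apply: unit_expi; rewrite normc_prod big1 // => i _.
  exact: Eig_normc (Em i).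
have JEX l n : joint_Eig T l -> joint_Eig T (l ^+ n).
  move=> [m Em <-]; exists (fun i => m i ^+ n); last by rewrite prodrXl.
  by move=> i; apply: EigX => //; exact: (@ergodic_of_joint _ _ _ _ _ T je i).
split=> [/floor1 pow|E1]; last first.
  apply/floor1 => l El l1; have [t lt] := JE_unit l El; rewrite lt.
  apply: floor_power_avg_vanish => // j; apply/eqP => tj; move/eqP: l1; apply.
  (* A trivial character puts [t + 2 pi j] in [2 pi / alpha] times the integers, so [l] lies in the
     intersection and must be 1. *)
  have [i ti] : exists i : int, t * alpha + 2 * pi * j%:~R * alpha = 2 * pi * i%:~R.
    have pi2 : 2 * pi != 0 :> R by rewrite gt_eqF // mulr_gt0 ?pi_gt0.
    exists (Num.floor ((t * alpha + 2 * pi * j%:~R * alpha) / (2 * pi))).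
    rewrite -expi_eq1; first by rewrite [RHS]mulrC divfK.
    by rewrite [2 * pi * _]mulrC divfK.
  suff : [set 1 : R[i]] l by [].
  rewrite -E1; split=> //; exists (i%:~R) => //; rewrite lt ratr_int.
  have -> : 2 * pi * (alpha^-1 * i%:~R) = t + 2 * pi * j%:~R.
    apply: (mulIf a0); rewrite [RHS]mulrDl ti.
    by rewrite -[LHS]mulrA [alpha^-1 * _]mulrC divfK.
  by rewrite expiD expi_2pi_int mulr1.
apply/seteqP; split=> [l [[q _ ql] El]|_ ->] /=; last first.
  by split=> //; exists 0 => //; rewrite rmorph0 !mulr0 expi0.
apply/eqP/negPn/negP => l1; pose c := 2 * pi * (alpha^-1 * (numq q)%:~R).
have s0 : (0 < `|denq q|)%N by rewrite absz_gt0 denq_eq0.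
(* When [q] is not an integer the mean for [l] itself does vanish. Its power by the denominator of
   [q] is a joint eigenvalue with integer exponent, still different from 1 because [alpha] is
   irrational, and its mean does not vanish. *)
have lc : l ^+ `|denq q|%N = expi c.
  rewrite -ql expiX; congr expi; rewrite /c -!mulrA; congr (_ * (_ * (_ * _))).
  by rewrite (pmulrn 1 `|denq q|%N) absz_denq mulVf ?mulr1 // intr_eq0 denq_eq0.
have p0 : numq q != 0.
  apply: contra l1; rewrite numq_eq0 => /eqP q0.
  by rewrite -ql q0 rmorph0 !mulr0 expi0.
have c1 : expi c != 1.
  apply/eqP => /expi_eq1 e.
  apply: (irrational_mul_int irr (p := Num.floor (alpha^-1 * (numq q)%:~R)) (m := numq q)).
    apply: contra p0 => /eqP f0; move: e; rewrite f0 => /eqP.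
    by rewrite mulf_eq0 invr_eq0 (negbTE a0) intr_eq0.
  by rewrite -e mulrA mulfV // mul1r.
apply: (@floor_power_avg_large R alpha c irr) => //.
  exists (numq q); rewrite /c -!mulrA; congr (_ * (_ * _)).
  by rewrite mulrCA mulVf ?mulr1 // mulrC.
by apply: pow => //; rewrite -lc; exact: JEX.
Qed.
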